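(* Let $N\ge 1$ be an integer, $p=2N+1$, $v=(v_n)_{n=1}^p\in\mathbb{R}^p$, and let $H=\Delta+V$ be the nanoribbon Schrödinger operator on $\ell^2(\Gamma)$ and $J_a$ the $p\times p$ Jacobi matrix defined in the context. i) The operator $H$ is unitarily equivalent to the direct integral $\int^{\oplus}_{[0,2\pi)}J_{a(t)}\,\frac{dt}{2\pi}$, where $a(t)=2|\cos\frac t2|$, acting on $\int^{\oplus}_{[0,2\pi)}\mathbb{C}^p\,\frac{dt}{2\pi}$. ii) Let $\lambda_{-N}(a)\le\lambda_{-N+1}(a)\le\dots\le\lambda_N(a)$ be the eigenvalues of $J_a$ (counted with multiplicity), $a\in[0,2]$. The spectrum of $H$ is $$\sigma(H)=\bigcup_{k=-N}^{N}\sigma_k,\qquad \sigma_k=\lambda_k([0,2])=\begin{cases}[\lambda_k^-,\lambda_k^+], & k\ge 0,\\ [\lambda_k^+,\lambda_k^-], & k<0\end{cases}$$ (i.e. $\sigma_k$ is a compact interval, possibly a single point, whose endpoints are denoted $\lambda_k^\pm$ in this way). Moreover, each $\lambda_k(\cdot)$ is real analytic in $a\in[0,2]$, and if $a\neq 0$, then $\lambda_{-N}(a)<\lambda_{-N+1}(a)<\dots<\lambda_N(a)$.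
   Context: Notation: $\mathbb{N}_k=\{1,\dots,k\}$, $p=2N+1$. The Hilbert space $\ell^2(\Gamma)$ consists of $f=(f_{n,k})_{(n,k)\in\mathbb{Z}\times\mathbb{N}_p}$ with $\|f\|^2=\sum|f_{n,k}|^2<\infty$. With the convention $f_{n,0}=f_{n,p+1}=0$ for all $n\in\mathbb{Z}$ (Dirichlet conditions), the operators $\Delta$ and $V$ are $$(\Delta f)_{n,2k+1}=f_{n,2k}+f_{n-1,2k+2}+f_{n,2k+2},\quad k=0,1,\dots,N,$$ $$(\Delta f)_{n,2k}=f_{n,2k-1}+f_{n+1,2k-1}+f_{n,2k+1},\quad k=1,\dots,N,$$ $$(Vf)_{n,k}=v_kf_{n,k},\quad (n,k)\in\mathbb{Z}\times\mathbb{N}_p,$$ and $H=\Delta+V$. The Jacobi matrix $J_a$ acts on $\mathbb{C}^p$ by $(J_ay)_n=a_{n-1}y_{n-1}+a_ny_{n+1}+v_ny_n$ for $1\le n\le p$, with $y_0=y_{p+1}=0$, where $a_n=a$ for odd $n$ and $a_n=1$ for even $n$. That is, $J_a$ is the symmetric tridiagonal matrix with diagonal $(v_1,\dots,v_p)$ and off-diagonal entries $(a,1,a,1,\dots,a,1)$. *)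

(* Defs.v *)
From HB Require Import structures.
From mathcomp Require Import all_boot all_order all_algebra.
From mathcomp Require Import complex.
From mathcomp Require Import all_classical all_reals all_analysis.

Set Implicit Arguments.
Unset Strict Implicit.
Unset Printing Implicit Defensive.

Import Order.TTheory GRing.Theory Num.Theory.
Import numFieldNormedType.Exports.

Local Open Scope classical_set_scope.
Local Open Scope ring_scope.
Local Open Scope complex_scope.

(* The strip Z x {1, ..., p} with p = 2N+1.  The ordinal i stands for the
   column k = i + 1. *)
Definition site (N : nat) := (int * 'I_(2 * N).+1)%type.

Section Sequences.
Variables (R : realType) (N : nat).
Implicit Types (f g : site N -> R[i]) (T B : (site N -> R[i]) -> site N -> R[i]).

(* Squared norm ||f||^2, possibly infinite for an arbitrary f. *)
Definition l2_sqnorm f : \bar R :=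
  \esum_(x in [set: site N]) (ComplexField.Normc.normc (f x) ^+ 2)%:E.

(* Membership in l^2(Gamma).  Operators are total maps on all sequences and
   only their values on l^2(Gamma) are ever used. *)
Definition l2 f : Prop := (l2_sqnorm f < +oo)%E.

Definition l2_bounded_linear T : Prop :=
  [/\ forall f, l2 f -> l2 (T f),
      forall (c : R[i]) f g, l2 f -> l2 g ->
        T (fun x => c * f x + g x) = (fun x => c * T f x + T g x)
    & exists M : R, forall f, l2 f ->
        (l2_sqnorm (T f) <= (M ^+ 2)%:E * l2_sqnorm f)%E].

Definition resolvent_set T : set R[i] :=
  [set z | exists B, [/\ l2_bounded_linear B,
      forall f, l2 f -> B (fun x => T f x - z * f x) = f
    & forall f, l2 f -> (fun x => T (B f) x - z * B f x) = f]].

Definition spectrum T : set R[i] := ~` resolvent_set T.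

(* f_{n,k} for k in {1, ..., p}, extended by f_{n,k} = 0 for every other k;
   in particular f_{n,0} = f_{n,p+1} = 0. *)
Definition dirichlet f (n : int) (k : nat) : R[i] :=
  if k is k'.+1 then oapp (fun i : 'I_(2 * N).+1 => f (n, i)) 0 (insub k')
  else 0.

Definition Delta f : site N -> R[i] := fun x =>
  let n := x.1 in let k := (x.2 : nat).+1 in
  if odd k
  then dirichlet f n k.-1 + dirichlet f (n - 1) k.+1 + dirichlet f n k.+1
  else dirichlet f n k.-1 + dirichlet f (n + 1) k.-1 + dirichlet f n k.+1.

Definition potential (v : 'rV[R]_((2 * N).+1)) f : site N -> R[i] :=
  fun x => (v 0 x.2)%:C * f x.

Definition schroedinger (v : 'rV[R]_((2 * N).+1)) f : site N -> R[i] :=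
  fun x => Delta f x + potential v f x.

End Sequences.

Definition jacobi_coef (R : realType) (a : R) (n : nat) : R :=
  if odd n then a else 1.

(* jacobi_coef a n is the coefficient a_n; row i is (J_a y)_n with n = i + 1. *)
Definition jacobi (R : realType) (N : nat) (v : 'rV[R]_((2 * N).+1)) (a : R) :
    'M[R]_((2 * N).+1) :=
  \matrix_(i, j)
    (if (i : nat) == j.+1 then jacobi_coef a i
     else if (j : nat) == i.+1 then jacobi_coef a i.+1
     else if i == j then v 0 i else 0).

Section DirectIntegral.
Variables (R : realType) (p : nat).
Implicit Types (g h : R -> 'cV[R[i]]_p).

Definition circle : set R := `[0, 2 * pi[%classic.

Definition ae_eq_fiber g h : Prop :=
  g = h %[ae @lebesgue_measure R in circle].

Definition dirint_sqnorm g : \bar R :=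
  (((2 * pi)^-1)%:E * \int[@lebesgue_measure R]_(t in circle)
     (\sum_(i < p) ComplexField.Normc.normc (g t i 0) ^+ 2)%:E)%E.

(* Representatives of the elements of the direct integral of C^p over
   [0, 2 pi) with respect to dt / 2 pi; two representatives define the same
   element when they are related by ae_eq_fiber. *)
Definition dirint g : Prop :=
  [/\ forall i, measurable_fun circle (fun t => complex.Re (g t i 0)),
      forall i, measurable_fun circle (fun t => complex.Im (g t i 0))
    & (dirint_sqnorm g < +oo)%E].

Definition dirint_op (A : R -> 'M[R[i]]_p) g : R -> 'cV[R[i]]_p :=
  fun t => A t *m g t.

End DirectIntegral.

(* U is a surjective linear isometry from l^2(Gamma) onto the direct integral
   of C^p, the latter being taken modulo almost everywhere equality. *)
Definition unitary (R : realType) (N p : nat)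
    (U : (site N -> R[i]) -> R -> 'cV[R[i]]_p) : Prop :=
  [/\ forall f, l2 f -> dirint (U f),
      forall (c : R[i]) f g, l2 f -> l2 g ->
        ae_eq_fiber (U (fun x => c * f x + g x))
                    (fun t => c *: U f t + U g t),
      forall f, l2 f -> dirint_sqnorm (U f) = l2_sqnorm f
    & forall g, dirint g -> exists2 f, l2 f & ae_eq_fiber (U f) g].

Definition unitarily_equivalent (R : realType) (N p : nat)
    (T : (site N -> R[i]) -> site N -> R[i])
    (S : (R -> 'cV[R[i]]_p) -> R -> 'cV[R[i]]_p) : Prop :=
  exists U : (site N -> R[i]) -> R -> 'cV[R[i]]_p, unitary U /\
    forall f, l2 f -> l2 (T f) /\ ae_eq_fiber (U (T f)) (S (U f)).

(* The values lam k, -N <= k <= N, are the eigenvalues of A in nondecreasing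
   order and with multiplicity.  Other values of lam are irrelevant. *)
Definition ordered_eigenvalues (R : realType) (N : nat)
    (A : 'M[R]_((2 * N).+1)) (lam : int -> R) : Prop :=
  char_poly A = \prod_(i < (2 * N).+1) ('X - (lam (i%:Z - N%:Z))%:P) /\
  forall j k : int, - N%:Z <= j -> j <= k -> k <= N%:Z -> lam j <= lam k.

(* Real analyticity on an interval I, which may contain its endpoints: around
   each point x0 of I, h agrees on I with a convergent power series.  Nothing
   is asked of h outside of I. *)
Definition real_analytic_on (R : realType) (I : interval R) (h : R -> R) :
    Prop :=
  forall x0, x0 \in I -> exists (r : R) (c : nat -> R), 0 < r /\
    forall x, x \in I -> `|x - x0| < r ->
      series (fun n => c n * (x - x0) ^+ n) @ \oo --> h x.

(* Main.v *)
Require Import Defs.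
From mathcomp Require Import all_boot all_order all_algebra.
From mathcomp Require Import complex.
From mathcomp Require Import all_classical all_reals all_analysis.
From mathcomp Require Import measurable_realfun ring lra zify.

Set Implicit Arguments.
Unset Strict Implicit.
Unset Printing Implicit Defensive.

Import Order.TTheory GRing.Theory Num.Theory.
Import numFieldNormedType.Exports.
Local Open Scope classical_set_scope.
Local Open Scope ring_scope.
Local Open Scope complex_scope.

(** A Fourier transform along the ribbon turns H into multiplication by p x p
    matrices, after which every claim is about the family J_a.

    Unitary equivalence.  In the Fourier variable t, a sum such as
    f_(n,k) + f_(n+1,k) becomes multiplication of column k by 1 + e^(-it), and
    1 + e^(it) = u(t) a(t) where u(t) has modulus one and
    a(t) = 2 |cos (t/2)| (lemma [phase_coupling]).  Multiplying column k by
    u^[k/2] absorbs the phases and leaves the real matrix J_(a(t)).  So the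
    orthonormal basis to use has its vectors supported on a single column k,
    equal there to u(t)^[k/2] e^(int).  Such a basis gives a unitary map
    ([fourier_unitary]): square summable coefficients can be summed because
    L^2 is complete ([synthesis]), and nothing is orthogonal to all the basis
    because the characters are complete ([chr_complete]).  That H acts on the
    coefficients as J_(a(t)) acts on the fibers is [coef_fiber].

    Spectrum.  If z lies on no band, then |det (z - J_a)| is the product of the
    |z - lam_k(a)|, which is bounded below on the compact interval [0, 2]; so
    the adjugate over the determinant is a bounded matrix valued function
    inverting z - J_(a(t)), and it provides the resolvent
    ([resolvent_off_bands]).  If z = lam_k(a) with a = a(s), an eigenvector of
    J_a cut off to a short arc after s is an approximate eigenvector
    ([bands_in_spectrum]).

    Bands.  For a <> 0 the off-diagonal entries of J_a do not vanish, so an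
    eigenvector is determined by its first coordinate and the spectrum is
    simple.  Analyticity rests on a theorem of Rellich, [analytic_roots]: a
    monic polynomial with all its roots real, whose coefficients depend
    analytically on one real parameter, has roots which can be chosen analytic
    near any given parameter.  It remains to see that an ordered eigenvalue is
    a single one of these branches.  Near a_0 <> 0 the branches stay distinct,
    and at a_0 = 0 only the side a >= 0 is in question, where two analytic
    functions always compare in one and the same way close to 0; in either case
    the order of the branches is constant ([band_germ]).  Continuity then makes
    each band a compact interval.

    Rellich's theorem is proved by induction on the degree.  Subtract the mean
    of the roots.  The coefficient of degree d - 2 is then minus half of the
    sum of the squares of the roots, hence of constant sign near 0, so that it
    vanishes to an even order 2q unless it vanishes identically, in which case
    all the roots are zero.  Every root is then O(t^q), and dividing the roots
    by t^q gives a polynomial, still with analytic coefficients, whose roots at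
    t = 0 are not all equal.  Its factorization into two coprime factors at
    t = 0 extends to an analytic factorization nearby ([analytic_hensel]), and
    both factors have smaller degree. *)

(** * Germs of real analytic functions *)

Section PowerSeries.
Variable R : realType.
Implicit Types (h g : R -> R) (c d : nat -> R).

Definition psum c (m : nat) (t : R) : R := \sum_(n < m) c n * t ^+ n.

(** The remainder of order m is required to be O(t^m) with geometric constants,
    rather than the series to converge.  Such bounds are at once equivalent to
    a convergent expansion and stable under products and under division by t,
    and they are what the recursive constructions below produce. *)
Definition has_ps h c : Prop := exists rho : R, 0 < rho /\ exists M : R,
  forall (m : nat) (t : R), `|t| < rho ->
    `|h t - psum c m t| <= M * (`|t| / rho) ^+ m.

Lemma psumS c m t : psum c m.+1 t = psum c m t + c m * t ^+ m.
Proof. by rewrite /psum big_ord_recr. Qed.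

Lemma psum0 c t : psum c 0 t = 0.
Proof. by rewrite /psum big_ord0. Qed.

Lemma psum1 c t : psum c 1 t = c 0%N.
Proof. by rewrite psumS psum0 add0r expr0 mulr1. Qed.

Lemma has_ps_shrink h h' c e rho M : 0 < e -> e <= rho ->
  (forall m t, `|t| < e -> `|h t - psum c m t| <= M * (`|t| / rho) ^+ m) ->
  (forall t, `|t| < e -> h' t = h t) ->
  forall m t, `|t| < e -> `|h' t - psum c m t| <= M * (`|t| / e) ^+ m.
Proof.
move=> e0 er H E m t te; rewrite E//; apply: le_trans (H _ _ te) _.
have M0 : 0 <= M.
  have := H 0%N t te; rewrite expr0 mulr1; exact: le_trans.
apply: ler_wpM2l => //; apply: lerXn2r; rewrite ?nnegrE ?divr_ge0 ?(ltW e0)//.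
  by rewrite (le_trans (ltW e0)).
by apply: ler_wpM2l => //; rewrite lef_pV2 ?posrE// (lt_le_trans e0).
Qed.

Lemma has_ps_near h h' c e : 0 < e -> (forall t, `|t| < e -> h' t = h t) ->
  has_ps h c -> has_ps h' c.
Proof.
move=> e0 E [rho [r0 [M H]]].
exists (Num.min e rho); split; first by rewrite lt_min e0.
exists M; apply: (@has_ps_shrink h h' c _ rho).
- by rewrite lt_min e0.
- by rewrite ge_min lexx orbT.
- by move=> m t; rewrite lt_min => /andP[_]; exact: H.
- by move=> t; rewrite lt_min => /andP[+ _]; exact: E.
Qed.

Lemma has_ps_common h c g d : has_ps h c -> has_ps g d ->
  exists e, 0 < e /\ exists M N, [/\ 0 <= M, 0 <= N,
   (forall m t, `|t| < e -> `|h t - psum c m t| <= M * (`|t| / e) ^+ m) &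
   (forall m t, `|t| < e -> `|g t - psum d m t| <= N * (`|t| / e) ^+ m)].
Proof.
move=> [r [r0 [M HM]]] [s [s0 [N HN]]].
have e0 : 0 < Num.min r s by rewrite lt_min r0.
exists (Num.min r s); split=> //; exists M, N; split.
- have := HM 0%N 0; rewrite normr0 expr0 mulr1 => /(_ r0); exact: le_trans.
- have := HN 0%N 0; rewrite normr0 expr0 mulr1 => /(_ s0); exact: le_trans.
- apply: (@has_ps_shrink h h c _ r) => //; first by rewrite ge_min lexx.
  by move=> m t; rewrite lt_min => /andP[+ _]; exact: HM.
- apply: (@has_ps_shrink g g d _ s) => //; first by rewrite ge_min lexx orbT.
  by move=> m t; rewrite lt_min => /andP[_]; exact: HN.
Qed.

(** Cauchy estimate: a coefficient is the difference of two consecutive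
    remainders, evaluated at half the radius. *)
Lemma has_ps_coef_le h c e M : 0 < e -> 0 <= M ->
  (forall m t, `|t| < e -> `|h t - psum c m t| <= M * (`|t| / e) ^+ m) ->
  forall m t, 0 <= t -> `|c m * t ^+ m| <= 2 * M * (t / e) ^+ m.
Proof.
move=> e0 M0 H m t t0.
suff C : `|c m| <= 2 * M * e^-1 ^+ m.
  rewrite normrM normrX (ger0_norm t0) expr_div_n mulrCA -exprVn mulrC.
  by apply: ler_wpM2l => //; apply: exprn_ge0.
have h0 : 0 < e / 2 by rewrite divr_gt0.
have he : `|e / 2| < e by rewrite gtr0_norm// ltr_pdivrMr// ltr_pMr// ltr1n.
have h1 := H m _ he; have h2 := H m.+1 _ he.
have : `|c m * (e / 2) ^+ m| <= 2 * M * (`|e / 2| / e) ^+ m.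
  have -> : c m * (e / 2) ^+ m =
    (h (e/2) - psum c m (e/2)) - (h (e/2) - psum c m.+1 (e/2)).
    by rewrite psumS; ring.
  apply: le_trans (ler_normB _ _) _; rewrite -mulrA mulrDl !mul1r lerD//.
  apply: le_trans h2 _; apply: ler_wpM2l => //.
  rewrite exprS ler_piMl ?exprn_ge0 ?divr_ge0 ?(ltW e0)//.
  by rewrite ler_pdivrMr// mul1r ltW.
rewrite normrM normrX (gtr0_norm h0) (expr_div_n (e / 2)) mulrA mulrAC -exprVn.
by rewrite ler_pM2r// exprn_gt0.
Qed.

(** Truncated Cauchy product, summed along the first factor. *)
Lemma psum_cauchy c d m t : psum (fun n => \sum_(i < n.+1) c i * d (n - i)%N) m t =
  \sum_(i < m) c i * t ^+ i * psum d (m - i) t.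
Proof.
elim: m => [|m IH]; first by rewrite psum0 big_ord0.
rewrite psumS IH [in RHS]big_ord_recr /= subSnn psum1 big_ord_recr /= subnn.
rewrite mulrDl mulr_suml addrA; congr (_ + _); last by rewrite mulrAC.
rewrite -big_split /=; apply: eq_bigr => i _.
rewrite subSn ?psumS ?mulrDr; last by rewrite ltnW.
have -> : t ^+ m = t ^+ (m - i) * t ^+ i by rewrite -exprD subnK// ltnW.
by ring.
Qed.

(** The remainder of the product is the remainder of h times g, plus the terms
    of h times remainders of g: at most 2m + 1 terms of size x^m.  Halving the
    radius turns x^m into (2x)^m and absorbs the factor 2m + 1. *)
Lemma has_psM h c g d : has_ps h c -> has_ps g d ->
  has_ps (fun t => h t * g t) (fun n => \sum_(i < n.+1) c i * d (n - i)%N).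
Proof.
move=> Hc Hd; have [e [e0 [M [N [M0 N0 HM HN]]]]] := has_ps_common Hc Hd.
have e20 : 0 < e / 2 by rewrite divr_gt0.
exists (e / 2); split=> //; exists (2 * (M * N)) => m t te2.
have te : `|t| < e by rewrite (lt_trans te2)// ltr_pdivrMr// ltr_pMr// ltr1n.
set x := `|t| / e; have x0 : 0 <= x by rewrite divr_ge0 // ltW.
have Cc i : `|c i * t ^+ i| <= 2 * M * x ^+ i.
  have := has_ps_coef_le e0 M0 HM i (normr_ge0 t).
  by rewrite !normrM !normrX normr_id.
have gN : `|g t| <= N.
  by have := HN 0%N t te; rewrite psum0 subr0 expr0 mulr1.
rewrite psum_cauchy.
have -> : h t * g t - \sum_(i < m) c i * t ^+ i * psum d (m - i) t =
   (h t - psum c m t) * g t + \sum_(i < m) c i * t ^+ i * (g t - psum d (m - i) t).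
  rewrite mulrBl -addrA; congr (_ + _); rewrite {2}/psum mulr_suml -sumrN -sumrN -big_split.
  by apply: eq_bigr => i _ /=; ring.
apply: le_trans (ler_normD _ _) _.
have -> : `|t| / (e / 2) = 2 * x by rewrite /x; field; rewrite gt_eqF.
have A1 : `|(h t - psum c m t) * g t| <= M * N * x ^+ m.
  rewrite normrM mulrAC; apply: ler_pM => //; exact: HM.
have A2 : `|\sum_(i < m) c i * t ^+ i * (g t - psum d (m - i) t)| <=
    (2 * m)%:R * (M * N) * x ^+ m.
  apply: le_trans (ler_norm_sum _ _ _) _.
  apply: (@le_trans _ _ (\sum_(i < m) 2 * (M * N) * x ^+ m)); last first.
    by rewrite sumr_const card_ord -mulr_natl natrM le_eqVlt; apply/orP; left; apply/eqP; ring.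
  apply: ler_sum => i _; rewrite normrM.
  have -> : x ^+ m = x ^+ (m - i) * x ^+ i by rewrite -exprD subnK// ltnW.
  have -> : 2 * (M * N) * (x ^+ (m - i) * x ^+ i) = 2 * M * x ^+ i * (N * x ^+ (m - i)) by ring.
  by apply: ler_pM => //; exact: HN.
apply: le_trans (lerD A1 A2) _; rewrite [(2 * x) ^+ m]exprMn.
have -> : M * N * x ^+ m + (2 * m)%:R * (M * N) * x ^+ m = (1 + 2 * m)%:R * (M * N * x ^+ m).
  by rewrite natrD natrM; ring.
have -> : 2 * (M * N) * (2 ^+ m * x ^+ m) = (2 * 2 ^ m)%:R * (M * N * x ^+ m).
  by rewrite natrM natrX; ring.
apply: ler_wpM2r; first by rewrite !mulr_ge0 ?exprn_ge0.
rewrite ler_nat; apply: (@leq_trans (2 * m.+1)); first by rewrite mulnS leq_add2r.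
by rewrite leq_pmul2l// ltn_expl.
Qed.

Lemma has_psD h c g d : has_ps h c -> has_ps g d ->
  has_ps (fun t => h t + g t) (fun n => c n + d n).
Proof.
move=> Hc Hd; have [e [e0 [M [N [M0 N0 HM HN]]]]] := has_ps_common Hc Hd.
exists e; split=> //; exists (M + N) => m t te.
have -> : psum (fun n => c n + d n) m t = psum c m t + psum d m t.
  by rewrite /psum -big_split; apply: eq_bigr => i _; rewrite mulrDl.
rewrite opprD addrACA (le_trans (ler_normD _ _))// mulrDl lerD//; [exact: HM|exact: HN].
Qed.

Lemma has_ps_cst (a : R) : has_ps (fun=> a) (fun n => if n is 0%N then a else 0).
Proof.
exists 1; split=> //; exists `|a| => -[|m] t t1.
  by rewrite psum0 subr0 expr0 mulr1.
have -> : psum (fun n => if n is 0%N then a else 0) m.+1 t = a.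
  by rewrite /psum big_ord_recl expr0 mulr1 big1 ?addr0// => i _; rewrite mul0r.
by rewrite subrr normr0 mulr_ge0 ?exprn_ge0// divr_ge0.
Qed.

Lemma has_ps_id : has_ps id (fun n => (n == 1%N)%:R).
Proof.
exists 1; split=> //; exists 1 => -[|[|m]] t t1; rewrite divr1 mul1r.
- by rewrite psum0 subr0 expr0 ltW.
- by rewrite psum1 subr0 expr1.
have -> : psum (fun n => (n == 1%N)%:R) m.+2 t = t.
  rewrite /psum 2!big_ord_recl mul0r mul1r add0r expr1 big1 ?addr0// => i _.
  by rewrite mul0r.
by rewrite subrr normr0 exprn_ge0.
Qed.

Lemma has_ps_sum (I : Type) (s : seq I) (hs : I -> R -> R) (cs : I -> nat -> R) :
  (forall i, has_ps (hs i) (cs i)) ->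
  has_ps (fun t => \sum_(i <- s) hs i t) (fun n => \sum_(i <- s) cs i n).
Proof.
move=> H; elim: s => [|i s IH].
  have := has_ps_cst 0; congr has_ps; apply/funext => x; rewrite big_nil//.
  by case: x.
by have := has_psD (H i) IH; congr has_ps; apply/funext => x; rewrite big_cons.
Qed.

Lemma has_ps0 h c : has_ps h c -> h 0 = c 0%N.
Proof.
move=> [r [r0 [M H]]]; have := H 1%N 0; rewrite normr0 psum1 mul0r expr1 mulr0.
by move=> /(_ r0); rewrite normr_le0 subr_eq0 => /eqP.
Qed.

Lemma has_ps_uniq h g c : has_ps h c -> has_ps g c ->
  exists e, 0 < e /\ forall t, `|t| < e -> h t = g t.
Proof.
move=> Hc Hd; have [e [e0 [M [N [M0 N0 HM HN]]]]] := has_ps_common Hc Hd.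
exists e; split=> // t te; apply/eqP; rewrite -subr_eq0 -normr_le0.
set x := `|t| / e; have x0 : 0 <= x by rewrite divr_ge0 // ltW.
have x1 : `|x| < 1 by rewrite ger0_norm// /x ltr_pdivrMr// mul1r.
have B m : `|h t - g t| <= (M + N) * x ^+ m.
  have -> : h t - g t = (h t - psum c m t) - (g t - psum c m t) by ring.
  by rewrite (le_trans (ler_normB _ _))// mulrDl lerD//; [exact: HM|exact: HN].
have C : (M + N) * x ^+ m @[m --> \oo] --> (M + N) * 0.
  by apply: cvgM; [exact: cvg_cst|exact: cvg_expr].
rewrite mulr0 in C; rewrite -(cvg_lim _ C)//.
apply: limr_ge; first by apply/cvg_ex; exists 0.
by near=> m; exact: B.
Unshelve. all: by end_near.
Qed.

Definition analytic0 h : Prop := exists c, has_ps h c.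

Lemma analytic0_near h h' e : 0 < e -> (forall t, `|t| < e -> h' t = h t) ->
  analytic0 h -> analytic0 h'.
Proof. by move=> e0 E [c Hc]; exists c; exact: has_ps_near e0 E Hc. Qed.

Lemma analytic0_cst a : analytic0 (fun=> a).
Proof. by eexists; exact: has_ps_cst. Qed.

Lemma analytic0_id : analytic0 id.
Proof. by eexists; exact: has_ps_id. Qed.

Lemma analytic0D h g : analytic0 h -> analytic0 g -> analytic0 (fun t => h t + g t).
Proof. by move=> [c Hc] [d Hd]; eexists; exact: has_psD Hc Hd. Qed.

Lemma analytic0M h g : analytic0 h -> analytic0 g -> analytic0 (fun t => h t * g t).
Proof. by move=> [c Hc] [d Hd]; eexists; exact: has_psM Hc Hd. Qed.

Lemma analytic0N h : analytic0 h -> analytic0 (fun t => - h t).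
Proof.
move=> Hh; have := analytic0M (analytic0_cst (-1)) Hh.
by congr analytic0; apply/funext => t; rewrite mulN1r.
Qed.

Lemma analytic0B h g : analytic0 h -> analytic0 g -> analytic0 (fun t => h t - g t).
Proof. by move=> Hh Hg; apply: analytic0D => //; exact: analytic0N. Qed.

Lemma analytic0X h n : analytic0 h -> analytic0 (fun t => h t ^+ n).
Proof.
move=> Hh; elim: n => [|n IH]; first by under eq_fun do rewrite expr0; exact: analytic0_cst.
by under eq_fun do rewrite exprS; exact: analytic0M.
Qed.

Lemma analytic0_sum (I : Type) (s : seq I) (P : pred I) (hs : I -> R -> R) :
  (forall i, P i -> analytic0 (hs i)) -> analytic0 (fun t => \sum_(i <- s | P i) hs i t).
Proof.
move=> H; elim: s => [|i s IH].
  by under eq_fun do rewrite big_nil; exact: analytic0_cst.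
under eq_fun do rewrite big_cons.
by have := H i; case: (P i) => // /(_ isT) Hi; exact: analytic0D.
Qed.

Lemma analytic0_cont h : analytic0 h -> forall eps, 0 < eps ->
  exists del, 0 < del /\ forall t, `|t| < del -> `|h t - h 0| < eps.
Proof.
move=> [c Hc] eps eps0; have [r [r0 [M H]]] := Hc.
have M0 : 0 <= M by have := H 0%N 0; rewrite normr0 expr0 mulr1 => /(_ r0); exact: le_trans.
have d0 : 0 < eps * r / (M + 1) by rewrite !mulr_gt0 ?invr_gt0// ltr_wpDl.
exists (Num.min r (eps * r / (M + 1))); split; first by rewrite lt_min r0.
move=> t; rewrite lt_min => /andP[tr te].
have := H 1%N t tr; rewrite psum1 -(has_ps0 Hc) expr1 => /le_lt_trans; apply.
move: te; rewrite ltr_pdivlMr ?ltr_wpDl// mulrA ltr_pdivrMr// => te.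
by apply: le_lt_trans te; rewrite mulrC ler_wpM2l// lerDl.
Qed.

(** The quotient takes the value c 1 at 0, where h t / t has no meaning. *)
Lemma has_ps_div h c : has_ps h c -> c 0%N = 0 ->
  exists g, has_ps g (fun n => c n.+1) /\ forall t, h t = t * g t.
Proof.
move=> Hc c0; exists (fun t => if t == 0 then c 1%N else h t / t); split; last first.
  move=> t; case: eqP => [->|/eqP t0]; first by rewrite mul0r (has_ps0 Hc).
  by rewrite mulrCA divff ?mulr1.
have [r [r0 [M H]]] := Hc.
have M0 : 0 <= M by have := H 0%N 0; rewrite normr0 expr0 mulr1 => /(_ r0); exact: le_trans.
exists r; split=> //; exists (M / r + `|c 1%N|) => m t tr.
case: eqP => [->|/eqP t0].
  case: m => [|m]; last first.
    rewrite normr0 /psum big_ord_recl /= expr0 mulr1 big1 ?addr0 ?subrr ?normr0; last first.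
      by move=> i _; rewrite exprS mul0r mulr0.
    by rewrite mul0r exprS mul0r mulr0.
  by rewrite psum0 subr0 expr0 mulr1 lerDr divr_ge0// ltW.
have -> : h t / t - psum (fun n => c n.+1) m t = (h t - psum c m.+1 t) / t.
  rewrite mulrBl; congr (_ - _); rewrite {2}/psum big_ord_recl c0 mul0r add0r mulr_suml.
  by apply: eq_bigr => i _; rewrite lift0 -mulrA exprSr mulfK.
rewrite normrM normfV ler_pdivrMr ?normr_gt0//.
apply: le_trans (H _ _ tr) _.
have -> : (M / r + `|c 1%N|) * (`|t| / r) ^+ m * `|t| =
    M * (`|t| / r) ^+ m.+1 + `|c 1%N| * (`|t| / r) ^+ m * `|t| by rewrite exprSr; ring.
by rewrite lerDl !mulr_ge0 ?exprn_ge0 ?divr_ge0 // ltW.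
Qed.

Lemma has_ps_divn h c k : has_ps h c -> (forall i, (i < k)%N -> c i = 0) ->
  exists g, has_ps g (fun n => c (k + n)%N) /\ forall t, h t = t ^+ k * g t.
Proof.
elim: k h c => [|k IH] h c Hc c0.
  by exists h; split=> // t; rewrite mul1r.
have [g [Hg hg]] := has_ps_div Hc (c0 0%N isT).
have [g' [Hg' hg']] := IH g _ Hg (fun i ik => c0 i.+1 ik).
by exists g'; split=> // t; rewrite hg hg' mulrA exprS.
Qed.

(** The order of vanishing is the index of the first nonzero coefficient; when
    there is none, h vanishes on a neighbourhood. *)
Lemma analytic0_order h : analytic0 h ->
  (exists e, 0 < e /\ forall t, `|t| < e -> h t = 0) \/
  (exists k g, [/\ analytic0 g, g 0 != 0 & forall t, h t = t ^+ k * g t]).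
Proof.
move=> [c Hc]; have [ex|] := pselect (exists n, c n != 0); last first.
  move=> /forallNP c0; left.
  have E : c = (fun n => if n is 0%N then 0 else 0).
    by apply/funext => n; have /negP/negPn/eqP -> := c0 n; case: n.
  by apply: has_ps_uniq (Hc) _; rewrite E; exact: has_ps_cst.
right; case: (ex_minnP ex) => k ck kmin.
have [i ik|g [Hg hg]] := has_ps_divn Hc (k := k).
  by apply/eqP; apply: contraTT ik => /kmin; rewrite -leqNgt.
exists k, g; split=> //; first by eexists; exact: Hg.
by rewrite (has_ps0 Hg) addn0.
Qed.

(** The bound excludes an order of vanishing smaller than n: otherwise h would
    be of size |t|^k with k < n, too large at a small enough t > 0. *)
Lemma analytic0_vanish h n C e : analytic0 h -> 0 < e ->
  (forall t, t != 0 -> `|t| < e -> `|h t| <= C * `|t| ^+ n) ->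
  exists g, analytic0 g /\ forall t, h t = t ^+ n * g t.
Proof.
move=> Hh e0 hC.
have [[d [d0 hz]]|[k [g [Hg g0 hg]]]] := analytic0_order Hh.
  exists (fun t => if t == 0 then 0 ^+ n * h 0 else h t / t ^+ n); split.
    apply: (@analytic0_near (fun=> 0) _ d) => //; last exact: analytic0_cst.
    by move=> t td; rewrite !hz ?normr0// mulr0 mul0r if_same.
  move=> t; case: eqP => [->|/eqP t0].
    by rewrite hz ?normr0// !mulr0.
  by rewrite mulrC divfK// expf_neq0.
have [nk|kn] := leqP n k.
  exists (fun t => t ^+ (k - n) * g t); split.
    by apply: analytic0M => //; apply: analytic0X; exact: analytic0_id.
  by move=> t; rewrite hg mulrA -exprD subnKC.
exfalso.
have g20 : 0 < `|g 0| / 2 by rewrite divr_gt0// normr_gt0.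
have [d [d0 dg]] := analytic0_cont Hg g20.
have C0 : 0 <= `|C| by [].
pose t := Num.min (Num.min (e / 2) (d / 2)) (Num.min (1 / 2) (`|g 0| / 2 / (`|C| + 1))).
have t0 : 0 < t by rewrite !lt_min !divr_gt0 ?normr_gt0 ?ltr_wpDl.
have te : t < e by have h' : e / 2 < e; [lra|rewrite /t !gt_min h'].
have td : t < d by have h' : d / 2 < d; [lra|rewrite /t !gt_min h' !orbT].
have t1 : t <= 1 by have h' : 1 / 2 <= 1 :> R; [lra|rewrite /t !ge_min h' !orbT].
have tC : t * (`|C| + 1) <= `|g 0| / 2.
  by rewrite -ler_pdivlMr ?ltr_wpDl// /t !ge_min lexx !orbT.
have := hC t; rewrite gt_eqF// gtr0_norm// => /(_ isT te).
rewrite hg normrM normrX gtr0_norm// -(subnKC (ltnW kn)) exprD mulrCA ler_pM2l ?exprn_gt0//.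
move: kn; rewrite -subn_gt0; case: (n - k)%N => // m _ gle.
have := dg t; rewrite gtr0_norm// => /(_ td) gd.
have t2 : C * t ^+ m.+1 <= t * (`|C| + 1).
  rewrite exprS mulrCA ler_pM2l//.
  apply: (@le_trans _ _ (`|C| * 1)); last by rewrite mulr1 lerDl.
  apply: (@le_trans _ _ (`|C| * t ^+ m)); first by rewrite ler_wpM2r ?exprn_ge0 ?(ltW t0)// ler_norm.
  by rewrite ler_wpM2l// exprn_ile1// ltW.
have := ler_normB (g t) (g t - g 0); rewrite subKr; lra.
Qed.

(** Coefficients of geometric growth define a germ, by summing the series at
    half the radius of convergence. *)
Lemma analytic0_of_coef c (C rho : R) : 0 < rho -> (forall n, `|c n| <= C / rho ^+ n) ->
  exists h, has_ps h c.
Proof.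
move=> r0 Hc; exists (fun t => limn (psum c ^~ t)); exists (rho / 2).
split; first by rewrite divr_gt0.
have C0 : 0 <= C by have := Hc 0%N; rewrite expr0 divr1; exact: le_trans.
exists (2 * C) => m t tr.
set x := `|t| / rho; have x0 : 0 <= x by rewrite divr_ge0// ltW.
have x1 : x <= 2^-1 by rewrite ler_pdivrMr// mulrC ltW.
have term n : `|c n * t ^+ n| <= C * x ^+ n.
  rewrite normrM normrX /x expr_div_n mulrCA mulrC.
  by rewrite ler_wpM2l ?exprn_ge0.
have tail k : `|psum c (m + k) t - psum c m t| <= 2 * C * x ^+ m * (1 - 2^-1 ^+ k).
  elim: k => [|k IH]; first by rewrite addn0 subrr normr0 expr0 subrr mulr0.
  rewrite addnS psumS addrAC (le_trans (ler_normD _ _))//.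
  have := lerD IH (term (m + k)%N); move/le_trans; apply.
  rewrite exprD exprS.
  have xk : x ^+ k <= 2^-1 ^+ k by rewrite lerXn2r// nnegrE.
  have := ler_wpM2l (mulr_ge0 C0 (exprn_ge0 m x0)) xk.
  set X := x ^+ m; set Y := x ^+ k; set Z := _ ^+ k; rewrite -mulrA; lra.
have cv : cvgn (psum c ^~ t).
  have -> : psum c ^~ t = series (fun n => c n * t ^+ n).
    by apply/funext => k; rewrite /psum /series /= big_mkord.
  apply: normed_cvg; apply: (@series_le_cvg _ _ (geometric C x)) => //.
  - by move=> n /=.
  - by move=> n; rewrite /= mulr_ge0 ?exprn_ge0.
  - apply: is_cvg_geometric_series; rewrite ger0_norm//; lra.
apply: (@le_trans _ _ (2 * C * x ^+ m)); last first.
  rewrite ler_wpM2l ?mulr_ge0// lerXn2r ?nnegrE ?divr_ge0 ?(ltW r0)//.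
  by rewrite /x ler_wpM2l// lef_pV2 ?posrE ?divr_gt0// ler_pdivrMr// ler_pMr// ler1n.
have cv2 : (fun k => `|psum c k t - psum c m t|) @ \oo --> `|limn (psum c ^~ t) - psum c m t|.
  by apply: cvg_norm; apply: cvgB => //; exact: cvg_cst.
rewrite -(cvg_lim _ cv2)//; apply: limr_le; first by apply/cvg_ex; eexists; exact: cv2.
near=> k.
have mk : (m <= k)%N by near: k; exact: nbhs_infty_ge.
rewrite -(subnKC mk); apply: le_trans (tail _) _.
by rewrite ler_piMr ?mulr_ge0 ?exprn_ge0// gerBl exprn_ge0.
Unshelve. all: by end_near.
Qed.

Lemma near0P (P : R -> Prop) :
  (\forall t \near (0 : R), P t) <-> exists e, 0 < e /\ forall t, `|t| < e -> P t.
Proof.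
split=> [/nbhs_ballP[e /= e0 H]|[e [e0 H]]].
  by exists e; split=> // t te; apply: H; rewrite /ball /= sub0r normrN.
by apply/nbhs_ballP; exists e => //= t; rewrite /ball /= sub0r normrN; exact: H.
Qed.

Lemma near_ord (n : nat) (P : 'I_n -> R -> Prop) :
  (forall i, \forall t \near (0 : R), P i t) -> \forall t \near (0 : R), forall i, P i t.
Proof. by move=> H; apply: (@filter_forall R 'I_n P (nbhs (0 : R))). Qed.

(** * Analytic factorization of a polynomial *)

(** Recursion on the whole past, with the past given as a total sequence; used
    for a sequence of coefficients each of which is determined by the previous
    ones. *)
Lemma strong_recursion (T : Type) (x0 : T) (F : nat -> (nat -> T) -> T) :
  (forall n (f f' : nat -> T), (forall i, (i < n)%N -> f i = f' i) -> F n f = F n f') ->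
  exists x : nat -> T, forall n, x n = F n x.
Proof.
move=> HF; pose G k := iter k (fun f n => F n f) (fun=> x0).
have Gk k k' n : (n < k)%N -> (n < k')%N -> G k n = G k' n.
  elim: k k' n => // k IH [//|k'] n nk nk' /=; apply: HF => i i_n.
  by apply: IH; [exact: leq_trans i_n _|exact: leq_trans i_n _].
exists (fun n => G n.+1 n) => n /=; apply: HF => i i_n.
exact: (Gk n i.+1 i).
Qed.

Lemma psum_ge0 c m t : (forall n, 0 <= c n) -> 0 <= t -> 0 <= psum c m t.
Proof. by move=> c0 t0; apply: sumr_ge0 => i _; rewrite mulr_ge0 ?exprn_ge0. Qed.

Lemma psum_cauchy_le c d m t : (forall n, 0 <= c n) -> (forall n, 0 <= d n) -> 0 <= t ->
  psum (fun n => \sum_(i < n.+1) c i * d (n - i)%N) m t <= psum c m t * psum d m t.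
Proof.
move=> c0 d0 t0; rewrite psum_cauchy {2}/psum mulr_suml; apply: ler_sum => i _.
apply: ler_wpM2l; first by rewrite mulr_ge0 ?exprn_ge0.
have := leq_subr i m; move: (m - i)%N => k /subnKC <-; elim: (m - k)%N => [|j IH].
  by rewrite addn0.
by rewrite addnS psumS (le_trans IH)// lerDl mulr_ge0 ?exprn_ge0.
Qed.

(** A convolution recursion with geometric forcing has solutions of geometric
    growth.  Writing S_m for the sum of the y_n tau^n with n < m, the recursion
    gives S_(m+1) <= b (2K + tau S_m^2), and for small tau the bound
    S_m <= r reproduces itself. *)
Lemma quadratic_majorant (y : nat -> R) (b K rho : R) :
  (forall n, 0 <= y n) -> 0 < b -> 0 <= K -> 0 < rho ->
  (forall n, y n <= b * (K / rho ^+ n + \sum_(i < n) y i * y (n.-1 - i)%N)) ->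
  exists C tau, 0 < tau /\ forall n, y n <= C / tau ^+ n.
Proof.
move=> y0 b0 K0 r0 Hy.
pose r := 4 * b * K + 1; have r1 : 0 < r by rewrite ltr_wpDl// !mulr_ge0// ltW.
pose tau := Num.min (rho / 2) (1 / (2 * b * r)).
have t0 : 0 < tau by rewrite lt_min !divr_gt0 ?mulr_gt0.
have tr : tau / rho <= 2^-1 by rewrite ler_pdivrMr// mulrC ge_min lexx.
have tb : b * tau * r <= 2^-1.
  have : tau <= 1 / (2 * b * r) by rewrite ge_min lexx orbT.
  rewrite ler_pdivlMr ?mulr_gt0// => h; lra.
have geo m : psum (fun n => K / rho ^+ n) m tau <= 2 * K * (1 - 2^-1 ^+ m).
  elim: m => [|m IH]; first by rewrite psum0 expr0 subrr mulr0.
  rewrite psumS; apply: le_trans (lerD IH (_ : _ <= K * 2^-1 ^+ m)) _.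
    rewrite -mulrA ler_wpM2l// mulrC -expr_div_n lerXn2r ?nnegrE//.
    by rewrite divr_ge0 // ltW.
  by rewrite exprS; set X := _ ^+ m; lra.
have S m : psum y m tau <= r.
  elim: m => [|m IH]; first by rewrite psum0 ltW.
  have step : psum y m.+1 tau <= b * (psum (fun n => K / rho ^+ n) m.+1 tau +
       tau * psum (fun n => \sum_(i < n.+1) y i * y (n - i)%N) m tau).
    rewrite {3}/psum mulr_sumr.
    have -> : \sum_(i < m) tau * ((\sum_(j < i.+1) y j * y (i - j)%N) * tau ^+ i)
       = psum (fun n => \sum_(i < n) y i * y (n.-1 - i)%N) m.+1 tau.
      rewrite /psum big_ord_recl big_ord0 mul0r add0r; apply: eq_bigr => i _.
      by rewrite lift0 /= exprS mulrCA.
    rewrite /psum -big_split mulr_sumr; apply: ler_sum => i _ /=.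
    by rewrite -mulrDl mulrA ler_wpM2r ?exprn_ge0 ?(ltW t0).
  apply: le_trans step _.
  have q := psum_cauchy_le m y0 y0 (ltW t0).
  have p0 := psum_ge0 m y0 (ltW t0).
  have q2 : psum y m tau * psum y m tau <= r * r by apply: ler_pM.
  have g1 : psum (fun n => K / rho ^+ n) m.+1 tau <= 2 * K.
    apply: le_trans (geo _) _; rewrite ler_piMr ?mulr_ge0// gerBl exprn_ge0//.
  apply: (@le_trans _ _ (b * (2 * K + tau * (r * r)))).
    rewrite ler_pM2l// lerD// ler_pM2l//; exact: le_trans q q2.
  rewrite mulrDr; have := ler_wpM2r (ltW r1) tb; rewrite /r; lra.
exists r, tau; split=> // n.
rewrite ler_pdivlMr ?exprn_gt0//; apply: le_trans (S n.+1).
by rewrite psumS lerDr psum_ge0// ltW.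
Qed.

(** Cutting at d makes this a norm on polynomials of size at most d while
    keeping it submultiplicative on all polynomials. *)
Definition coef_norm (d : nat) (p : {poly R}) : R := \sum_(i < d) `|p`_i|.

Lemma coef_norm_ge0 (d : nat) (p : {poly R}) : 0 <= coef_norm d p.
Proof. exact: sumr_ge0. Qed.

Lemma coef_normD (d : nat) (p q : {poly R}) : coef_norm d (p + q) <= coef_norm d p + coef_norm d q.
Proof. by rewrite -big_split; apply: ler_sum => i _ /=; rewrite coefD ler_normD. Qed.

Lemma coef_normN (d : nat) (p : {poly R}) : coef_norm d (- p) = coef_norm d p.
Proof. by apply: eq_bigr => i _; rewrite coefN normrN. Qed.

Lemma coef_norm_sum (d : nat) (I : Type) (s : seq I) (p : I -> {poly R}) :
  coef_norm d (\sum_(i <- s) p i) <= \sum_(i <- s) coef_norm d (p i).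
Proof.
elim: s => [|i s IH]; last first.
  by rewrite !big_cons (le_trans (coef_normD _ _ _))// lerD2l.
by rewrite !big_nil /coef_norm big1// => i _; rewrite coef0 normr0.
Qed.

Lemma coef_normZ (d : nat) (a : R) (p : {poly R}) : coef_norm d (a *: p) = `|a| * coef_norm d p.
Proof. by rewrite /coef_norm mulr_sumr; apply: eq_bigr => i _; rewrite coefZ normrM. Qed.

Lemma coef_normM (d : nat) (p q : {poly R}) : coef_norm d (p * q) <= coef_norm d p * coef_norm d q.
Proof.
have E f : coef_norm d f = psum (fun i => `|f`_i|) d 1.
  by apply: eq_bigr => i _; rewrite expr1n mulr1.
rewrite !E; apply: le_trans (psum_cauchy_le _ _ _ _) => //.
apply: ler_sum => i _; rewrite expr1n !mulr1 coefM.
by apply: le_trans (ler_norm_sum _ _ _) _; apply: ler_sum => j _; rewrite normrM.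
Qed.

(** Linear maps are bounded on a space of finite dimension; the constant is the
    sum of the norms of the images of the monomials. *)
Lemma coef_norm_linear (d : nat) (f : {poly R} -> {poly R}) :
  (forall a p q, f (a *: p + q) = a *: f p + f q) ->
  exists b : R, 0 <= b /\ forall p : {poly R}, (size p <= d)%N -> coef_norm d (f p) <= b * coef_norm d p.
Proof.
move=> fl; exists (\sum_(i < d) coef_norm d (f 'X^i)); split.
  by apply: sumr_ge0 => i _; exact: coef_norm_ge0.
move=> p sp.
have f0 : f 0 = 0 by have := fl (-1) 0 0; rewrite scaler0 addr0 scaleN1r addNr.
have -> : f p = \sum_(i < d) p`_i *: f 'X^i.
  have {1}-> : p = \sum_(i < d) p`_i *: 'X^i.
    rewrite -poly_def; apply/polyP => i; rewrite coef_poly; case: ltnP => // di.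
    by rewrite nth_default// (leq_trans sp).
  have : forall r : seq 'I_d, f (\sum_(i <- r) p`_i *: 'X^i) = \sum_(i <- r) p`_i *: f 'X^i.
    elim=> [|i r IH]; first by rewrite !big_nil.
    by rewrite !big_cons fl IH.
  exact.
apply: le_trans (coef_norm_sum _ _ _) _; rewrite mulr_suml; apply: ler_sum => i _.
rewrite coef_normZ mulrC ler_wpM2l ?coef_norm_ge0//.
by rewrite /coef_norm (bigD1 i)//= lerDl sumr_ge0.
Qed.

(** The linearized factorization problem: E is to be written Q0 B + S0 A with A
    and B of lower degree.  A is v E reduced modulo Q0, where v inverts S0
    modulo Q0; both solutions depend linearly on E, hence are bounded by it. *)
Lemma bezout_split (Q0 S0 : {poly R}) (m l : nat) : Q0 \is monic ->
  size Q0 = m.+1 -> size S0 = l.+1 -> coprimep Q0 S0 ->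
  exists A B : {poly R} -> {poly R}, exists b : R, 0 < b /\
   forall E : {poly R}, (size E <= m + l)%N ->
    [/\ (size (A E) <= m)%N, (size (B E) <= l)%N, Q0 * B E + S0 * A E = E,
        coef_norm (m + l) (A E) <= b * coef_norm (m + l) E &
        coef_norm (m + l) (B E) <= b * coef_norm (m + l) E].
Proof.
move=> mQ sQ sS /Bezout_eq1_coprimepP[[u v] /= uv].
pose A (E : {poly R}) : {poly R} := (v * E) %% Q0.
pose B (E : {poly R}) : {poly R} := (E - S0 * A E) %/ Q0.
have AL a p q : A (a *: p + q) = a *: A p + A q.
  by rewrite /A mulrDr -scalerAr modpD modpZl.
have BL a p q : B (a *: p + q) = a *: B p + B q.
  rewrite /B AL -divpZl -divpD; congr (_ %/ _).
  by rewrite mulrDr scalerBr -scalerAr opprD addrACA.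
have [bA [bA0 HA]] := coef_norm_linear (m + l) AL.
have [bB [bB0 HB]] := coef_norm_linear (m + l) BL.
exists A, B, (bA + bB + 1); split; first by rewrite ltr_wpDl// addr_ge0.
move=> E sE.
have Q00 : Q0 != 0 by rewrite monic_neq0.
have sA : (size (A E) <= m)%N by have := ltn_modpN0 (v * E) Q00; rewrite sQ.
have dv : Q0 %| E - S0 * A E.
  have -> : E - S0 * A E = Q0 * (u * E + S0 * ((v * E) %/ Q0)).
    have e1 := divp_eq (v * E) Q0.
    have -> : A E = v * E - (v * E) %/ Q0 * Q0 by rewrite /A {2}e1; ring.
    rewrite -{1}(mul1r E) -uv; ring.
  exact: dvdp_mulr.
have eqE : Q0 * B E + S0 * A E = E by rewrite /B mulrC divpK// subrK.
split=> //.
- have [->|B0] := eqVneq (B E) 0; first by rewrite size_poly0.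
  have := size_proper_mul (p := Q0) (q := B E); rewrite (monicP mQ) mul1r lead_coef_eq0 B0.
  rewrite sQ => /(_ isT) sz.
  have : (size (Q0 * B E)%R <= m + l)%N.
    have -> : Q0 * B E = E - S0 * A E by rewrite -{2}eqE addrK.
    apply: leq_trans (size_polyD _ _) _; rewrite geq_max sE size_polyN /=.
    have [->|A0] := eqVneq (A E) 0; first by rewrite mulr0 size_poly0.
    by apply: leq_trans (size_polyMleq _ _) _; rewrite sS addSn /= addnC leq_add2r.
  by rewrite sz addSn /= leq_add2l.
- apply: le_trans (HA _ sE) _; rewrite ler_wpM2r ?coef_norm_ge0//; lra.
- apply: le_trans (HB _ sE) _; rewrite ler_wpM2r ?coef_norm_ge0//; lra.
Qed.

(** The centre of the expansions is the parameter 0. *)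
Definition analytic_poly (P : R -> {poly R}) : Prop :=
  forall i, analytic0 (fun t => (P t)`_i).

(** The coefficients above degree m are those of a monic polynomial of degree m,
    so only the m lower ones have to be summed as power series. *)
Lemma monic_ps (m : nat) (q : nat -> {poly R}) (C tau : R) :
  q 0%N \is monic -> size (q 0%N) = m.+1 -> (forall n, size (q n.+1) <= m)%N ->
  0 < tau -> (forall n i, (i < m)%N -> `|(q n.+1)`_i| <= C / tau ^+ n) ->
  exists Q : R -> {poly R}, [/\ forall t, Q t \is monic, forall t, size (Q t) = m.+1 &
    forall i, has_ps (fun t => (Q t)`_i) (fun n => (q n)`_i)].
Proof.
move=> mq sq sz t0 Hq.
(* Coefficients of index i >= m do not depend on t and are treated apart. *)
have hex i : exists h, (i < m)%N -> has_ps h (fun n => (q n)`_i).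
  have [im|//] := boolP (i < m)%N; last by exists id.
  have [|h Hh] := @analytic0_of_coef (fun n => (q n)`_i) (C * tau + `|(q 0%N)`_i|) tau t0.
    have C0 : 0 <= C by have := Hq 0%N i im; rewrite expr0 divr1; exact: le_trans.
    move=> [|n]; first by rewrite expr0 divr1 lerDr mulr_ge0// ltW.
    apply: le_trans (Hq n i im) _; rewrite exprS invfM mulrA mulrDl mulfK ?gt_eqF//.
    rewrite mulrDl lerDl !mulr_ge0 ?invr_ge0 ?exprn_ge0 //; exact: ltW.
  by exists h.
have [h Hh] := choice hex.
pose Q t := 'X^m + \poly_(i < m) h i t.
have sP t : (size (\poly_(i < m) h i t) < size ('X^m : {poly R}))%N.
  by rewrite size_polyXn ltnS size_poly.
exists Q; split=> [t|t|i].
- by rewrite monicE lead_coefDl// lead_coefXn.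
- by rewrite size_polyDl// size_polyXn.
rewrite /Q; under eq_fun do rewrite coefD coefXn coef_poly.
case: (ltngtP i m) => im.
- by under eq_fun do rewrite add0r; exact: Hh.
- have -> : (fun n => (q n)`_i) = (fun n => if n is 0%N then 0 else 0).
    apply/funext => -[|n]; rewrite nth_default ?sq//.
    by rewrite (leq_trans (sz n))// ltnW.
  by under eq_fun do rewrite addr0; exact: has_ps_cst.
- have -> : (fun n => (q n)`_i) = (fun n => if n is 0%N then 1 else 0).
    apply/funext => -[|n]; first by have := monicP mq; rewrite lead_coefE sq im.
    by rewrite nth_default// im.
  by under eq_fun do rewrite addr0; exact: has_ps_cst.
Qed.

(** Hensel's lemma for a family depending on t.  Comparing the coefficients of
    t^(n+1) in P = Q S gives Q0 s_(n+1) + S0 q_(n+1) = e_(n+1) - (sum of the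
    products q_i s_j with i + j = n + 1 and i, j > 0), which [bezout_split]
    solves with a bounded operator.  The norms of the solutions satisfy the
    recursion of [quadratic_majorant], so that the two formal factors converge. *)
Lemma analytic_hensel (P : R -> {poly R}) (Q0 S0 : {poly R}) (m l : nat) :
  analytic_poly P -> (forall t, P t \is monic) -> (forall t, size (P t) = (m + l).+1) ->
  P 0 = Q0 * S0 -> Q0 \is monic -> S0 \is monic ->
  size Q0 = m.+1 -> size S0 = l.+1 -> coprimep Q0 S0 ->
  exists Q S : R -> {poly R},
   [/\ analytic_poly Q, analytic_poly S,
      (forall t, Q t \is monic /\ S t \is monic),
      (forall t, size (Q t) = m.+1 /\ size (S t) = l.+1) &
      \forall t \near (0 : R), P t = Q t * S t].
Proof.
move=> aP mP sP P0 mQ mS sQ sS cop.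
have [A [B [b [b0 AB]]]] := bezout_split mQ sQ sS cop.
pose d := (m + l)%N.
have cstP i : (d <= i)%N -> has_ps (fun t => (P t)`_i) (fun n => if n is 0%N then (P 0)`_i else 0).
  move=> di; have -> : (fun t => (P t)`_i) = (fun=> (P 0)`_i); last exact: has_ps_cst.
  apply/funext => t; move: di; rewrite leq_eqVlt => /orP[/eqP <-|di].
    by have := monicP (mP t); have := monicP (mP 0); rewrite !lead_coefE !sP /= => -> ->.
  by rewrite !nth_default ?sP.
have /choice[c HcX] i : exists c, has_ps (fun t => (P t)`_i) c /\
    ((d <= i)%N -> forall n, c n.+1 = 0).
  have [di|id_] := leqP d i; last by have [c Hc] := aP i; exists c.
  by eexists; split=> [|_]; [exact: cstP|].
have Hc i := (HcX i).1.
pose E n := \poly_(i < d) c i n.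
have sE n : (size (E n) <= d)%N by exact: size_poly.
pose F n (x : nat -> {poly R} * {poly R}) :=
  let G := E n.+1 - \sum_(i < n) (x i).1 * (x (n.-1 - i)%N).2 in (A G, B G).
have [|x Hx] := @strong_recursion _ (0, 0) F.
  move=> n f f' ff'; rewrite /F; have -> // : \sum_(i < n) (f i).1 * (f (n.-1 - i)%N).2 =
    \sum_(i < n) (f' i).1 * (f' (n.-1 - i)%N).2.
  apply: eq_bigr => i _; rewrite !ff'//; case: i => i /=; lia.
pose G n := E n.+1 - \sum_(i < n) (x i).1 * (x (n.-1 - i)%N).2.
have x1 n : (x n).1 = A (G n) by rewrite Hx.
have x2 n : (x n).2 = B (G n) by rewrite Hx.
have sxG n : (size (G n) <= d)%N /\ (size (x n).1 <= m)%N /\ (size (x n).2 <= l)%N.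
  elim/ltn_ind: n => n IH.
  have sG : (size (G n) <= d)%N.
    rewrite (leq_trans (size_polyD _ _))// geq_max sE size_polyN /=.
    apply: leq_trans (size_sum _ _ _) _; apply/bigmax_leqP => i _.
    have [_ [h1 _]] := IH i (ltn_ord i).
    have [|_ [_ h2]] := IH (n.-1 - i)%N; first by case: i {h1} => i /=; lia.
    apply: leq_trans (size_polyMleq _ _) _; apply: leq_trans (leq_pred _) _.
    by rewrite leq_add.
  by have [h1 h2 _ _ _] := AB _ sG; rewrite x1 x2.
have sG n := (sxG n).1; have s1 n := (sxG n).2.1; have s2 n := (sxG n).2.2.
pose y n := coef_norm d (x n).1 + coef_norm d (x n).2.
have [r0 [r00 [K [K0 HE]]]] : exists rho : R, 0 < rho /\ exists K : R, 0 <= K /\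
    forall n, coef_norm d (E n.+1) <= K / rho ^+ n.
  have : forall k, exists rho : R, 0 < rho /\ exists K : R, 0 <= K /\
      forall n, \sum_(i < k) `|c i n| <= K / rho ^+ n.
    elim=> [|k [r [r0 [K [K0 HK]]]]].
      by exists 1; split=> //; exists 0; split=> // n; rewrite big_ord0 mul0r.
    have [e [e0 [M [_ [M0 _ HM _]]]]] := has_ps_common (Hc k) (Hc k).
    have Hk n : `|c k n| <= 2 * M / e ^+ n.
      have := has_ps_coef_le e0 M0 HM n (@ler01 R).
      by rewrite expr1n mulr1 div1r exprVn.
    have i0 : 0 < Num.min r e by rewrite lt_min r0.
    exists (Num.min r e); split=> //; exists (K + 2 * M); split.
      by rewrite addr_ge0// mulr_ge0.
    move=> n; rewrite big_ord_recr /= mulrDl lerD//.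
      apply: le_trans (HK n) _; rewrite ler_wpM2l// lef_pV2 ?posrE ?exprn_gt0//.
      by rewrite lerXn2r ?nnegrE ?(ltW i0) ?(ltW r0)// ge_min lexx.
    apply: le_trans (Hk n) _; rewrite ler_wpM2l ?mulr_ge0// lef_pV2 ?posrE ?exprn_gt0//.
    by rewrite lerXn2r ?nnegrE ?(ltW i0) ?(ltW e0)// ge_min lexx orbT.
  move=> /(_ d)[r [r0 [K [K0 HK]]]]; exists r; split=> //; exists (K / r); split.
    by rewrite divr_ge0// ltW.
  move=> n; have := HK n.+1; rewrite exprS invfM mulrA; apply: le_trans.
  rewrite le_eqVlt; apply/orP; left; apply/eqP; apply: eq_bigr => i _.
  by rewrite coef_poly ltn_ord.
have y0 n : 0 <= y n by rewrite addr_ge0// coef_norm_ge0.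
have [|C [tau [t0 Hy]]] := @quadratic_majorant y (2 * b) K r0 y0 (mulr_gt0 (ltr0Sn R 1) b0) K0 r00.
  move=> n; have [_ _ _ hA hB] := AB _ (sG n).
  rewrite /y x1 x2; apply: le_trans (lerD hA hB) _.
  rewrite -mulrDl -mulr2n -[b *+ 2]mulr_natl ler_wpM2l ?mulr_ge0 ?(ltW b0)//.
  apply: le_trans (coef_normD _ _ _) _; rewrite lerD ?HE// coef_normN.
  apply: le_trans (coef_norm_sum _ _ _) _; apply: ler_sum => i _.
  apply: le_trans (coef_normM _ _ _) _; apply: ler_pM; rewrite ?coef_norm_ge0 //.
  - by rewrite lerDl coef_norm_ge0.
  - by rewrite lerDr coef_norm_ge0.
pose q n := if n is n'.+1 then (x n').1 else Q0.
pose s n := if n is n'.+1 then (x n').2 else S0.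
have cle (p : {poly R}) i : (i < d)%N -> `|p`_i| <= coef_norm d p.
  by move=> id_; rewrite /coef_norm (bigD1 (Ordinal id_))//= lerDl sumr_ge0.
have [|Q [HQ1 HQ2 HQ3]] := @monic_ps m q C tau mQ sQ s1 t0.
  move=> n i im; apply: le_trans (Hy n).
  by rewrite (le_trans (cle _ i _)) ?(leq_trans im) ?leq_addr// lerDl coef_norm_ge0.
have [|S [HS1 HS2 HS3]] := @monic_ps l s C tau mS sS s2 t0.
  move=> n i im; apply: le_trans (Hy n).
  by rewrite (le_trans (cle _ i _)) ?(leq_trans im) ?leq_addl// lerDr coef_norm_ge0.
exists Q, S; split=> [i|i|t|t|]; [by eexists; exact: HQ3|by eexists; exact: HS3|by []|by []|].
have key n : \sum_(i < n.+2) q i * s (n.+1 - i)%N = E n.+1.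
  rewrite big_ord_recl big_ord_recr /= subnn /=.
  have -> : \sum_(i < n) q (lift ord0 (widen_ord (leqnSn n) i)) *
      s (n.+1 - lift ord0 (widen_ord (leqnSn n) i))%N =
      \sum_(i < n) (x i).1 * (x (n.-1 - i)%N).2.
    apply: eq_bigr => i _; rewrite lift0 /= subSS.
    by have -> : (n - i = (n.-1 - i).+1)%N by case: i => i /=; lia.
  have [_ _ h _ _] := AB _ (sG n).
  by rewrite addrCA /= mulrC x1 x2 [A _ * _]mulrC [B _ * _]mulrC h /G addrC subrK.
have near_coef i : \forall t \near (0 : R), (P t)`_i = (Q t * S t)`_i.
  suff [e [c1 c2]] : exists e, has_ps (fun t => (P t)`_i) e /\ has_ps (fun t => (Q t * S t)`_i) e.
    by apply/near0P; exact: has_ps_uniq c1 c2.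
  exists (fun n => \sum_(j < i.+1) \sum_(k < n.+1) (q k)`_j * (s (n - k)%N)`_(i - j)).
  split; last first.
    under eq_fun do rewrite coefM.
    by apply: has_ps_sum => j; exact: has_psM (HQ3 _) (HS3 _).
  have := Hc i; congr has_ps; apply/funext => n.
  rewrite exchange_big /=.
  under eq_bigr do rewrite -coefM.
  rewrite -coef_sum; case: n => [|n].
    by rewrite big_ord_recl big_ord0 addr0 -P0 (has_ps0 (Hc i)).
  by rewrite key coef_poly; case: ltnP => // di; rewrite (HcX i).2.
have : \forall t \near (0 : R), forall i : 'I_d.+1, (P t)`_i = (Q t * S t)`_i.
  have Hn (i : 'I_d.+1) : \forall t \near (0 : R), (P t)`_i = (Q t * S t)`_i by [].
  exact: (near_ord Hn).
apply: filterS => t Ht; apply/polyP => i; have [id_|di] := ltnP i d.+1.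
  exact: (Ht (Ordinal id_)).
rewrite !nth_default ?sP// size_Mmonic ?monic_neq0//.
by rewrite HQ2 HS2 addSn addnS.
Qed.

(** * Analytic roots of polynomials with only real roots *)

Definition splits (p : {poly R}) : Prop := exists rs : seq R, p = \prod_(r <- rs) ('X - r%:P).

Lemma splits_dvd (p q : {poly R}) : splits p -> q \is monic -> q %| p -> splits q.
Proof.
move=> [rs ->] mq /dvdp_prod_XsubC[msk]; rewrite eqp_monic// ?monic_prod_XsubC//.
by move=> /eqP ->; exists (mask msk rs).
Qed.

(** A real valued squared modulus: it is polynomial in the coordinates and
    avoids square roots. *)
Definition normsq (z : R[i]) : R := complex.Re z ^+ 2 + complex.Im z ^+ 2.

Lemma normsqM z w : normsq (z * w) = normsq z * normsq w.
Proof. by case: z w => [a b] [c d]; rewrite /normsq /=; ring. Qed.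

Lemma normsq_ge0 z : 0 <= normsq z.
Proof. by rewrite addr_ge0 ?sqr_ge0. Qed.

Lemma normsq_eq0 z : (normsq z == 0) = (z == 0).
Proof.
case: z => a b; rewrite /normsq /= paddr_eq0 ?sqr_ge0// !sqrf_eq0.
by rewrite eq_complex.
Qed.

(** Each factor satisfies |z - r| >= |Im z| because r is real. *)
Lemma splits_lower_bound (p : {poly R}) (z : R[i]) (d : nat) : splits p -> size p = d.+1 ->
  (complex.Im z ^+ 2) ^+ d <= normsq (map_poly (real_complex R) p).[z].
Proof.
move=> [rs ->]; rewrite size_prod_XsubC => -[<-].
rewrite map_prod_XsubC horner_prod; elim: rs => [|r rs IH].
  by rewrite big_nil expr0 /normsq /= expr1n expr0n addr0.
rewrite big_cons normsqM /= exprS; apply: ler_pM; [exact: sqr_ge0|by apply: exprn_ge0; exact: sqr_ge0| |by []].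
by rewrite hornerXsubC; case: z {IH} => a b; rewrite /normsq /= subr0 lerDr sqr_ge0.
Qed.

Lemma splits_of_no_nonreal_root (p : {poly R}) : p \is monic ->
  (forall z : R[i], complex.Im z != 0 -> (map_poly (real_complex R) p).[z] != 0) -> splits p.
Proof.
move=> mp H; have [zs] := closed_field_poly_normal (map_poly (real_complex R) p).
rewrite lead_coef_map (monicP mp) rmorph1 scale1r => E.
exists [seq complex.Re z | z <- zs].
apply: (@map_poly_inj _ _ (real_complex R)); rewrite E big_map map_prod_XsubC.
apply: eq_big_seq => z zzs; congr ('X - _%:P).
have : complex.Im z = 0.
  apply/eqP; apply: contraT => /H; rewrite E -rootE.
  by rewrite root_prod_XsubC zzs.
by case: z {zzs} => a b /= ->.
Qed.

(** By continuity, the punctured neighbourhood suffices. *)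
Lemma analytic0_ge h (a : R) : analytic0 h ->
  (\forall t \near (0 : R), t != 0 -> a <= h t) -> a <= h 0.
Proof.
move=> Hh /near0P[e [e0 He]]; rewrite leNgt; apply/negP => h0.
have [|d [d0 Hd]] := analytic0_cont Hh (_ : 0 < a - h 0); first by rewrite subr_gt0.
(* A point of the punctured neighbourhood at which h is close to h 0. *)
have i0 : 0 < Num.min e d / 2 by rewrite divr_gt0// lt_min e0.
have im : Num.min e d / 2 < Num.min e d by rewrite ltr_pdivrMr// ltr_pMr ?lt_min ?e0// ltr1n.
move: im; rewrite {2}/Num.min => im.
have te : `|Num.min e d / 2| < e.
  by rewrite gtr0_norm// (lt_le_trans im)//; case: ltP.
have td : `|Num.min e d / 2| < d.
  by rewrite gtr0_norm// (lt_le_trans im)//; case: ltP => // /ltW.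
have := Hd _ td; have := He _ te; rewrite gt_eqF// => /(_ isT) h1.
by move=> /(le_lt_trans (ler_norm _)); rewrite ltrD2r ltNge h1.
Qed.

Lemma analytic0_eq0 h : analytic0 h -> (\forall t \near (0 : R), t != 0 -> h t = 0) -> h 0 = 0.
Proof.
move=> Hh H; apply/eqP; rewrite eq_le; apply/andP; split.
  rewrite -oppr_ge0; apply: (analytic0_ge (analytic0N Hh)).
  by apply: filterS H => t Ht /Ht ->; rewrite oppr0.
by apply: (analytic0_ge Hh); apply: filterS H => t Ht /Ht ->.
Qed.

(** Having only real roots passes to the limit, since the lower bound
    |P(z)| >= |Im z|^d off the real axis does. *)
Lemma splits_limit (P : R -> {poly R}) (d : nat) :
  analytic_poly P -> (forall t, P t \is monic) -> (forall t, size (P t) = d.+1) ->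
  (\forall t \near (0 : R), t != 0 -> splits (P t)) -> splits (P 0).
Proof.
move=> aP mP sP H; apply: splits_of_no_nonreal_root => // z z0.
rewrite -normsq_eq0 gt_eqF//.
apply: (@lt_le_trans _ _ ((complex.Im z ^+ 2) ^+ d)).
  by rewrite exprn_gt0// lt0r sqrf_eq0 z0 sqr_ge0.
have E t : (map_poly (real_complex R) (P t)).[z] =
    ((\sum_(i < d.+1) (P t)`_i * complex.Re (z ^+ i)) +i*
     (\sum_(i < d.+1) (P t)`_i * complex.Im (z ^+ i)))%C.
  rewrite horner_coef size_map_poly sP; elim: d.+1 => [|k IH].
    by rewrite !big_ord0.
  rewrite !big_ord_recr /= IH coef_map /=.
  by case: (z ^+ k) => a b; apply/eqP; rewrite eq_complex /= !mul0r subr0 addr0 !eqxx.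
apply: (@analytic0_ge (fun t => normsq (map_poly (real_complex R) (P t)).[z])); last first.
  by apply: filterS H => t Ht /Ht; move/splits_lower_bound; apply.
under eq_fun do rewrite E /normsq /=.
by apply: analytic0D; apply: analytic0X; apply: analytic0_sum => i _;
  apply: analytic0M => //; exact: analytic0_cst.
Qed.

(** Up to sign the elementary symmetric functions of rs, that is the
    coefficients of the product of the X - r read downwards from the leading
    one. *)
Fixpoint topcoef (rs : seq R) (j : nat) : R :=
  if rs is r :: rs' then topcoef rs' j - (if j is j'.+1 then r * topcoef rs' j' else 0)
  else (j == 0%N)%:R.

Lemma topcoef_large rs j : (size rs < j)%N -> topcoef rs j = 0.
Proof.
elim: rs j => [|r rs IH] [|j]//= sj; rewrite !IH ?mulr0 ?subr0// ltnW//.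
Qed.

Lemma coef_prod_topcoef rs j : (j <= size rs)%N ->
  (\prod_(r <- rs) ('X - r%:P))`_(size rs - j) = topcoef rs j.
Proof.
elim: rs j => [|r rs IH] j.
  by rewrite leqn0 => /eqP ->; rewrite big_nil coef1.
rewrite big_cons mulrBl coefB coefCM coefXM /= leq_eqVlt => /orP[/eqP ->|js].
  by rewrite subnn /= topcoef_large// -(IH (size rs))// subnn.
have js' : (j <= size rs)%N by [].
rewrite subSn// IH//; congr (_ - _); case: j js js' => [|j] js js'.
  by rewrite subn0 nth_default ?mulr0// size_prod_XsubC.
by rewrite -subSn// subSS IH// ltnW.
Qed.

Lemma topcoef0 rs : topcoef rs 0 = 1.
Proof. by elim: rs => //= r rs ->; rewrite subr0. Qed.

Lemma topcoef1 rs : topcoef rs 1 = - \sum_(r <- rs) r.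
Proof.
elim: rs => [|r rs IH] /=; first by rewrite big_nil oppr0.
by rewrite IH topcoef0 big_cons; ring.
Qed.

Lemma topcoef2 rs : \sum_(r <- rs) r ^+ 2 = topcoef rs 1 ^+ 2 - 2 * topcoef rs 2.
Proof.
elim: rs => [|r rs IH]; first by rewrite big_nil /=; ring.
by rewrite big_cons IH /= topcoef0 mulr1; ring.
Qed.

Lemma topcoef_scale (a : R) rs j : topcoef [seq a * r | r <- rs] j = a ^+ j * topcoef rs j.
Proof.
elim: rs j => [|r rs IH] [|j] /=; rewrite ?mul1r ?mulr0 // !IH; rewrite ?exprS; ring.
Qed.

Lemma coef_prod_scale (a : R) rs i : (i <= size rs)%N ->
  (\prod_(r <- [seq a * r | r <- rs]) ('X - r%:P))`_i =
  a ^+ (size rs - i) * (\prod_(r <- rs) ('X - r%:P))`_i.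
Proof.
move=> irs; have h := leq_subr i (size rs).
have := @coef_prod_topcoef [seq a * r | r <- rs] (size rs - i); rewrite size_map subKn//.
move=> ->//; rewrite topcoef_scale; congr (_ * _).
by rewrite -coef_prod_topcoef// subKn.
Qed.

Lemma topcoef_bound (B : R) rs j : (forall r, r \in rs -> `|r| <= B) -> 0 <= B ->
  `|topcoef rs j| <= 2 ^+ size rs * B ^+ j.
Proof.
move=> + B0; elim: rs j => [|r rs IH] j HB /=.
  rewrite expr0 mul1r; case: j => [|j]; first by rewrite normr1 expr0.
  by rewrite normr0 exprn_ge0.
have HB' s : s \in rs -> `|s| <= B by move=> srs; apply: HB; rewrite inE srs orbT.
have rB : `|r| <= B by apply: HB; rewrite inE eqxx.
apply: le_trans (ler_normB _ _) _.
rewrite exprS -mulrA mulrDl mul1r lerD ?IH//.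
case: j => [|j]; first by rewrite normr0 !mulr_ge0 ?exprn_ge0.
rewrite normrM exprS mulrCA ler_pM// ?IH//.
Qed.

Lemma analytic_poly_comp (P : R -> {poly R}) (c : R -> R) (d : nat) :
  analytic_poly P -> (forall t, size (P t) = d) -> analytic0 c ->
  analytic_poly (fun t => P t \Po ('X + (c t)%:P)).
Proof.
move=> aP sP ac j.
have aX i k : analytic0 (fun t => (('X + (c t)%:P) ^+ i)`_k).
  elim: i k => [|i IH] k; first by under eq_fun do rewrite expr0; exact: analytic0_cst.
  under eq_fun do rewrite exprS mulrDl coefD coefXM coefCM.
  apply: analytic0D; last exact: analytic0M.
  by case: k => [|k]; [exact: analytic0_cst|exact: IH].
under eq_fun do rewrite comp_polyE sP coef_sum.
apply: analytic0_sum => i _; under eq_fun do rewrite coefZ.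
exact: analytic0M.
Qed.

Lemma prod_XsubC_comp (rs : seq R) (c : R) :
  (\prod_(r <- rs) ('X - r%:P)) \Po ('X + c%:P) = \prod_(r <- rs) ('X - (r - c)%:P).
Proof.
rewrite rmorph_prod; apply: eq_bigr => r _ /=.
by rewrite comp_polyB comp_polyX comp_polyC polyCB opprB addrA -addrA [_ - r%:P]addrC addrA addrAC.
Qed.

(** The inductive step of Rellich's theorem, for roots of vanishing sum.  The
    coefficient of degree d is t^k g with g 0 <> 0, and it is minus half of the
    sum of the squares of the roots, which is nonnegative: so k = 2q is even,
    and the roots are O(t^q).  After division by t^q their sum is still zero
    while the sum of their squares is -2 g 0 <> 0 at t = 0, so that they are not
    all equal there and the polynomial factors. *)
Lemma analytic_roots_traceless (d : nat) (P : R -> {poly R}) :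
  (forall (d' : nat) (P' : R -> {poly R}), (d' < d.+2)%N -> analytic_poly P' ->
    (forall t, P' t \is monic) -> (forall t, size (P' t) = d'.+1) ->
    (\forall t \near (0 : R), splits (P' t)) ->
    exists mu : nat -> R -> R, (forall i, analytic0 (mu i)) /\
     \forall t \near (0 : R), P' t = \prod_(i < d') ('X - (mu i t)%:P)) ->
  analytic_poly P -> (forall t, P t \is monic) -> (forall t, size (P t) = d.+3) ->
  (\forall t \near (0 : R), splits (P t)) ->
  (\forall t \near (0 : R), (P t)`_d.+1 = 0) ->
  exists mu : nat -> R -> R, (forall i, analytic0 (mu i)) /\
    \forall t \near (0 : R), P t = \prod_(i < d.+2) ('X - (mu i t)%:P).
Proof.
move=> IH aP mP sP splP tr0.
have rootsP : \forall t \near (0 : R), exists rs : seq R,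
   [/\ P t = \prod_(r <- rs) ('X - r%:P), size rs = d.+2,
      (forall j, (j <= d.+2)%N -> (P t)`_(d.+2 - j) = topcoef rs j), topcoef rs 1 = 0 &
      \sum_(r <- rs) r ^+ 2 = - 2 * (P t)`_d].
  apply: filterS2 splP tr0 => t [rs Prs] tr.
  have srs : size rs = d.+2.
    by have := sP t; rewrite Prs size_prod_XsubC => -[].
  have cf j : (j <= d.+2)%N -> (P t)`_(d.+2 - j) = topcoef rs j.
    by move=> jd; rewrite Prs -coef_prod_topcoef ?srs.
  have t1 : topcoef rs 1 = 0 by rewrite -(cf 1%N)// subSS subn0.
  exists rs; split=> //; rewrite topcoef2 t1 -(cf 2%N)// !subSS subn0; ring.
have [[e [e0 z2]]|[k [g [ag g0 Pg]]]] := analytic0_order (aP d).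
  exists (fun _ _ => 0); split; first by move=> _; exact: analytic0_cst.
  have : \forall t \near (0 : R), (P t)`_d = 0 by apply/near0P; exists e.
  apply: filterS2 rootsP => t [rs [-> srs _ _ sq2]] Pd.
  rewrite Pd mulr0 in sq2.
  have rs0 r : r \in rs -> r = 0.
    move=> rrs; apply/eqP; rewrite -sqrf_eq0; apply/eqP.
    move: sq2; rewrite (big_rem r)//= => /eqP; rewrite paddr_eq0 ?sqr_ge0//.
      by move=> /andP[/eqP].
    by apply: sumr_ge0 => i _; exact: sqr_ge0.
  rewrite (eq_big_seq (fun=> 'X - 0%:P)); last by move=> r /rs0 ->.
  rewrite big_const_seq count_predT srs big_const_ord //.
have Pd_le : \forall t \near (0 : R), t ^+ k * g t <= 0.
  apply: filterS rootsP => t [rs [_ _ _ _ sq2]]; rewrite -Pg.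
  have : 0 <= \sum_(r <- rs) r ^+ 2 by apply: sumr_ge0 => i _; exact: sqr_ge0.
  rewrite sq2; lra.
have g_near : \forall t \near (0 : R), `|g t - g 0| < `|g 0|.
  by apply/near0P; apply: analytic0_cont => //; rewrite normr_gt0.
have gneg : g 0 < 0 /\ ~~ odd k.
  have /near0P[e [e0 He]] : \forall t \near (0 : R), t ^+ k * g t <= 0 /\ `|g t - g 0| < `|g 0|.
    by apply: filterS2 Pd_le g_near.
  have e2 : 0 < e / 2 by rewrite divr_gt0.
  have ee : `|e / 2| < e by rewrite gtr0_norm//; lra.
  have [h1 h2] := He _ ee; rewrite pmulr_rle0 ?exprn_gt0// in h1.
  have gn : g 0 < 0.
    rewrite ltNge; apply/negP => g0'; move: h2; rewrite (ger0_norm g0').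
    by rewrite distrC => /(le_lt_trans (ler_norm _)); lra.
  split=> //.
  have ee' : `|- (e / 2)| < e by rewrite normrN.
  have [h3 h4] := He _ ee'.
  have gn' : g (- (e / 2)) < 0.
    move: h4; rewrite (ltr0_norm gn) => /(le_lt_trans (ler_norm _)); lra.
  apply/negP => ok; move: h3; rewrite exprNn -signr_odd ok expr1 mulN1r mulNr oppr_le0.
  by rewrite pmulr_rge0 ?exprn_gt0// leNgt gn'.
have [gn ek] := gneg; pose q := k./2.
have kq : k = (q * 2)%N by rewrite muln2 even_halfK.
(* The roots are O(t^q). *)
(* The sum of the squares is -2 t^(2q) g t <= 4 |g 0| t^(2q), and B <= B^2. *)
pose B := 4 * `|g 0| + 1; have B0 : 0 < B by rewrite ltr_wpDl// mulr_ge0.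
have B1 : 1 <= B by rewrite lerDr mulr_ge0.
have root_bound : \forall t \near (0 : R), exists rs : seq R,
   [/\ P t = \prod_(r <- rs) ('X - r%:P), size rs = d.+2,
      (forall j, (j <= d.+2)%N -> (P t)`_(d.+2 - j) = topcoef rs j) &
      (forall r, r \in rs -> `|r| <= B * `|t| ^+ q)].
  apply: filterS2 rootsP g_near => t [rs [Prs srs cf _ sq2]] gt.
  exists rs; split=> // r rrs.
  have Bt : 0 <= B * `|t| ^+ q by rewrite mulr_ge0 ?exprn_ge0// ltW.
  rewrite -(ler_pXn2r (ltn0Sn 1)) ?nnegrE// real_normK ?num_real//.
  apply: (@le_trans _ _ (- 2 * (P t)`_d)).
    rewrite -sq2 (big_rem r)//= lerDl.
    by apply: sumr_ge0 => i _; exact: sqr_ge0.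
  rewrite Pg kq exprM exprMn -normrX real_normK ?num_real// mulrCA [leRHS]mulrC.
  rewrite ler_wpM2l ?sqr_ge0//.
  have : - g t <= 2 * `|g 0|.
    have := ler_norm (- g t); rewrite normrN => /le_trans; apply.
    have := ler_normD (g t - g 0) (g 0); rewrite subrK; lra.
  have : B <= B ^+ 2 by rewrite expr2 ler_peMl// ltW.
  rewrite /B; lra.
have scaled j : (j <= d.+2)%N -> exists h, analytic0 h /\
    forall t, (P t)`_(d.+2 - j) = t ^+ (q * j) * h t.
  move=> jd; have /near0P[e [e0 He]] := root_bound.
  apply: (@analytic0_vanish _ _ (2 ^+ d.+2 * B ^+ j) e) => // t _ te.
  have [rs [_ srs cf rb]] := He t te; rewrite cf// exprM -mulrA -exprMn.
  by rewrite -srs; apply: topcoef_bound => //; rewrite mulr_ge0 ?exprn_ge0// ltW.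
have /choice[h Hh] j : exists h, (j <= d.+2)%N -> analytic0 h /\
    forall t, (P t)`_(d.+2 - j) = t ^+ (q * j) * h t.
  have [/scaled[h Hh]|] := boolP (j <= d.+2)%N; first by exists h.
  by exists id.
(* The polynomial of the roots divided by t^q. *)
pose P' t := 'X^(d.+2) + \poly_(i < d.+2) h (d.+2 - i)%N t.
have szl t : (size (\poly_(i < d.+2) h (d.+2 - i)%N t) < size ('X^(d.+2) : {poly R}))%N.
  by rewrite size_polyXn ltnS size_poly.
have mP' t : P' t \is monic by rewrite monicE lead_coefDl// lead_coefXn.
have sP' t : size (P' t) = d.+3 by rewrite size_polyDl// size_polyXn.
have aP' : analytic_poly P'.
  move=> i; rewrite /P'; under eq_fun do rewrite coefD coefXn coef_poly.
  case: ltnP => _; apply: analytic0D; try exact: analytic0_cst.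
  exact: (Hh _ (leq_subr _ _)).1.
have cP' i t : (i <= d.+2)%N -> (P t)`_i = t ^+ (q * (d.+2 - i)) * (P' t)`_i.
  rewrite leq_eqVlt => /orP[/eqP ->|id_].
    rewrite subnn muln0 expr0 mul1r.
    have := monicP (mP t); have := monicP (mP' t).
    by rewrite !lead_coefE sP sP' => -> ->.
  rewrite /P' coefD coefXn coef_poly id_ (ltn_eqF id_) add0r.
  by rewrite -(Hh _ (leq_subr _ _)).2 subKn// ltnW.
have splP' : \forall t \near (0 : R), splits (P' t).
  have H : \forall t \near (0 : R), t != 0 -> splits (P' t).
    apply: filterS root_bound => t [rs [Prs srs cf _]] t0.
    exists [seq (t ^+ q)^-1 * r | r <- rs]; apply/polyP => i.
    have [id_|di] := leqP i d.+2; last first.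
      by rewrite !nth_default// ?sP'// big_map size_prod_XsubC srs.
    rewrite coef_prod_scale ?srs// -Prs cP'// mulrA.
    by rewrite exprM -exprMn mulVf ?expr1n ?mul1r// expf_neq0.
  (* Division by t^q says nothing at t = 0, where a limit argument is needed. *)
  have S0 := splits_limit aP' mP' sP' H.
  by apply: filterS H => t; have [->|t0 /(_ isT)] := eqVneq t 0.
have [ss Pss] : splits (P' 0).
  by have /near0P[e [e0 He]] := splP'; apply: He; rewrite normr0.
have sss : size ss = d.+2.
  by have := sP' 0; rewrite Pss size_prod_XsubC => -[].
have ss1 : \sum_(s <- ss) s = 0.
  apply: oppr_inj; rewrite oppr0 -topcoef1 -coef_prod_topcoef ?sss// subSS subn0 -Pss.
  apply: (analytic0_eq0 (aP' d.+1)); apply: filterS tr0 => t.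
  rewrite cP'// => /eqP; rewrite mulf_eq0 => /orP[|/eqP //].
  by rewrite expf_eq0 => /andP[_ ->].
have ss2 : topcoef ss 2 = g 0.
  rewrite -coef_prod_topcoef ?sss// !subSS subn0 -Pss; apply/eqP; rewrite -subr_eq0; apply/eqP.
  apply: (@analytic0_eq0 (fun t => (P' t)`_d - g t)).
    by apply: analytic0B => //; exact: aP'.
  apply: filterE => t t0; have := Pg t; rewrite cP' ?(leqW (leqnSn d))//.
  rewrite -addn2 addKn -kq => /mulfI -> //; first by rewrite subrr.
  exact: expf_neq0.
pose s0 := head 0 ss; pose ss' := [seq s <- ss | s != s0].
have s0ss : s0 \in ss by rewrite /s0; case: (ss) sss => // a l _; rewrite inE eqxx.
(* Equal roots of vanishing sum would all be 0, against ss2. *)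
have [s1 s1ss s10] : exists2 s, s \in ss & s != s0.
  apply/hasP; rewrite has_predC; apply/negP => /allP alls.
  have ssE : \sum_(s <- ss) s = s0 *+ d.+2.
    rewrite (eq_big_seq (fun=> s0)) => [|s /alls /eqP //].
    by rewrite big_const_seq count_predT sss iter_addr_0.
  have s00 : s0 = 0 by move/eqP: ss1; rewrite ssE mulrn_eq0 /= => /eqP.
  have : \sum_(s <- ss) s ^+ 2 = 0.
    by rewrite big_seq big1// => s /alls /eqP ->; rewrite s00 expr0n.
  by rewrite topcoef2 topcoef1 ss1 ss2 => h'; move/eqP: g0; apply; lra.
pose m := count_mem s0 ss; pose l := size ss'.
have ml : (m + l = d.+2)%N.
  by rewrite /l size_filter -sss -(count_predC (pred1 s0)).
have m0 : (0 < m)%N by rewrite -has_count has_pred1.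
have l0 : (0 < l)%N by rewrite /l size_filter -has_count; apply/hasP; exists s1.
pose Q0 := ('X - s0%:P) ^+ m; pose S0 := \prod_(s <- ss') ('X - s%:P).
have P0E : P' 0 = Q0 * S0.
  rewrite Pss (bigID (pred1 s0))/=; congr (_ * _); last by rewrite /S0 big_filter.
  rewrite (eq_bigr (fun=> 'X - s0%:P)) => [|s /eqP -> //].
  by rewrite big_const_seq iter_mulr_1 .
have mQ0 : Q0 \is monic by rewrite monic_exp// monicXsubC.
have mS0 : S0 \is monic by exact: monic_prod_XsubC.
have sQ0 : size Q0 = m.+1 by rewrite size_exp_XsubC.
have sS0 : size S0 = l.+1 by rewrite size_prod_XsubC.
have cop : coprimep Q0 S0.
  rewrite coprimep_expl// coprimep_sym coprimep_XsubC root_prod_XsubC mem_filter eqxx//.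
have sP'' t : size (P' t) = (m + l).+1 by rewrite ml.
have [Q [S [aQ aS mQS sQS PQS]]] :=
  analytic_hensel aP' mP' sP'' P0E mQ0 mS0 sQ0 sS0 cop.
have spQ : \forall t \near (0 : R), splits (Q t).
  apply: filterS2 splP' PQS => t sp E; apply: (splits_dvd sp (mQS t).1).
  by rewrite E dvdp_mulr.
have spS : \forall t \near (0 : R), splits (S t).
  apply: filterS2 splP' PQS => t sp E; apply: (splits_dvd sp (mQS t).2).
  by rewrite E dvdp_mull.
have [|mu1 [amu1 Hmu1]] := IH m Q _ aQ (fun t => (mQS t).1) (fun t => (sQS t).1) spQ.
  by rewrite -ml -addn1 leq_add2l.
have [|mu2 [amu2 Hmu2]] := IH l S _ aS (fun t => (mQS t).2) (fun t => (sQS t).2) spS.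
  by rewrite -ml -add1n leq_add2r.
exists (fun i t => t ^+ q * (if (i < m)%N then mu1 i t else mu2 (i - m)%N t)); split.
  move=> i; apply: analytic0M; first by apply: analytic0X; exact: analytic0_id.
  by case: (i < m)%N.
near=> t.
pose nu i := if (i < m)%N then mu1 i t else mu2 (i - m)%N t.
pose ns := [seq nu i | i <- iota 0 d.+2].
have E : P' t = \prod_(r <- ns) ('X - r%:P).
  rewrite big_map -[iota 0 d.+2]/(index_iota 0 d.+2) big_mkord -ml big_split_ord /=.
  have -> : P' t = Q t * S t by near: t; exact: PQS.
  have -> : Q t = \prod_(i < m) ('X - (mu1 i t)%:P) by near: t; exact: Hmu1.
  have -> : S t = \prod_(i < l) ('X - (mu2 i t)%:P) by near: t; exact: Hmu2.
  by congr (_ * _); apply: eq_bigr => i _; rewrite /nu ?ltn_ord// ltnNge leq_addr /= addKn.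
have sns : size ns = d.+2 by rewrite size_map size_iota.
have -> : \prod_(i < d.+2) ('X - (t ^+ q * nu i)%:P) =
    \prod_(r <- [seq t ^+ q * r | r <- ns]) ('X - r%:P).
  by rewrite !big_map -[iota 0 d.+2]/(index_iota 0 d.+2) big_mkord.
apply/polyP => i; have [id_|di] := leqP i d.+2; last first.
  by rewrite !nth_default// ?sP// size_prod_XsubC size_map sns.
rewrite coef_prod_scale ?sns// -E cP'//.
by rewrite exprM.
Unshelve. all: by end_near.
Qed.

(** The hypothesis that all roots are real is essential: X^2 - t has no analytic
    roots. *)
Theorem analytic_roots (d : nat) (P : R -> {poly R}) : analytic_poly P ->
  (forall t, P t \is monic) -> (forall t, size (P t) = d.+1) ->
  (\forall t \near (0 : R), splits (P t)) ->
  exists mu : nat -> R -> R, (forall i, analytic0 (mu i)) /\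
   \forall t \near (0 : R), P t = \prod_(i < d) ('X - (mu i t)%:P).
Proof.
elim/ltn_ind: d P => -[|[|d]] IH P aP mP sP splP.
- exists (fun _ _ => 0); split; first by move=> _; exact: analytic0_cst.
  apply: filterE => t; rewrite big_ord0.
  have /size_poly1P[a a0 Pa] : size (P t) == 1%N by rewrite sP.
  by have := monicP (mP t); rewrite Pa lead_coefC => ->.
- exists (fun _ t => - (P t)`_0); split; first by move=> _; apply: analytic0N; exact: aP.
  apply: filterE => t; rewrite big_ord_recl big_ord0 mulr1 polyCN opprK.
  apply/polyP => -[|[|i]]; rewrite coefD coefX coefC /= ?add0r ?addr0 //.
    by have := monicP (mP t); rewrite lead_coefE sP.
  by rewrite nth_default ?sP.
(* The mean of the roots. *)
pose c t := - (P t)`_d.+1 / d.+2%:R.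
have ac : analytic0 c.
  by apply: analytic0M; [apply: analytic0N; exact: aP|exact: analytic0_cst].
pose P' t := P t \Po ('X + (c t)%:P).
have aP' := analytic_poly_comp aP sP ac.
have sX t : size ('X + (c t)%:P : {poly R}) = 2%N.
  by rewrite -[c t]opprK polyCN size_XsubC.
have mX t : ('X + (c t)%:P : {poly R}) \is monic.
  by rewrite -[c t]opprK polyCN monicXsubC.
have sP' t : size (P' t) = d.+3.
  by rewrite size_comp_poly2// sX.
have mP' t : P' t \is monic.
  by rewrite monicE lead_coef_comp ?sX// (monicP (mP t)) (monicP (mX t)) expr1n mulr1.
have shift t rs : P t = \prod_(r <- rs) ('X - r%:P) ->
    P' t = \prod_(r <- [seq r - c t | r <- rs]) ('X - r%:P).
  by move=> E; rewrite /P' E prod_XsubC_comp big_map.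
have splP' : \forall t \near (0 : R), splits (P' t).
  by apply: filterS splP => t [rs /shift E]; eexists; exact: E.
have tr0 : \forall t \near (0 : R), (P' t)`_d.+1 = 0.
  apply: filterS splP => t [rs Prs].
  have srs : size rs = d.+2 by have := sP t; rewrite Prs size_prod_XsubC => -[].
  rewrite (shift _ _ Prs).
  have -> : d.+1 = (size [seq r - c t | r <- rs]).-1 by rewrite size_map srs.
  rewrite coefPn_prod_XsubC ?size_map ?srs// big_map sumrB.
  have -> : \sum_(r <- rs) r = d.+2%:R * c t.
    rewrite /c mulrC divfK ?pnatr_eq0// Prs -[d.+1]/(d.+2.-1) -srs.
    by rewrite coefPn_prod_XsubC ?srs// opprK.
  by rewrite big_const_seq count_predT srs iter_addr_0 -[c t *+ _]mulr_natl subrr oppr0.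
have [mu [amu Hmu]] := analytic_roots_traceless (fun (d' : nat) P' hd => IH d' hd P') aP' mP' sP' splP' tr0.
exists (fun i t => mu i t + c t); split; first by move=> i; exact: analytic0D.
apply: filterS Hmu => t E.
have -> : P t = P' t \Po ('X + (- c t)%:P).
  by rewrite /P' -comp_polyA comp_polyD comp_polyX comp_polyC polyCN subrK comp_polyXr.
rewrite /P' E rmorph_prod; apply: eq_bigr => i _ /=.
by rewrite comp_polyB comp_polyX comp_polyC polyCD polyCN opprD addrA addrAC.
Qed.

End PowerSeries.

(** * Spectra of real symmetric matrices *)

Section Symmetric.
Variable R : realType.

(** Unique factorization: a multiset of roots is determined by its polynomial. *)
Lemma prod_XsubC_perm (rs ss : seq R) :
  \prod_(r <- rs) ('X - r%:P) = \prod_(r <- ss) ('X - r%:P) -> perm_eq rs ss.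
Proof.
elim: rs ss => [|r rs IH] ss E.
  have := size_prod_XsubC ss id; rewrite -E big_nil size_poly1 => -[/esym/size0nil ->].
  by [].
have rss : r \in ss by rewrite -root_prod_XsubC -E root_prod_XsubC inE eqxx.
have pss := perm_to_rem rss.
rewrite perm_sym (perm_trans pss)// perm_cons perm_sym; apply: IH.
move: E; rewrite (perm_big _ pss) /= !big_cons => /mulfI; apply.
by rewrite polyXsubC_eq0.
Qed.

Lemma char_poly_similar (F : fieldType) (n : nat) (P A D : 'M[F]_n) : P \in unitmx ->
  P *m A = D *m P -> char_poly A = char_poly D.
Proof.
move=> uP E; rewrite /char_poly.
have P0 : \det (map_mx polyC P) != 0.
  by rewrite det_map_mx polyC_eq0 -unitfE -unitmxE.
apply: (mulfI P0 (x2 := \det (char_poly_mx D))).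
rewrite -det_mulmx [RHS]mulrC -det_mulmx; congr (\det _).
rewrite /char_poly_mx mulmxBr mulmxBl scalar_mxC; congr (_ - _).
by rewrite -!map_mxM E.
Qed.

(** Over the complex numbers the matrix is hermitian, so unitarily similar to a
    real diagonal matrix.  Eigenvectors may be left complex, but the eigenvalues are
    wanted as elements of R. *)
Lemma symmetric_diagonalizable (n : nat) (A : 'M[R]_n) : A^T = A ->
  exists (P : 'M[R[i]]_n) (sp : 'I_n -> R), [/\ P \in unitmx,
    forall i, row i P *m map_mx (real_complex R) A = (sp i)%:C *: row i P &
    char_poly A = \prod_(i < n) ('X - (sp i)%:P)].
Proof.
move=> sA; pose B := map_mx (real_complex R) A.
have hB : B \is hermsymmx.
  apply/is_hermitianmxP; rewrite expr0 scale1r /B.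
  apply/matrixP => i j; rewrite !mxE -[in RHS]sA mxE.
  by apply/eqP; rewrite eq_complex /= oppr0 !eqxx.
have rs := hermitian_spectral_diag_real hB.
have /hermitian_normalmx/orthomx_spectralP E := hB.
pose P := spectralmx B; pose d := spectral_diag B.
have uP : P \in unitmx by exact: spectral_unit.
have PB : P *m B = diag_mx d *m P by move: (congr1 (mulmx P) E); rewrite -[invmx _ *m _ *m _]mulmxA mulKVmx.
have dE i : d 0 i = (complex.Re (d 0 i))%:C.
  have /mxOverP/(_ 0 i) := rs; rewrite -/d; case: (d 0 i) => a b.
  by rewrite /= complex_real => /eqP ->.
exists P, (fun i => complex.Re (d 0 i)); split=> // [i|].
  rewrite -row_mul PB -dE; apply/rowP => j; rewrite !mxE (bigD1 i)//= big1 ?addr0.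
    by rewrite !mxE eqxx mulr1n.
  by move=> k ki; rewrite !mxE eq_sym (negPf ki) mulr0n mul0r.
apply: (@map_poly_inj _ _ (real_complex R)).
rewrite map_char_poly -/B (char_poly_similar uP PB) char_poly_trig ?diag_mx_is_trig//.
transitivity (\prod_(i < n) ('X - ((complex.Re (d 0 i))%:C)%:P)); last by rewrite map_prod_XsubC.
by apply: eq_bigr => i _; rewrite -dE !mxE eqxx mulr1n.
Qed.

End Symmetric.

(** * Eigenvalues of the Jacobi matrices *)

Section Jacobi.
Variables (R : realType) (N : nat) (v : 'rV[R]_((2 * N).+1)).
Local Notation p := (2 * N).+1.
Local Notation J := (jacobi v).

Lemma jacobi_sym a : (J a)^T = J a.
Proof.
apply/matrixP => i j; rewrite !mxE.
case: (altP (j =P i :> nat)) => [ji|ji].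
  have -> : i = j by apply/val_inj.
  by [].
have ij : (i == j) = false by apply/negbTE; rewrite eq_sym; exact: ji.
have ji' : (j == i) = false by apply/negbTE; exact: ji.
rewrite ij ji'; case: eqP => [e1|]; case: eqP => [e2|] //; first by lia.
  by rewrite e1.
by rewrite e2.
Qed.

(** Row k of the eigenvalue equation expresses the coordinate k + 1 through the
    previous ones, since the off-diagonal entries are nonzero.  So an
    eigenvector with vanishing first coordinate is zero, and two independent
    eigenvectors for one eigenvalue would combine into such a vector. *)
Lemma jacobi_uniq_spectrum a (rs : seq R) : a != 0 ->
  char_poly (J a) = \prod_(r <- rs) ('X - r%:P) -> uniq rs.
Proof.
move=> a0 E; have [P [sp [uP rP cp]]] := symmetric_diagonalizable (jacobi_sym a).
have perm : perm_eq rs [seq sp i | i <- enum 'I_p].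
  by apply: prod_XsubC_perm; rewrite -E cp big_map big_enum.
rewrite (perm_uniq perm) map_inj_uniq ?enum_uniq//.
(* A vector in an eigenspace is determined by its first coordinate. *)
have first0 (u : 'rV[R[i]]_p) s : u *m map_mx (real_complex R) (J a) = s *: u ->
    u 0 0 = 0 -> u = 0.
  move=> us u0; suff H k : forall i : 'I_p, (i <= k)%N -> u 0 i = 0.
    by apply/rowP => i; rewrite mxE; exact: (H i).
  elim: k => [|k IH] i; first by rewrite leqn0 => /eqP i0; rewrite -u0; congr (u 0 _); apply/val_inj.
  rewrite leq_eqVlt => /orP[/eqP ik|]; last exact: IH.
  have kp : (k < p)%N by rewrite (leq_trans _ (ltn_ord i))// ik.
  have := congr1 (fun w : 'rV_p => w 0 (Ordinal kp)) us.
  rewrite !mxE (IH (Ordinal kp))// mulr0 (bigD1 i)//= big1 ?addr0.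
    rewrite !mxE /= ik eqxx /jacobi_coef; move/eqP; rewrite mulf_eq0 => /orP[/eqP//|].
    rewrite -[0]/((0 : R)%:C) (inj_eq (@complexI _)); case: ifP => _; rewrite ?oner_eq0 ?(negPf a0)//.
  move=> j ji; have [jk|jk] := leqP j k; first by rewrite IH// mul0r.
  rewrite !mxE /= ifF; last by apply/eqP => e; case/eqP: ji; apply/val_inj; rewrite /= ik.
  rewrite ifF; last by apply/eqP; lia.
  rewrite ifF ?rmorph0 ?mulr0//.
  by apply/eqP => e; move: jk; rewrite e /= ltnn.
have P_inj (w : 'rV[R[i]]_p) : w *m P = 0 -> w = 0.
  by move=> wP; rewrite -(mulmxK uP w) wP mul0mx.
move=> i j sij; apply/eqP; apply: contraT => ij.
have row0 k : row k P 0 0 != 0.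
  apply/eqP => h; have := first0 _ _ (rP k) h; rewrite rowE => /P_inj/rowP/(_ k).
  by rewrite !mxE !eqxx => /eqP; rewrite oner_eq0.
(* The combination of the two eigenvectors whose first coordinate cancels. *)
pose w : 'rV[R[i]]_p := (row j P 0 0) *: delta_mx 0 i - (row i P 0 0) *: delta_mx 0 j.
have wP : w *m P = (row j P 0 0) *: row i P - (row i P 0 0) *: row j P.
  by rewrite mulmxBl -!scalemxAl -!rowE.
have : w = 0.
  apply: P_inj; apply: (first0 _ (sp i)%:C).
    rewrite wP mulmxBl -!scalemxAl !rP -sij scalerBr !scalerA.
    by rewrite ![(sp i)%:C * _]mulrC.
  by rewrite wP 2!mxE [X in _ + X]mxE [X in _ - X]mxE mulrC subrr.
move/rowP/(_ i); rewrite !mxE !eqxx (negPf ij) mulr1 mulr0 subr0.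
by move/eqP => h; have := row0 j; rewrite mxE h.
Qed.

Lemma char_poly_jacobi_analytic a0 : analytic_poly (fun t => char_poly (J (a0 + t))).
Proof.
have aC (P : {poly R}) : analytic_poly (fun=> P) by move=> i; exact: analytic0_cst.
have aM (P Q : R -> {poly R}) : analytic_poly P -> analytic_poly Q ->
    analytic_poly (fun t => P t * Q t).
  move=> aP aQ i; under eq_fun do rewrite coefM.
  by apply: analytic0_sum => j _; exact: analytic0M.
have aprod (I : Type) (s : seq I) (P : I -> R -> {poly R}) :
    (forall i, analytic_poly (P i)) -> analytic_poly (fun t => \prod_(i <- s) P i t).
  move=> aP; elim: s => [|i s IH].
    by under eq_fun do rewrite big_nil; exact: aC.
  by under eq_fun do rewrite big_cons; exact: aM.
have asum (I : Type) (s : seq I) (P : I -> R -> {poly R}) :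
    (forall i, analytic_poly (P i)) -> analytic_poly (fun t => \sum_(i <- s) P i t).
  move=> aP j; under eq_fun do rewrite coef_sum.
  by apply: analytic0_sum => i _; exact: aP.
rewrite /char_poly /determinant; apply: asum => s; apply: aM; first exact: aC.
apply: aprod => i k; under eq_fun do rewrite !mxE coefB coefC.
apply: analytic0B; first exact: analytic0_cst.
case: (k == 0%N); last exact: analytic0_cst.
have acoef n : analytic0 (fun t => jacobi_coef (a0 + t) n).
  rewrite /jacobi_coef; case: odd; last exact: analytic0_cst.
  by apply: analytic0D; [exact: analytic0_cst|exact: analytic0_id].
by case: eqP => _ //; case: eqP => _ //; case: eqP => _; exact: analytic0_cst.
Qed.

(** The eigenvalues relisted from index 0, to use the theory of sorted
    sequences. *)
Definition spec_seq (lam : int -> R) : seq R :=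
  [seq lam (i%:Z - N%:Z) | i <- iota 0 p].

Lemma size_spec_seq lam : size (spec_seq lam) = p.
Proof. by rewrite size_map size_iota. Qed.

Lemma nth_spec_seq lam i : (i < p)%N -> nth 0 (spec_seq lam) i = lam (i%:Z - N%:Z).
Proof. by move=> ip; rewrite (nth_map 0%N) ?size_iota// nth_iota. Qed.

Lemma spec_seq_prod lam : \prod_(r <- spec_seq lam) ('X - r%:P) =
  \prod_(i < p) ('X - (lam (i%:Z - N%:Z))%:P).
Proof. by rewrite big_map -[iota 0 p]/(index_iota 0 p) big_mkord. Qed.

Lemma ordered_spec_seq (A : 'M[R]_p) lam : ordered_eigenvalues A lam ->
  char_poly A = \prod_(r <- spec_seq lam) ('X - r%:P) /\ sorted <=%R (spec_seq lam).
Proof.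
move=> [cp lo]; split; first by rewrite spec_seq_prod.
apply/(sortedP 0) => i; rewrite size_spec_seq => ip.
by rewrite !nth_spec_seq// 1?ltnW//; apply: lo; lia.
Qed.

Lemma int_index (k : int) : - N%:Z <= k <= N%:Z ->
  exists2 i, (i < p)%N & k = i%:Z - N%:Z.
Proof. by move=> /andP[k1 k2]; exists (absz (k + N%:Z)); lia. Qed.

Lemma jacobi_ordered_eigenvalues : exists lam : int -> R -> R, forall a : R,
  ordered_eigenvalues (J a) (fun k => lam k a).
Proof.
have /choice[lam Hlam] a : exists lam : int -> R, ordered_eigenvalues (J a) lam.
  have [_ [sp [_ _ cp]]] := symmetric_diagonalizable (jacobi_sym a).
  pose s := sort <=%R [seq sp i | i <- enum 'I_p].
  have ss : size s = p by rewrite size_sort size_map size_enum_ord.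
  have cps : char_poly (J a) = \prod_(r <- s) ('X - r%:P).
    by rewrite (perm_big _ (permEl (perm_sort _ _))) big_map big_enum.
  exists (fun k => nth 0 s (absz (k + N%:Z))); split; last first.
    move=> j k jN jk kN; apply: le_sorted_leq_nth; rewrite ?inE ?ss; try lia.
    exact: (sort_sorted (@le_total _ R)).
  rewrite cps (big_nth 0) ss big_mkord; apply: eq_bigr => i _.
  by have -> : absz (i%:Z - N%:Z + N%:Z) = i by lia.
by exists (fun k a => lam a k).
Qed.

(** * Band functions *)

Section Bands.
Variable lam : int -> R -> R.
Hypothesis Hlam : forall a : R, a \in `[0, 2] ->
  ordered_eigenvalues (J a) (fun k => lam k a).

Lemma band_strict a j k : a \in `[0, 2] -> a != 0 ->
  - N%:Z <= j -> j < k -> k <= N%:Z -> lam j a < lam k a.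
Proof.
move=> a02 a0 jN jk kN; have [cp so] := ordered_spec_seq (Hlam a02).
have un := jacobi_uniq_spectrum a0 cp.
rewrite lt_neqAle (Hlam a02).2 ?(ltW jk)// andbT.
have [|i ip je] := @int_index j; first by rewrite jN (le_trans (ltW jk)).
have [|l lp ke] := @int_index k; first by rewrite kN (le_trans jN (ltW jk)).
rewrite je ke -(@nth_spec_seq (lam^~ a))// -(@nth_spec_seq (lam^~ a))// nth_uniq ?size_spec_seq//.
by apply/eqP; lia.
Qed.

Lemma analytic0_sign (h : R -> R) : analytic0 h -> h 0 != 0 ->
  (\forall t \near (0 : R), 0 <= h t) \/ (\forall t \near (0 : R), h t <= 0).
Proof.
move=> ah h0; have [|d [d0 hd]] := analytic0_cont ah (_ : 0 < `|h 0|); first by rewrite normr_gt0.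
case: (ltrgt0P (h 0)) h0 hd => // h0 _ hd; [left|right]; apply/near0P; exists d; split=> // t /hd.
  by rewrite distrC => /(le_lt_trans (ler_norm _)); lra.
by move=> /(le_lt_trans (ler_norm _)); lra.
Qed.

(** On one side of 0 a germ has constant sign: there t^k does. *)
Lemma analytic0_sign_right (h : R -> R) : analytic0 h ->
  (\forall t \near (0 : R), 0 <= t -> 0 <= h t) \/ (\forall t \near (0 : R), 0 <= t -> h t <= 0).
Proof.
move=> ah; have [[e [e0 hz]]|[k [g [ag g0 hg]]]] := analytic0_order ah.
  by left; apply/near0P; exists e; split=> // t /hz ->.
have [H|H] := analytic0_sign ag g0; [left|right]; apply: filterS H => t gt t0; rewrite hg.
  by rewrite mulr_ge0 ?exprn_ge0.
by rewrite mulr_ge0_le0 ?exprn_ge0.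
Qed.

(** All comparisons between branches of analytic roots are constant on a
    neighbourhood, within [0, 2].  Sorting the branches once by this order sorts
    their values at every parameter, so that the k-th eigenvalue is the k-th
    branch throughout. *)
Lemma band_germ a0 k : a0 \in `[0, 2] -> - N%:Z <= k <= N%:Z ->
  exists g, analytic0 g /\
    \forall t \near (0 : R), a0 + t \in `[0, 2] -> lam k (a0 + t) = g t.
Proof.
move=> a02 kN.
have szP t : size (char_poly (J (a0 + t))) = p.+1 by rewrite size_char_poly.
have [|mu [amu Hmu]] := analytic_roots (char_poly_jacobi_analytic a0)
    (fun t => char_poly_monic _) szP.
  apply: filterE => t; have [_ [sp [_ _ ->]]] := symmetric_diagonalizable (jacobi_sym (a0 + t)).
  by exists [seq sp i | i <- enum 'I_p]; rewrite big_map big_enum.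
(* Any two branches are ordered the same way throughout a neighbourhood. *)
have pair (ij : 'I_p * 'I_p) : \forall e \near (0 : R), 0 < e ->
    (forall t, `|t| < e -> a0 + t \in `[0, 2] -> mu ij.1 t <= mu ij.2 t) \/
    (forall t, `|t| < e -> a0 + t \in `[0, 2] -> mu ij.2 t <= mu ij.1 t).
  have E (P : R -> Prop) : (\forall t \near (0 : R), P t) ->
      \forall e \near (0 : R), forall t, `|t| < e -> P t.
    move=> /near0P[e [e0 H]]; apply/near0P; exists e; split=> // e' ee t te.
    by apply: H; rewrite (lt_trans te)// (le_lt_trans (ler_norm e')).
  have ad : analytic0 (fun t => mu ij.2 t - mu ij.1 t) by exact: analytic0B.
  (* At a0 = 0 eigenvalues may cross, but only t >= 0 is admissible. *)
  have [ae|a00] := eqVneq a0 0.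
    have [/E H|/E H] := analytic0_sign_right ad; apply: filterS H => e H e0; [left|right];
      move=> t te; rewrite ae add0r in_itv => /andP[t0 _]; have := H t te t0.
      by rewrite subr_ge0.
    by rewrite subr_le0.
  have [->|d0] := eqVneq ij.1 ij.2; first by apply: filterE => e e0; left.
  have un : mu ij.2 0 - mu ij.1 0 != 0.
    have P0 : char_poly (J a0) = \prod_(r <- [seq mu (i : 'I_p) 0 | i <- enum 'I_p]) ('X - r%:P).
      rewrite big_map big_enum; have /near0P[e [e0 He]] := Hmu.
      by rewrite -{1}[a0]addr0; apply: He; rewrite normr0.
    have /injectiveP inj := jacobi_uniq_spectrum a00 P0.
    by rewrite subr_eq0; apply: contra_neq d0 => /esym/inj.
  have [/E H|/E H] := analytic0_sign ad un; apply: filterS H => e H e0; [left|right];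
    move=> t te _; have := H t te.
    by rewrite subr_ge0.
  by rewrite subr_le0.
have /near0P[e1 [e10 He1]] : \forall e \near (0 : R), forall i j : 'I_p, 0 < e ->
    (forall t, `|t| < e -> a0 + t \in `[0, 2] -> mu i t <= mu j t) \/
    (forall t, `|t| < e -> a0 + t \in `[0, 2] -> mu j t <= mu i t).
  by apply: near_ord => i; apply: near_ord => j; exact: (pair (i, j)).
have /near0P[e2 [e20 He2]] := Hmu.
pose e := Num.min e1 e2 / 2.
have m0 : 0 < Num.min e1 e2 by rewrite lt_min e10.
have e0 : 0 < e by rewrite divr_gt0.
have em : e < Num.min e1 e2 by rewrite ltr_pdivrMr// ltr_pMr// ltr1n.
have [ee1 ee2] : e < e1 /\ e < e2 by move: em; rewrite lt_min => /andP[].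
have ae1 : `|e| < e1 by rewrite gtr0_norm.
have tot i j := He1 e ae1 i j e0.
pose I t := `|t| < e /\ a0 + t \in `[0, 2].
pose rel (i j : 'I_p) : bool := `[< forall t, I t -> mu i t <= mu j t >].
have rel_total : total rel.
  move=> i j; apply/orP; have [H|H] := tot i j.
    by left; apply/asboolP => t [te ta]; exact: H.
  by right; apply/asboolP => t [te ta]; exact: H.
pose s := sort rel (enum 'I_p).
have ss : size s = p by rewrite size_sort size_enum_ord.
have [n np kE] := int_index kN.
exists (mu (nth ord0 s n)); split=> //.
apply/near0P; exists e; split=> // t te ta.
have It : I t by [].
have [cp so] := ordered_spec_seq (Hlam ta).
rewrite kE -(@nth_spec_seq (lam^~ (a0 + t)))//.
have -> : mu (nth ord0 s n) t = nth 0 [seq mu (i : 'I_p) t | i <- s] n.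
  by rewrite (nth_map ord0) ?ss.
congr nth; apply: (sorted_eq (@le_trans _ R) (@le_anti _ R)) => //.
  rewrite sorted_map; apply: (sub_sorted _ (sort_sorted rel_total _)) => i j /asboolP.
  by apply.
apply: prod_XsubC_perm; rewrite -cp He2 ?(lt_trans te)// big_map.
by rewrite (perm_big _ (permEl (perm_sort _ _))) big_enum.
Qed.

Lemma band_analytic k : - N%:Z <= k <= N%:Z -> real_analytic_on `[0, 2] (lam k).
Proof.
move=> kN a0 a02; have [g [[c Hg] /near0P[e [e0 He]]]] := band_germ a02 kN.
have [r [r0 [M HM]]] := Hg.
have i0 : 0 < Num.min e r by rewrite lt_min e0.
exists (Num.min e r), c; split=> // x x02; rewrite lt_min => /andP[xe xr].
have -> : lam k x = g (x - a0) by rewrite -He// addrC subrK.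
set t := x - a0; set y := `|t| / r.
have y0 : 0 <= y by rewrite divr_ge0// ltW.
have y1 : `|y| < 1 by rewrite ger0_norm// ltr_pdivrMr// mul1r.
have -> : series (fun n => c n * t ^+ n) = psum c ^~ t.
  by apply/funext => n; rewrite /psum /series /= big_mkord.
apply/cvgrPdist_le => eps eps0.
have C : M * y ^+ m @[m --> \oo] --> 0.
  by rewrite -(mulr0 M); apply: cvgM; [exact: cvg_cst|exact: cvg_expr].
near=> m; apply: le_trans (HM m t xr) _; rewrite -/y.
near: m; move/cvgrPdist_le : C => /(_ _ eps0); apply: filterS => m.
by rewrite sub0r normrN; apply: le_trans; exact: ler_norm.
Unshelve. all: by end_near.
Qed.

Lemma band_continuous k : - N%:Z <= k <= N%:Z -> {within `[0, 2], continuous (lam k)}.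
Proof.
move=> kN; apply/subspace_continuousP => a0 /= a02.
have [g [ag /near0P[e [e0 He]]]] := band_germ a02 kN.
apply/cvgrPdist_lt => eps eps0.
have [d [d0 Hd]] := analytic0_cont ag eps0.
rewrite /prop_near1 /= /within /=; apply/nbhs_ballP; exists (Num.min d e) => /=.
  by rewrite lt_min d0.
move=> x; rewrite /ball /= distrC lt_min => /andP[xd xe] x02.
have gx : lam k x = g (x - a0) by rewrite -He// addrC subrK.
have ga : lam k a0 = g 0 by rewrite -[a0 in LHS]addr0 He ?normr0 ?addr0.
by rewrite -[_ - _]/(lam k a0 - lam k x) gx ga distrC Hd.
Qed.

(** Extreme values are attained, and values in between are taken. *)
Lemma band_image k : - N%:Z <= k <= N%:Z -> exists l u : R,
  lam k @` `[0, 2]%classic = `[l, u]%classic.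
Proof.
move=> kN; have ck := band_continuous kN.
have [am am02 Hm] := EVT_min (@ler0n R 2) ck.
have [aM aM02 HM] := EVT_max (@ler0n R 2) ck.
exists (lam k am), (lam k aM); apply/seteqP; split.
  by move=> _ [x x02 <-] /=; rewrite in_itv /= Hm// HM.
move=> y /=; rewrite in_itv /= => /andP[y1 y2].
have ivt x z : x \in `[0, 2] -> z \in `[0, 2] -> x <= z ->
    Num.min (lam k x) (lam k z) <= y <= Num.max (lam k x) (lam k z) ->
    exists2 c, c \in `[0, 2] & lam k c = y.
  rewrite !in_itv /= => /andP[x0 x2] /andP[z0 z2] xz yb.
  have [|c] := IVT xz _ yb.
    apply: continuous_subspaceW ck => w /=; rewrite !in_itv /= => /andP[w1 w2].
    by rewrite (le_trans x0)// (le_trans w2).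
  rewrite in_itv /= => /andP[c1 c2] cy; exists c => //.
  by rewrite in_itv /= (le_trans x0)// (le_trans c2).
suff [c c02 cy] : exists2 c, c \in `[0, 2] & lam k c = y by exists c.
have yy : Num.min (lam k am) (lam k aM) <= y <= Num.max (lam k am) (lam k aM).
  by rewrite ge_min y1 le_max y2 orbT.
have [h|h] := leP am aM; first exact: (ivt am aM).
by apply: (ivt aM am) => //; [exact: ltW|rewrite minC maxC].
Qed.

End Bands.

End Jacobi.

(** * Completeness of L^2 *)

Section RieszFischer.
Context d (T : measurableType d) (R : realType) (mu : {measure set T -> \bar R}).
Variable D : set T.
Hypothesis mD : measurable D.

(** The increments are dominated by a geometric series. *)
Lemma geometric_increments (u : nat -> R) (s : R) : 0 <= s ->
  (forall j, `|u j.+1 - u j| <= s / 2 ^+ j) ->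
  cvgn u /\ forall J, `|limn u - u J| <= 2 * s / 2 ^+ J.
Proof.
move=> s0 Hu.
have tail J k : `|u (J + k)%N - u J| <= 2 * s / 2 ^+ J * (1 - 2^-1 ^+ k).
  elim: k => [|k IH]; first by rewrite addn0 subrr normr0 expr0 subrr mulr0.
  have -> : u (J + k.+1)%N - u J = (u (J + k).+1 - u (J + k)%N) + (u (J + k)%N - u J).
    by rewrite addnS; ring.
  apply: le_trans (ler_normD _ _) _.
  have := lerD (Hu (J + k)%N) IH; move/le_trans; apply.
  rewrite exprD -exprVn invfM -!exprVn exprS le_eqVlt; apply/orP; left; apply/eqP; by field.
have cu : cvgn u.
  have -> : u = fun n => u 0%N + series (fun j => u j.+1 - u j) n.
    apply/funext => n; rewrite /series /=; elim: n => [|n IH].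
      by rewrite big_geq// addr0.
    by rewrite big_nat_recr//= addrA -IH addrC subrK.
  apply: is_cvgD; first exact: is_cvg_cst.
  apply: normed_cvg; apply: (@series_le_cvg _ _ (geometric s 2^-1)) => //.
  - by move=> n /=.
  - by move=> n /=; rewrite mulr_ge0 ?exprn_ge0.
  - by move=> n /=; rewrite exprVn; exact: Hu.
  - by apply: is_cvg_geometric_series; rewrite ger0_norm; lra.
split=> // J.
have cv2 : (fun k => `|u k - u J|) @ \oo --> `|limn u - u J|.
  by apply: cvg_norm; apply: cvgB => //; exact: cvg_cst.
rewrite -(cvg_lim _ cv2)//; apply: limr_le; first by apply/cvg_ex; eexists; exact: cv2.
near=> k.
have Jk : (J <= k)%N by near: k; exact: nbhs_infty_ge.
rewrite -(subnKC Jk); apply: le_trans (tail _ _) _.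
by rewrite ler_piMr ?divr_ge0 ?mulr_ge0 ?exprn_ge0// gerBl exprn_ge0.
Unshelve. all: by end_near.
Qed.

(** The weights 4^j make W, the sum of the 4^j (u_(j+1) - u_j)^2, integrable and
    hence finite almost everywhere; where it is finite, the increments of u are
    at most sqrt W / 2^j, so u converges pointwise and its distance to the limit
    is controlled by W.  Where W is infinite the limit is replaced by 0. *)
Lemma riesz_fischer (u : nat -> T -> R) (C : R) :
  (forall j, measurable_fun D (u j)) ->
  (forall j, \int[mu]_(x in D) ((u j.+1 x - u j x) ^+ 2)%:E <= (C / 8 ^+ j)%:E)%E ->
  exists w : T -> R, measurable_fun D w /\
    forall J, (\int[mu]_(x in D) ((w x - u J x) ^+ 2)%:E <= (8 * C / 4 ^+ J)%:E)%E.
Proof.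
move=> mu_ Hu.
pose f j x : \bar R := (4 ^+ j * (u j.+1 x - u j x) ^+ 2)%:E.
have f0 j x : (0 <= f j x)%E by rewrite lee_fin mulr_ge0 ?sqr_ge0 ?exprn_ge0.
have mdiff j J : measurable_fun D (fun x => (u j x - u J x) ^+ 2).
  by apply: measurable_funX; exact: measurable_funB.
have mf j : measurable_fun D (f j).
  by apply/measurable_EFinP; apply: measurable_funM => //; exact: measurable_cst.
pose W x := (\sum_(0 <= j <oo) f j x)%E.
have mW : measurable_fun D W by apply: ge0_emeasurable_sum.
have W0 x : (0 <= W x)%E by apply: nneseries_ge0.
have intW : (\int[mu]_(x in D) W x <= (2 * C)%:E)%E.
  rewrite integral_nneseries//; apply: lime_le.
    by apply: is_cvg_nneseries => n _ _; exact: integral_ge0.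
  apply: nearW => n.
  have C0 : 0 <= C.
    have := Hu 0%N; rewrite expr0 divr1 -lee_fin; apply: le_trans.
    by apply: integral_ge0 => x _; rewrite lee_fin sqr_ge0.
  apply: (@le_trans _ _ (2 * C * (1 - 2^-1 ^+ n))%:E); last first.
    by rewrite lee_fin ler_piMr ?mulr_ge0// gerBl exprn_ge0.
  elim: n => [|n IH]; first by rewrite big_geq// expr0 subrr mulr0.
  rewrite big_nat_recr//=; apply: le_trans (leeD IH (_ : _ <= (C / 2 ^+ n)%:E)%E) _.
    rewrite /f; under eq_integral do rewrite EFinM.
    rewrite ge0_integralZl//; last 2 first.
    - by apply/measurable_EFinP.
    - by move=> x _; rewrite lee_fin sqr_ge0.
    apply: le_trans (lee_wpmul2l _ (Hu n)) _; first by rewrite lee_fin exprn_ge0.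
    rewrite -EFinM lee_fin.
    have -> : (8 : R) = 4 * 2 by ring.
    rewrite exprMn le_eqVlt; apply/orP; left; apply/eqP; field.
    by rewrite !expf_neq0.
  rewrite -EFinD lee_fin -exprVn exprS le_eqVlt; apply/orP; left; apply/eqP; by field.
pose A := D `&` [set x | (W x < +oo)%E].
have mA : measurable A by exact: emeasurable_fun_infty_o.
have pt x : D x -> (W x < +oo)%E -> let s := Num.sqrt (fine (W x)) in
    cvgn (u ^~ x) /\ forall J, `|limn (u ^~ x) - u J x| <= 2 * s / 2 ^+ J.
  move=> Dx Wx s; apply: geometric_increments; first exact: sqrtr_ge0.
  move=> j; rewrite -(ler_pXn2r (ltn0Sn 1)) ?nnegrE ?divr_ge0 ?sqrtr_ge0 ?exprn_ge0//.
  rewrite real_normK ?num_real// expr_div_n sqr_sqrtr ?fine_ge0//.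
  rewrite -exprM mulnC exprM ler_pdivlMr ?exprn_gt0// mulrC.
  have -> : (2 : R) ^+ 2 = 4 by ring.
  rewrite -lee_fin fineK; last by rewrite ge0_fin_numE.
  apply: le_trans (nneseries_lim_ge j.+1 _) => //.
  by rewrite big_nat_recr//= -[leLHS]add0e leeD2r// sume_ge0.
pose w x := if (W x < +oo)%E then limn (u ^~ x) else 0.
have mw : measurable_fun D w.
  apply: (measurable_fun_cvg (h := fun j x => u j x * \1_A x)).
    by move=> j; apply: measurable_funM => //; exact: measurable_indic.
  move=> x Dx; rewrite /w indicE; case: ifPn => Wx.
    rewrite mem_set//; under eq_fun do rewrite mulr1.
    exact: (pt x Dx Wx).1.
  rewrite memNset; last by move=> [_ /= h]; rewrite h in Wx.
  under eq_fun do rewrite mulr0; exact: cvg_cst.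
exists w; split=> // J; apply: (@le_trans _ _ (\int[mu]_(x in D) ((4 / 4 ^+ J)%:E * W x))%E).
  apply: ge0_le_integral => //.
  - by move=> x _; rewrite lee_fin sqr_ge0.
  - apply/measurable_EFinP; apply: measurable_funX; exact: measurable_funB.
  - by apply: emeasurable_funM => //; exact: measurable_cst.
  - move=> x Dx; rewrite /w; case: ifPn => Wx; last first.
      have -> : W x = +oo%E by move: Wx; rewrite -leNgt leye_eq => /eqP.
      by rewrite gt0_muley ?leey// lte_fin divr_gt0// exprn_gt0.
    have [_ /(_ J)] := pt x Dx Wx; set s := Num.sqrt _ => H.
    have -> : W x = (s ^+ 2)%:E.
      by rewrite /s sqr_sqrtr ?fine_ge0// fineK// ge0_fin_numE.
    rewrite -EFinM lee_fin -[leLHS]ger0_norm ?sqr_ge0// normrX.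
    have -> : 4 / 4 ^+ J * s ^+ 2 = (2 * s / 2 ^+ J) ^+ 2.
      by rewrite expr_div_n exprMn -exprM mulnC exprM (_ : 2 ^+ 2 = 4); ring.
    by rewrite lerXn2r ?nnegrE ?divr_ge0 ?mulr_ge0 ?sqrtr_ge0 ?exprn_ge0.
have c0 : (0 <= (4 / 4 ^+ J : R)%:E)%E by rewrite lee_fin divr_ge0 ?exprn_ge0.
rewrite ge0_integralZl//.
apply: (@le_trans _ _ ((4 / 4 ^+ J)%:E * (2 * C)%:E)%E); first exact: lee_wpmul2l.
by rewrite -EFinM lee_fin le_eqVlt; apply/orP; left; apply/eqP; ring.
Qed.

End RieszFischer.

(** * Square integrable complex functions on the circle *)

Section SquareIntegrable.
Variable R : realType.
Implicit Types (h k : R -> R[i]) (c z w : R[i]).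
Local Notation mu := (@lebesgue_measure R).
Local Notation circle := (@circle R).
Local Notation normc := ComplexField.Normc.normc.
Local Notation Re := complex.Re.
Local Notation Im := complex.Im.

Lemma measurable_circle : measurable (circle : set (measurableTypeR R)).
Proof. exact: measurable_itv. Qed.
Hint Resolve measurable_circle : core.

(** The same set over R itself, a type formally distinct from its measurable
    alias. *)
Lemma measurable_circle' : measurable circle.
Proof. exact: measurable_itv. Qed.
Hint Resolve measurable_circle' : core.

Lemma circle_measure : mu circle = (2 * pi)%:E.
Proof.
have := @lebesgue_measure_itv R `[0, (2 * pi)[.
by rewrite /= lte_fin mulr_gt0 ?pi_gt0// -EFinB subr0.
Qed.

Lemma normc_sqr z : normc z ^+ 2 = normsq z.
Proof. by case: z => a b; rewrite /normsq /= sqr_sqrtr// addr_ge0 ?sqr_ge0. Qed.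

Lemma normsq_conj z : normsq z^*%C = normsq z.
Proof. by case: z => a b; rewrite /normsq /= sqrrN. Qed.

Lemma normsqD_le z w : normsq (z + w) <= 2 * normsq z + 2 * normsq w.
Proof.
case: z w => [a b] [c e]; rewrite /normsq /=.
by have := sqr_ge0 (a - c); have := sqr_ge0 (b - e); rewrite !sqrrB !sqrrD; lra.
Qed.

Lemma Re_mul_le z w : `|Re (z * w)| <= normsq z + normsq w.
Proof.
case: z w => [a b] [c e]; rewrite /normsq /= ler_norml.
have := sqr_ge0 (a - c); have := sqr_ge0 (b - e); have := sqr_ge0 (a + c);
have := sqr_ge0 (b + e); rewrite !sqrrB !sqrrD; have := sqr_ge0 a; have := sqr_ge0 b;
have := sqr_ge0 c; have := sqr_ge0 e; lra.
Qed.

Lemma Im_mul_le z w : `|Im (z * w)| <= normsq z + normsq w.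
Proof.
case: z w => [a b] [c e]; rewrite /normsq /= ler_norml.
have := sqr_ge0 (a - e); have := sqr_ge0 (b - c); have := sqr_ge0 (a + e);
have := sqr_ge0 (b + c); rewrite !sqrrB !sqrrD; have := sqr_ge0 a; have := sqr_ge0 b;
have := sqr_ge0 c; have := sqr_ge0 e; lra.
Qed.

Lemma mul_conj z : z * z^*%C = (normsq z)%:C.
Proof. by case: z => a b; apply/eqP; rewrite eq_complex /normsq /=; apply/andP; split; apply/eqP; ring. Qed.

Definition cmeas h := measurable_fun circle (fun t => Re (h t)) /\
  measurable_fun circle (fun t => Im (h t)).

Lemma cmeas_cst c : cmeas (fun=> c).
Proof. by split; exact: measurable_cst. Qed.

Lemma cmeasD h k : cmeas h -> cmeas k -> cmeas (fun t => h t + k t).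
Proof.
move=> [h1 h2] [k1 k2]; split.
  by under eq_fun do rewrite raddfD /=; exact: measurable_funD.
by under eq_fun do rewrite raddfD /=; exact: measurable_funD.
Qed.

Lemma cmeasM h k : cmeas h -> cmeas k -> cmeas (fun t => h t * k t).
Proof.
move=> [h1 h2] [k1 k2]; split.
  have -> : (fun t => Re (h t * k t)) = (fun t => Re (h t) * Re (k t) - Im (h t) * Im (k t)).
    by apply/funext => t; case: (h t) (k t) => [a b] [c e].
  by apply: measurable_funB; exact: measurable_funM.
have -> : (fun t => Im (h t * k t)) = (fun t => Re (h t) * Im (k t) + Im (h t) * Re (k t)).
  by apply/funext => t; case: (h t) (k t) => [a b] [c e].
by apply: measurable_funD; exact: measurable_funM.
Qed.

Lemma cmeasJ h : cmeas h -> cmeas (fun t => (h t)^*%C).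
Proof.
move=> [h1 h2]; split.
  have -> : (fun t => Re (h t)^*%C) = (fun t => Re (h t)) by apply/funext => t; case: (h t).
  exact: h1.
have -> : (fun t => Im (h t)^*%C) = (fun t => - Im (h t)) by apply/funext => t; case: (h t).
exact: measurable_funN.
Qed.

Lemma cmeas_normsq h : cmeas h -> measurable_fun circle (fun t => normsq (h t)).
Proof. by move=> [h1 h2]; apply: measurable_funD; exact: measurable_funX. Qed.

Lemma cmeas_real (f : R -> R) : measurable_fun circle f -> cmeas (fun t => (f t)%:C).
Proof. by move=> mf; split=> //=; exact: measurable_cst. Qed.

Definition rintegrable (f : R -> R) := mu.-integrable circle (EFin \o f).
Definition cintegrable h := rintegrable (fun t => Re (h t)) /\ rintegrable (fun t => Im (h t)).

(** Integration of real and imaginary parts separately, normalized to total mass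
    one. *)
Definition cmean h : R[i] :=
  (((2 * pi)^-1 * \int[mu]_(t in circle) Re (h t)) +i*
   ((2 * pi)^-1 * \int[mu]_(t in circle) Im (h t)))%C.

Lemma rintegrableD (f g : R -> R) : rintegrable f -> rintegrable g -> rintegrable (fun t => f t + g t).
Proof. by move=> If Ig; exact: (integrableD measurable_circle If Ig). Qed.

Lemma rintegrableZ (a : R) (f : R -> R) : rintegrable f -> rintegrable (fun t => a * f t).
Proof. by move=> If; exact: (integrableZl measurable_circle a If). Qed.

Lemma cintegrableD h k : cintegrable h -> cintegrable k -> cintegrable (fun t => h t + k t).
Proof.
move=> [h1 h2] [k1 k2]; split.
  by under [fun t => Re _]eq_fun do rewrite raddfD /=; exact: rintegrableD.
by under [fun t => Im _]eq_fun do rewrite raddfD /=; exact: rintegrableD.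
Qed.

Lemma cintegrableZ c h : cintegrable h -> cintegrable (fun t => c * h t).
Proof.
case: c => a b [h1 h2]; split.
  have -> : (fun t => Re ((a +i* b)%C * h t)) = (fun t => a * Re (h t) + (- b) * Im (h t)).
    by apply/funext => t; case: (h t) => x y /=; ring.
  by apply: rintegrableD; exact: rintegrableZ.
have -> : (fun t => Im ((a +i* b)%C * h t)) = (fun t => a * Im (h t) + b * Re (h t)).
  by apply/funext => t; case: (h t) => x y /=.
by apply: rintegrableD; exact: rintegrableZ.
Qed.

Lemma cmeanD h k : cintegrable h -> cintegrable k ->
  cmean (fun t => h t + k t) = cmean h + cmean k.
Proof.
move=> [h1 h2] [k1 k2]; apply/eqP; rewrite eq_complex /=; apply/andP; split; apply/eqP.
  rewrite -mulrDr -RintegralD//; congr (_ * _); apply: eq_Rintegral => t _.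
  by rewrite raddfD.
rewrite -mulrDr -RintegralD//; congr (_ * _); apply: eq_Rintegral => t _.
by rewrite raddfD.
Qed.

Lemma cmeanZ c h : cintegrable h -> cmean (fun t => c * h t) = c * cmean h.
Proof.
case: c => a b [h1 h2]; apply/eqP; rewrite eq_complex /=; apply/andP; split; apply/eqP.
  have -> : \int[mu]_(t in circle) Re ((a +i* b)%C * h t) =
      \int[mu]_(t in circle) (a * Re (h t) + (- b) * Im (h t)).
    by apply: eq_Rintegral => t _; case: (h t) => x y /=; ring.
  by rewrite RintegralD ?RintegralZl//; try exact: rintegrableZ; ring.
have -> : \int[mu]_(t in circle) Im ((a +i* b)%C * h t) =
    \int[mu]_(t in circle) (a * Im (h t) + b * Re (h t)).
  by apply: eq_Rintegral => t _; case: (h t) => x y /=; ring.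
by rewrite RintegralD ?RintegralZl//; try exact: rintegrableZ; ring.
Qed.

Lemma cmeanJ h : cintegrable h -> cmean (fun t => (h t)^*%C) = (cmean h)^*%C.
Proof.
move=> [h1 h2]; apply/eqP; rewrite eq_complex /=; apply/andP; split; apply/eqP.
  by congr (_ * _); apply: eq_Rintegral => t _; case: (h t).
have -> : \int[mu]_(t in circle) Im (h t)^*%C = \int[mu]_(t in circle) (-1 * Im (h t)).
  by apply: eq_Rintegral => t _; case: (h t) => a b /=; rewrite mulN1r.
by rewrite RintegralZl// mulN1r mulrN.
Qed.

Lemma cintegrable0 : cintegrable (fun=> 0).
Proof. by split; exact: integrable0. Qed.

Lemma cmean0 : cmean (fun=> 0) = 0.
Proof.
by apply/eqP; rewrite eq_complex /= /Rintegral integral0 mulr0 eqxx.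
Qed.

Lemma cintegrable_sum (I : Type) (s : seq I) (hs : I -> R -> R[i]) :
  (forall i, cintegrable (hs i)) -> cintegrable (fun t => \sum_(i <- s) hs i t).
Proof.
move=> H; elim: s => [|i s IH]; first by under eq_fun do rewrite big_nil; exact: cintegrable0.
by under eq_fun do rewrite big_cons; exact: cintegrableD.
Qed.

Lemma cmean_sum (I : Type) (s : seq I) (hs : I -> R -> R[i]) :
  (forall i, cintegrable (hs i)) -> cmean (fun t => \sum_(i <- s) hs i t) = \sum_(i <- s) cmean (hs i).
Proof.
move=> H; elim: s => [|i s IH].
  by rewrite big_nil; under eq_fun do rewrite big_nil; exact: cmean0.
rewrite big_cons -IH -cmeanD//; last exact: cintegrable_sum.
by congr cmean; apply/funext => t; rewrite big_cons.
Qed.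

Definition sqint h := cmeas h /\ (\int[mu]_(t in circle) (normsq (h t))%:E < +oo)%E.

Lemma sqint_rintegrable h : sqint h -> rintegrable (fun t => normsq (h t)).
Proof.
move=> [mh fh]; apply/integrableP; split.
  by apply/measurable_EFinP; exact: cmeas_normsq.
by under eq_integral do rewrite gee0_abs ?lee_fin ?normsq_ge0//.
Qed.

Lemma sqint_le h k (B : R) : cmeas h -> sqint k -> 0 <= B ->
  (forall t, circle t -> normsq (h t) <= B * normsq (k t)) -> sqint h.
Proof.
move=> mh sk B0 H; split=> //.
have := rintegrableZ B (sqint_rintegrable sk) => /integrableP[mI]; apply: le_lt_trans.
apply: ge0_le_integral => //.
- by move=> t _; rewrite lee_fin normsq_ge0.
- by apply/measurable_EFinP; exact: cmeas_normsq.
- by apply: measurableT_comp.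
- move=> t Dt; rewrite /= lee_fin; apply: le_trans (ler_norm _).
  exact: H.
Qed.

Lemma sqintD h k : sqint h -> sqint k -> sqint (fun t => h t + k t).
Proof.
move=> sh sk; split; first exact: cmeasD sh.1 sk.1.
have := rintegrableD (rintegrableZ 2 (sqint_rintegrable sh)) (rintegrableZ 2 (sqint_rintegrable sk)).
move=> /integrableP[mI]; apply: le_lt_trans.
apply: ge0_le_integral => //.
- by move=> t _; rewrite lee_fin normsq_ge0.
- by apply/measurable_EFinP; apply: cmeas_normsq; exact: cmeasD sh.1 sk.1.
- by apply: measurableT_comp.
- by move=> t Dt; rewrite /= lee_fin; apply: le_trans (ler_norm _); exact: normsqD_le.
Qed.

Lemma sqint_bounded m h (B : R) : cmeas m -> (forall t, circle t -> normsq (m t) <= B) ->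
  sqint h -> sqint (fun t => m t * h t).
Proof.
move=> mm mB sh; have [|nB] := leP 0 B; last first.
  have c0 : circle 0 by rewrite /Defs.circle /= in_itv /= lexx mulr_gt0// pi_gt0.
  by have := mB _ c0; have := normsq_ge0 (m 0); lra.
move=> B0; apply: (sqint_le _ sh B0); first exact: cmeasM mm sh.1.
by move=> t Dt; rewrite normsqM ler_wpM2r ?normsq_ge0 ?mB.
Qed.

Lemma sqintZ c h : sqint h -> sqint (fun t => c * h t).
Proof. by apply: (sqint_bounded (B := normsq c)); [exact: cmeas_cst|]. Qed.

Lemma sqint1 : sqint (fun=> 1).
Proof.
split; first exact: cmeas_cst.
have E1 : normsq 1 = 1 :> R by rewrite /normsq /= expr1n expr0n addr0.
under eq_integral do rewrite E1.
rewrite (integral_cst mu measurable_circle) mul1e; apply: (@le_lt_trans _ _ (2 * pi)%:E); last exact: ltry.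
by rewrite -circle_measure.
Qed.

Lemma sqint_of_bounded m (B : R) : cmeas m -> (forall t, circle t -> normsq (m t) <= B) -> sqint m.
Proof.
move=> mm mB; have := sqint_bounded mm mB sqint1.
by under eq_fun do rewrite mulr1.
Qed.

Lemma sqintJ h : sqint h -> sqint (fun t => (h t)^*%C).
Proof.
move=> [mh fh]; split; first exact: cmeasJ.
by under eq_integral do rewrite normsq_conj.
Qed.

Lemma sqint_sum (I : Type) (s : seq I) (hs : I -> R -> R[i]) :
  (forall i, sqint (hs i)) -> sqint (fun t => \sum_(i <- s) hs i t).
Proof.
move=> H; elim: s => [|i s IH].
  under eq_fun do rewrite big_nil.
  by have := sqintZ 0 sqint1; under eq_fun do rewrite mul0r.
by under eq_fun do rewrite big_cons; exact: sqintD.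
Qed.

Lemma sqintM h k : sqint h -> sqint k -> cintegrable (fun t => h t * k t).
Proof.
move=> sh sk; have [m1 m2] := cmeasM sh.1 sk.1.
have I := rintegrableD (sqint_rintegrable sh) (sqint_rintegrable sk).
split; apply: (le_integrable measurable_circle _ _ I).
- by apply/measurable_EFinP.
- move=> t _ /=; rewrite lee_fin (le_trans (Re_mul_le _ _))//.
  exact: ler_norm.
- by apply/measurable_EFinP.
- move=> t _ /=; rewrite lee_fin (le_trans (Im_mul_le _ _))//.
  exact: ler_norm.
Qed.

(** Passage from the extended real valued norm to a mean, where linearity is
    available. *)
Lemma sqint_mean h : sqint h ->
  (((2 * pi)^-1)%:E * \int[mu]_(t in circle) (normsq (h t))%:E)%E = (Re (cmean (fun t => h t * (h t)^*%C)))%:E.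
Proof.
move=> sh; rewrite /cmean /=.
have -> : \int[mu]_(t in circle) Re (h t * (h t)^*%C) = \int[mu]_(t in circle) normsq (h t).
  by apply: eq_Rintegral => t _; rewrite mul_conj.
rewrite EFinM; congr (_ * _)%E; rewrite /Rintegral fineK//.
rewrite ge0_fin_numE ?sh.2//.
by apply: integral_ge0 => t _; rewrite lee_fin normsq_ge0.
Qed.

End SquareIntegrable.

(** * Characters of the circle and their completeness *)

Section Fourier.
Variable R : realType.
Local Notation mu := (@lebesgue_measure R).
Local Notation circle := (@circle R).
Local Notation Re := complex.Re.
Local Notation Im := complex.Im.

(** The complex number e^(ix). *)
Definition expi (x : R) : R[i] := (cos x +i* sin x)%C.

Lemma expiD x y : expi (x + y) = expi x * expi y.
Proof. by rewrite /expi cosD sinD; apply/eqP; rewrite eq_complex /= !eqxx /= addrC. Qed.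

Lemma conjcM (z w : R[i]) : (z * w)^*%C = z^*%C * w^*%C.
Proof. exact: rmorphM. Qed.

Lemma expi0 : expi 0 = 1.
Proof. by rewrite /expi cos0 sin0. Qed.

Lemma expi_conj x : (expi x)^*%C = expi (- x).
Proof. by rewrite /expi cosN sinN. Qed.

Lemma normsq_expi x : normsq (expi x) = 1.
Proof. by rewrite /normsq /= cos2Dsin2. Qed.

Lemma expi_mulC x : expi (- x) * expi x = 1.
Proof. by rewrite -expiD addNr expi0. Qed.

Lemma expiMn x n : expi (n%:R * x) = expi x ^+ n.
Proof.
elim: n => [|n IH]; first by rewrite mul0r expi0.
by rewrite -natr1 mulrDl mul1r expiD IH exprSr.
Qed.

Lemma expi_2pi_int (n : int) : expi (n%:~R * (2 * pi)) = 1.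
Proof.
have E m : expi (m%:R * (2 * pi)) = 1.
  rewrite expiMn; have -> : expi (2 * pi) = 1; last by rewrite expr1n.
  by rewrite /expi mulr_natl cos2pi sin2pi.
case: n => n; first exact: E.
by rewrite NegzE mulrNz mulNr -expi_conj E conjc1.
Qed.

Lemma continuous_scale (k : R) : continuous (fun t : R => k * t).
Proof. by move=> t; apply: cvgM; [exact: cvg_cst|exact: cvg_id]. Qed.

Lemma cmeas_expi (k : R) : cmeas (fun t => expi (k * t)).
Proof.
split; apply: measurable_funTS; apply: continuous_measurable_fun => t;
  apply: continuous_comp; try exact: continuous_scale.
- exact: continuous_cos.
- exact: continuous_sin.
Qed.

(** By the fundamental theorem of calculus: the primitives sin (k t) / k and
    - cos (k t) / k take the same values at both ends. *)
Lemma Rintegral_expi (k : R) : k != 0 -> expi (k * (2 * pi)) = 1 ->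
  \int[mu]_(t in circle) cos (k * t) = 0 /\ \int[mu]_(t in circle) sin (k * t) = 0.
Proof.
move=> k0 e2; have pi2 : 0 < 2 * pi :> R by rewrite mulr_gt0// pi_gt0.
have FTC (f F : R -> R) : continuous f -> (forall x : R, is_derive x (1 : R) F (f x)) -> F (2 * pi) = F 0 ->
    \int[mu]_(t in circle) f t = 0.
  move=> cf dF F0.
  have cF : continuous F by move=> x; apply: differentiable_continuous; apply/derivable1_diffP; apply: (@ex_derive _ _ _ _ _ _ _ (dF x)).
  rewrite /Defs.circle.
  have I : mu.-integrable `[0, 2 * pi] (EFin \o f).
    by apply: continuous_compact_integrable; [exact: segment_compact|exact: continuous_subspaceT].
  rewrite Rintegral_itv_bndo_bndc; last first.
    by apply: integrableS I => //; exact: subset_itv_co_cc.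
  rewrite /Rintegral (continuous_FTC2 pi2 (F := F)).
  - by rewrite F0 -EFinB subrr.
  - exact: continuous_subspaceT.
  - split=> [x _||]; first exact: (@ex_derive _ _ _ _ _ _ _ (dF x)).
      by apply: cvg_at_right_filter; exact: cF.
    by apply: cvg_at_left_filter; exact: cF.
  - by move=> x _; rewrite derive1E; exact: derive_val.
have [c1 s0] : cos (k * (2 * pi)) = 1 /\ sin (k * (2 * pi)) = 0.
  by move/eqP: e2; rewrite eq_complex /= => /andP[/eqP ? /eqP ?].
split.
  apply: (FTC _ (fun t => k^-1 * sin (k * t))).
  - by move=> t; apply: continuous_comp; [exact: continuous_scale|exact: continuous_cos].
  - move=> x; apply: is_derive_eq; rewrite /GRing.scale /=; by field.
  - by rewrite s0 !mulr0 sin0 mulr0.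
apply: (FTC _ (fun t => - k^-1 * cos (k * t))).
- by move=> t; apply: continuous_comp; [exact: continuous_scale|exact: continuous_sin].
- move=> x; apply: is_derive_eq; rewrite /GRing.scale /=; by field.
- by rewrite c1 mulr0 cos0.
Qed.

(** The character e^(int). *)
Definition chr (n : int) (t : R) : R[i] := expi (n%:~R * t).

Lemma chrD m n t : chr (m + n) t = chr m t * chr n t.
Proof. by rewrite /chr intrD mulrDl expiD. Qed.

Lemma chr_conj n t : (chr n t)^*%C = chr (- n) t.
Proof. by rewrite /chr expi_conj mulrNz mulNr. Qed.

Lemma chr0 t : chr 0 t = 1.
Proof. by rewrite /chr mul0r expi0. Qed.

Lemma chr1Xn (n : nat) t : expi t ^+ n = chr n t.
Proof. by rewrite -expiMn. Qed.

Lemma normsq_chr n t : normsq (chr n t) = 1.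
Proof. exact: normsq_expi. Qed.

Lemma cmeas_chr n : cmeas (chr n).
Proof. exact: cmeas_expi. Qed.

Lemma sqint_chr n : sqint (chr n).
Proof. by apply: (sqint_of_bounded (B := 1)) => [|t _]; [exact: cmeas_chr|rewrite normsq_chr]. Qed.

Lemma cmean_chr n : cmean (chr n) = (n == 0)%:R.
Proof.
have [->|n0] := eqVneq n 0.
  have -> : chr 0 = fun=> 1 by apply/funext => t; rewrite chr0.
  apply/eqP; rewrite eq_complex /= Rintegral_cst; last exact: measurable_circle.
  rewrite Rintegral_cst; last exact: measurable_circle.
  have -> : fine (mu circle) = 2 * pi by rewrite circle_measure.
  by rewrite mul0r mulr0 mul1r mulVf ?eqxx// gt_eqF// mulr_gt0// pi_gt0.
have [|c0 s0] := @Rintegral_expi n%:~R _ (expi_2pi_int n); first by rewrite intr_eq0.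
by apply/eqP; rewrite eq_complex /= c0 s0 !mulr0 eqxx.
Qed.

(** A trigonometric polynomial, equal to 1/2 - (cos (t - b/2) - cos (b/2)) / 4,
    with values in [0, 1], below 1/2 on the arc (0, b) and above 1/2 on
    (b, 2 pi). *)
Definition arc_coord (b t : R) : R := 2^-1 - 2^-1 * (sin (t / 2) * sin ((b - t) / 2)).

Lemma arc_coord_itv b t : 0 <= arc_coord b t <= 1.
Proof.
have [s1 s2] := (sin_le1 (t / 2), sin_le1 ((b - t) / 2)).
have [s3 s4] := (sin_geN1 (t / 2), sin_geN1 ((b - t) / 2)).
have : `|sin (t / 2) * sin ((b - t) / 2)| <= 1.
  by rewrite normrM mulr_ile1// ler_norml ?s1 ?s2 ?s3 ?s4.
by rewrite ler_norml /arc_coord => /andP[? ?]; lra.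
Qed.

Lemma arc_coord_lt b t : 0 < b < 2 * pi -> 0 < t < b -> arc_coord b t < 2^-1.
Proof.
move=> /andP[b0 b2] /andP[t0 tb]; rewrite /arc_coord ltrBlDr ltrDl mulr_gt0// mulr_gt0//; apply: sin_gt0_pi; lra.
Qed.

Lemma arc_coord_gt b t : 0 < b < 2 * pi -> b < t < 2 * pi -> 2^-1 < arc_coord b t.
Proof.
move=> /andP[b0 b2] /andP[bt t2].
have -> : arc_coord b t = 2^-1 + 2^-1 * (sin (t / 2) * sin ((t - b) / 2)).
  by rewrite /arc_coord -[b - t]opprB mulNr sinN; ring.
by rewrite ltrDl mulr_gt0// mulr_gt0//; apply: sin_gt0_pi; lra.
Qed.

(** Powers (1 - x^n)^(2^n) converge on [0, 1] to 1 for x < 1/2 and to 0 for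
    x > 1/2, since 2^n x^n tends to 0 or to infinity.  Composed with [arc_coord]
    they are trigonometric polynomials approaching the indicator of an arc, and
    stay bounded, which replaces the theorem of Weierstrass here. *)
Definition step_approx (x : R) (n : nat) : R := (1 - x ^+ n) ^+ (2 ^ n).

Lemma step_approx_itv x n : 0 <= x <= 1 -> 0 <= step_approx x n <= 1.
Proof.
move=> /andP[x0 x1]; have h : 0 <= 1 - x ^+ n <= 1.
  by rewrite subr_ge0 exprn_ile1//= gerBl exprn_ge0.
by case/andP: h => h1 h2; rewrite exprn_ge0//= exprn_ile1.
Qed.

Lemma bernoulli (y : R) (n : nat) : 0 <= y <= 1 -> 1 - n%:R * y <= (1 - y) ^+ n.
Proof.
move=> /andP[y0 y1]; elim: n => [|n IH]; first by rewrite mul0r subr0 expr0.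
rewrite exprSr; have h := ler_wpM2r (_ : 0 <= 1 - y) IH.
apply: le_trans (h _); last by rewrite subr_ge0.
have : 0 <= n%:R * (y * y) by rewrite !mulr_ge0.
rewrite -natr1; nra.
Qed.

Lemma step_approx_lt x : 0 <= x < 2^-1 -> step_approx x n @[n --> \oo] --> (1 : R).
Proof.
move=> /andP[x0 x1].
have x1' : x <= 1 by lra.
have low n : 1 - (2 * x) ^+ n <= step_approx x n.
  rewrite exprMn -natrX; apply: bernoulli; rewrite exprn_ge0//= exprn_ile1//.
have C : 1 - (2 * x) ^+ n @[n --> \oo] --> (1 - 0 : R).
  apply: cvgB; [exact: cvg_cst|apply: cvg_expr; rewrite ger0_norm; lra].
rewrite subr0 in C; apply: (squeeze_cvgr _ C (@cvg_cst R (1 : R) nat _ _)).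
apply: nearW => n; rewrite low/=.
by have /andP[] := step_approx_itv n (introT andP (conj x0 x1')).
Qed.

Lemma step_approx_gt x : 2^-1 < x <= 1 -> step_approx x n @[n --> \oo] --> (0 : R).
Proof.
move=> /andP[x0 x1].
have x0' : 0 <= x by lra.
have up n : step_approx x n <= (2 * x)^-1 ^+ n.
  have xn : 0 <= x ^+ n <= 1 by rewrite exprn_ge0//= exprn_ile1.
  have q0 : 0 <= step_approx x n by have /andP[] := step_approx_itv n (introT andP (conj x0' x1)).
  (* (1 - y)^k (1 + y)^k <= 1, and (1 + y)^k >= k y. *)
  have : step_approx x n * (1 + x ^+ n) ^+ (2 ^ n) <= 1.
    rewrite /step_approx -exprMn exprn_ile1//; case/andP: xn => a b.
      by rewrite mulr_ge0 ?subr_ge0// addr_ge0.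
    by have -> : (1 - x ^+ n) * (1 + x ^+ n) = 1 - x ^+ n * x ^+ n; [ring|rewrite gerBl mulr_ge0].
  have B : (2 * x) ^+ n <= (1 + x ^+ n) ^+ (2 ^ n).
    rewrite exprMn -natrX; case/andP: xn => a _.
    elim: (2 ^ n)%N => [|m IH]; first by rewrite mul0r expr0.
    rewrite exprS -natr1 mulrDl mul1r.
    have o : 1 <= (1 + x ^+ n) ^+ m by rewrite exprn_ege1// lerDl.
    have := ler_wpM2l a o; rewrite mulr1 mulrDl mul1r; lra.
  move=> h; rewrite exprVn -div1r ler_pdivlMr ?exprn_gt0//; last by rewrite mulr_gt0//; lra.
  exact: le_trans (ler_wpM2l q0 B) h.
have C : (2 * x)^-1 ^+ n @[n --> \oo] --> (0 : R).
  by apply: cvg_expr; rewrite ger0_norm ?invr_ge0; [rewrite invf_lt1|]; lra.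
apply: (squeeze_cvgr _ (@cvg_cst R (0 : R) nat _ _) C).
by apply: nearW => n; rewrite up andbT; have /andP[] := step_approx_itv n (introT andP (conj x0' x1)).
Qed.

Lemma arc_coord_trig b : exists A : {poly R[i]}, forall t,
  (arc_coord b t)%:C = chr (- 1%:Z) t * A.[expi t].
Proof.
(* arc_coord is al + 2 Re (be e^(it)). *)
pose al : R[i] := (2^-1 + 4^-1 * cos (b / 2))%:C.
pose be : R[i] := (- 8^-1)%:C * expi (- (b / 2)).
exists (be *: 'X^2 + al *: 'X + (be^*%C)%:P) => t.
rewrite !hornerD !hornerZ hornerXn hornerX hornerC.
have c1 : chr (- 1%:Z) t = expi (- t) by rewrite /chr mulrNz mulr1z mulN1r.
have e1 : chr (- 1%:Z) t * expi t = 1 by rewrite c1 expi_mulC.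
have -> : chr (- 1%:Z) t * (be * expi t ^+ 2 + al * expi t + be^*%C) =
    be * expi t + al + be^*%C * chr (- 1%:Z) t.
  rewrite !mulrDr [chr _ _ * be^*%C]mulrC; congr (_ + _ + _).
    by rewrite mulrCA expr2 [chr _ _ * (_ * _)]mulrA e1 mul1r.
  by rewrite mulrCA e1 mulr1.
have -> : be^*%C * chr (- 1%:Z) t = (be * expi t)^*%C.
  by rewrite conjcM expi_conj c1.
have -> : be * expi t = (- 8^-1)%:C * expi (t - b / 2) by rewrite -mulrA -expiD addrC.
apply/eqP; rewrite eq_complex /=; apply/andP; split; apply/eqP; last by ring.
have -> : t - b / 2 = t / 2 - (b - t) / 2 by field.
have -> : b / 2 = t / 2 + (b - t) / 2 by field.
by rewrite /arc_coord cosB cosD; field.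
Qed.

Lemma step_approx_trig b n : exists (M : nat) (B : {poly R[i]}), forall t,
  (step_approx (arc_coord b t) n)%:C = chr (- M%:Z) t * B.[expi t].
Proof.
have [A HA] := arc_coord_trig b.
have chrX (m k : nat) t : chr (- m%:Z) t ^+ k = chr (- (m * k)%N%:Z) t.
  by rewrite /chr -expiMn mulrA; congr (expi (_ * _)); rewrite !mulrNz mulrN PoszM intrM mulrC.
exists (n * 2 ^ n)%N, (('X^n - A ^+ n) ^+ (2 ^ n)) => t.
rewrite /step_approx rmorphXn rmorphB rmorph1 rmorphXn /= HA exprMn.
rewrite !horner_exp hornerD hornerN !horner_exp hornerX -chrX -[RHS]exprMn; congr (_ ^+ _).
rewrite mulrBr -[- 1%:Z]/(- (1%N)%:Z) chrX mul1n; congr (_ - _).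
by rewrite chr1Xn -chrD addNr chr0.
Qed.

Lemma cmean_trig_eq0 (h : R -> R[i]) (M : nat) (B : {poly R[i]}) : sqint h ->
  (forall n, cmean (fun t => h t * chr n t) = 0) ->
  cmean (fun t => h t * (chr (- M%:Z) t * B.[expi t])) = 0.
Proof.
move=> sh H.
have -> : (fun t => h t * (chr (- M%:Z) t * B.[expi t])) =
    (fun t => \sum_(i < size B) B`_i * (h t * chr (- M%:Z + (i : nat)%:Z) t)).
  apply/funext => t; rewrite horner_coef !mulr_sumr; apply: eq_bigr => i _.
  by rewrite chr1Xn chrD; ring.
have I n : cintegrable (fun t => h t * chr n t) by apply: sqintM => //; exact: sqint_chr.
rewrite cmean_sum => [|i]; last exact: cintegrableZ.
by rewrite big1// => i _; rewrite cmeanZ// H mulr0.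
Qed.

(** By dominated convergence the integral of f over [0, b] vanishes for every b,
    so by the differentiation theorem of Lebesgue f vanishes almost everywhere.
    The convergence fails only at the ends 0 and b of the arc. *)
Lemma ae_eq0_of_arcs (f : R -> R) : rintegrable f ->
  (forall b n, 0 < b < 2 * pi ->
     \int[mu]_(t in circle) (f t * step_approx (arc_coord b t) n) = 0) ->
  {ae mu, forall t, circle t -> f t = 0}.
Proof.
move=> If H.
have mcoord b : measurable_fun circle (arc_coord b).
  apply: measurable_funTS; apply: continuous_measurable_fun => t.
  rewrite /arc_coord; apply: cvgB; first exact: cvg_cst.
  apply: cvgM; first exact: cvg_cst.
  apply: cvgM; apply: continuous_comp; try exact: continuous_sin.
    by apply: cvgM; [exact: cvg_id|exact: cvg_cst].
  by apply: cvgM; [apply: cvgB; [exact: cvg_cst|exact: cvg_id]|exact: cvg_cst].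
have mf : measurable_fun circle f by move/integrableP : If => [/measurable_EFinP].
have int0 b : 0 < b < 2 * pi -> \int[mu]_(t in `[0, b]) f t = 0.
  move=> b02; have /andP[b0 b2] := b02.
  pose q n t := step_approx (arc_coord b t) n.
  have q01 n t : 0 <= q n t <= 1 by apply: step_approx_itv; exact: arc_coord_itv.
  have mq n : measurable_fun circle (q n).
    apply: measurable_funX; apply: measurable_funB; first exact: measurable_cst.
    exact: measurable_funX.
  pose l t : R := f t * \1_(`[0, b[%classic) t.
  have mfq n : measurable_fun circle (fun t => f t * q n t) by exact: measurable_funM.
  have ml : measurable_fun circle l.
    by apply: measurable_funM => //; apply: measurable_indic; exact: measurable_itv.
  have [|||||_ _ C] := @dominated_convergence _ _ R mu circle (@measurable_circle R)
     (fun n t => (f t * q n t)%:E) (fun t => (l t)%:E) (fun t => `|f t|%:E).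
  - by move=> n; apply/measurable_EFinP; exact: mfq.
  - by apply/measurable_EFinP; exact: ml.
  - exists [set 0; b]; split.
    + by apply: measurableU; exact: measurable_set1.
    + by apply: countable_lebesgue_measure0; apply: finite_set_countable; exact: finite_set2.
    + move=> t /=; apply: contra_notP => /not_orP[t0 tb] ct.
      move: (ct); rewrite /Defs.circle /= in_itv /= => /andP[t1 t2].
      apply: cvg_EFin; first exact: nearW.
      rewrite /comp /= /l indicE; apply: cvgM; first exact: cvg_cst.
      case: (ltgtP t b) => // [tlb|tgb].
        rewrite mem_set /=; last by rewrite in_itv /= t1.
        apply: step_approx_lt; case/andP: (arc_coord_itv b t) => -> _ /=.
        by apply: arc_coord_lt => //; rewrite tlb andbT lt_neqAle t1 andbT eq_sym; apply/eqP.
      rewrite memNset /=; last by rewrite in_itv /= t1 /= => h; move: (lt_trans h tgb); rewrite ltxx.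
      apply: step_approx_gt; case/andP: (arc_coord_itv b t) => _ -> /=; rewrite andbT.
      by apply: arc_coord_gt => //; rewrite tgb.
  - exact: (integrable_norm If).
  - apply: aeW => t n _; rewrite lee_fin normrM ler_piMr//.
    by case/andP: (q01 n t) => q0 q1; rewrite ger0_norm.
  have l0 : \int[mu]_(t in circle) l t = 0.
    rewrite /Rintegral -(cvg_lim _ C)//.
    have -> : [sequence (\int[mu]_(x in circle) (f x * q n x)%:E)%E]_n = fun=> 0%E.
      apply/funext => n /=; have := H b n b02; rewrite /Rintegral => E.
      rewrite -[LHS]fineK ?E//.
      apply: integrable_fin_num; first exact: measurable_circle.
      apply: (le_integrable (@measurable_circle R) _ _ If).
        by apply/measurable_EFinP; exact: mfq.
      move=> t _ /=; rewrite lee_fin normrM ler_piMr//.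
      by case/andP: (q01 n t) => q0 q1; rewrite ger0_norm.
    by rewrite lim_cst.
  rewrite -Rintegral_itv_bndo_bndc; last first.
    apply: (integrableS _ _ _ If); [exact: measurable_circle|exact: measurable_itv|].
    by apply: subset_itvl; rewrite bnd_simp ltW.
  have -> : `[0, b[%classic = circle `&` `[0, b[%classic.
    apply/seteqP; split => t; last by case.
    by rewrite /Defs.circle /= !in_itv /= => /andP[h1 h2]; rewrite h1 h2 (lt_trans h2).
  rewrite Rintegral_mkcondr -[RHS]l0; apply: eq_Rintegral => t _.
  by rewrite /l patchE indicE; case: ifP => _; rewrite ?mulr1 ?mulr0.
pose g := f \_ circle.
have Ig : mu.-integrable setT (EFin \o g).
  have := (@integrable_mkcond _ _ R mu circle (EFin \o f) (@measurable_circle R)).1 If.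
  by rewrite restrict_EFin.
have locg : locally_integrable [set: R] g.
  exact: (integrable_locally_restrict (@measurable_circle R)).
have IgS y : mu.-integrable [set` Interval (BLeft 0) (BRight y)] (EFin \o g).
  by apply: (@integrableS _ _ R mu setT) => //; exact: measurable_itv.
have := @FTC1 R g (BLeft 0) IgS locg.
set F := fun x => _ => HF.
have F0 x : 0 < x < 2 * pi -> F x = 0.
  move=> x02; rewrite /F -[RHS](int0 _ x02); apply: eq_Rintegral => t.
  rewrite inE /= in_itv /= => /andP[t0 tx]; rewrite /g patchE mem_set//.
  by rewrite /Defs.circle /= in_itv /= t0 (le_lt_trans tx)//; case/andP: x02.
have HZ : {ae mu, forall t : R, t <> 0}.
  exists [set 0]; split; [exact: measurable_set1|exact: lebesgue_measure_set1|].
  by move=> t /= /contrapT.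
have aeF := ae_filter_ringOfSetsType mu.
rewrite /= in HF; apply: filterS2 HF HZ => t dF t0 ct.
move: (ct); rewrite /Defs.circle /= in_itv /= => /andP[t1 t2].
have tp : 0 < t by rewrite lt_neqAle t1 andbT eq_sym; apply/eqP.
have [|_] := dF; first by rewrite lte_fin.
rewrite /g patchE mem_set// => <-.
rewrite derive1E (near_eq_derive (g := fun=> 0)) ?derive_cst ?oner_eq0//.
near=> x; apply: F0; apply/andP; split; near: x.
  exact: lt_nbhsr.
exact: lt_nbhsl.
Unshelve. all: by end_near.
Qed.

(** A function orthogonal to the characters is orthogonal to all trigonometric
    polynomials, in particular to approximations of indicators of arcs. *)
Theorem chr_complete (h : R -> R[i]) : sqint h ->
  (forall n, cmean (fun t => h t * chr n t) = 0) ->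
  {ae mu, forall t, circle t -> h t = 0}.
Proof.
move=> sh H.
have Ih : cintegrable h.
  have := sqintM sh (sqint_chr 0).
  by under eq_fun do rewrite chr0 mulr1.
have key b n : cmean (fun t => h t * (step_approx (arc_coord b t) n)%:C) = 0.
  have [M [B E]] := step_approx_trig b n.
  by under eq_fun do rewrite E; exact: cmean_trig_eq0.
have pi0 : (2 * pi)^-1 != 0 :> R by rewrite invr_eq0 gt_eqF// mulr_gt0// pi_gt0.
have aeF := ae_filter_ringOfSetsType mu.
have [] : {ae mu, forall t, circle t -> Re (h t) = 0} /\ {ae mu, forall t, circle t -> Im (h t) = 0}; last first.
  by apply: filterS2 => t h1 h2 ct; apply/eqP; rewrite eq_complex h1// h2// eqxx.
split; [apply: (ae_eq0_of_arcs Ih.1)|apply: (ae_eq0_of_arcs Ih.2)].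
- move=> b n _; have /eqP := key b n; rewrite eq_complex /= => /andP[+ _].
  rewrite mulf_eq0 (negPf pi0) /= => /eqP E; rewrite -[RHS]E.
  by apply: eq_Rintegral => t _; case: (h t) => x y /=; ring.
- move=> b n _; have /eqP := key b n; rewrite eq_complex /= => /andP[_].
  rewrite mulf_eq0 (negPf pi0) /= => /eqP E; rewrite -[RHS]E.
  by apply: eq_Rintegral => t _; case: (h t) => x y /=; ring.
Qed.

End Fourier.

(** * Square summable sequences *)

Section SquareSummable.
Variables (R : realType) (N : nat).
Implicit Types (f g : site N -> R[i]).
Local Notation normc := ComplexField.Normc.normc.

(** Finite partial sums of the squared norm.  They avoid extended reals, and the
    squared norm is their supremum. *)
Definition mass f (s : seq (site N)) : R := \sum_(x <- s) normsq (f x).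

Lemma mass_le_l2_sqnorm f s : uniq s -> ((mass f s)%:E <= l2_sqnorm f)%E.
Proof.
move=> us; apply: esum_ge; exists [set` s]; first by split => //; exact: finite_seq.
rewrite -fsbig_seq// /mass -sumEFin le_eqVlt; apply/orP; left; apply/eqP.
by apply: eq_bigr => x _; rewrite normc_sqr.
Qed.

Lemma l2_sqnorm_le f (M : R) : (forall s, uniq s -> mass f s <= M) -> (l2_sqnorm f <= M%:E)%E.
Proof.
move=> H; apply: ge_ereal_sup => _ [A [fA _] <-].
rewrite fsbig_finite//=; have := H _ (finmap.fset_uniq (fset_set A)).
rewrite -lee_fin; apply: le_trans; rewrite /mass -sumEFin le_eqVlt; apply/orP; left; apply/eqP.
by apply: eq_bigr => x _; rewrite normc_sqr.
Qed.

Lemma l2_sqnorm_ge0 f : (0 <= l2_sqnorm f)%E.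
Proof. by apply: esum_ge0 => x _; rewrite lee_fin sqr_ge0. Qed.

Definition l2norm2 f : R := fine (l2_sqnorm f).

Lemma l2_fin f : l2 f -> l2_sqnorm f = (l2norm2 f)%:E.
Proof. by move=> lf; rewrite /l2norm2 fineK// ge0_fin_numE// l2_sqnorm_ge0. Qed.

Lemma mass_le f s : l2 f -> uniq s -> mass f s <= l2norm2 f.
Proof. by move=> lf us; rewrite -lee_fin -l2_fin//; exact: mass_le_l2_sqnorm. Qed.

Lemma mass_approx f (e : R) : l2 f -> 0 < e ->
  exists2 s, uniq s & l2norm2 f <= mass f s + e.
Proof.
move=> lf e0; apply: contrapT => H.
have : (l2_sqnorm f <= (l2norm2 f - e)%:E)%E.
  apply: l2_sqnorm_le => s us; rewrite leNgt; apply/negP => h; apply: H; exists s => //.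
  by rewrite -lerBlDr ltW.
by rewrite l2_fin// lee_fin lerBrDr gerDl leNgt e0.
Qed.

Lemma l2_of_mass f (M : R) : (forall s, uniq s -> mass f s <= M) -> l2 f.
Proof. by move=> /l2_sqnorm_le; move/le_lt_trans; apply; exact: ltry. Qed.

Lemma l2_linear (c : R[i]) f g : l2 f -> l2 g -> l2 (fun x => c * f x + g x).
Proof.
move=> lf lg; apply: (@l2_of_mass _ (2 * normsq c * l2norm2 f + 2 * l2norm2 g)) => s us.
apply: (@le_trans _ _ (2 * normsq c * mass f s + 2 * mass g s)); last first.
  by rewrite lerD// ler_wpM2l ?mulr_ge0 ?normsq_ge0// mass_le.
rewrite /mass !mulr_sumr -big_split; apply: ler_sum => x _ /=.
by apply: le_trans (normsqD_le _ _) _; rewrite normsqM mulrA.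
Qed.

End SquareSummable.

(** * Unitary transform onto the direct integral *)

Section Fibers.
Variables (R : realType) (N : nat).
Local Notation p := (2 * N).+1.
Local Notation mu := (@lebesgue_measure R).
Local Notation circle := (@circle R).
Local Notation Re := complex.Re.
Local Notation Im := complex.Im.
Implicit Types (g h k : R -> 'cV[R[i]]_p).

Definition ip g h : R[i] := \sum_(i < p) cmean (fun t => g t i 0 * (h t i 0)^*%C).
(** The squared norm of the direct integral as a real number, which agrees with
    dirint_sqnorm on its elements. *)
Definition nrm2 g : R := Re (ip g g).

Lemma dirint_sqnormE g : (forall i, cmeas (fun t => g t i 0)) -> dirint_sqnorm g =
  (((2 * pi)^-1)%:E * \sum_(i < p) \int[mu]_(t in circle) (normsq (g t i 0))%:E)%E.
Proof.
move=> mg; rewrite /dirint_sqnorm; congr (_ * _)%E.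
rewrite -(ge0_integral_sum mu (@measurable_circle R))//; last 2 first.
- by move=> i; apply/measurable_EFinP; exact: cmeas_normsq.
- by move=> i t _; rewrite lee_fin normsq_ge0.
apply: eq_integral => t _; rewrite sumEFin; congr (_%:E).
by apply: eq_bigr => i _; rewrite normc_sqr.
Qed.

Lemma dirintP g : dirint g <-> forall i, sqint (fun t => g t i 0).
Proof.
have c0 : (0 < (2 * pi)^-1 :> R) by rewrite invr_gt0 mulr_gt0// pi_gt0.
have int0 i : (0 <= \int[mu]_(t in circle) (normsq (g t i 0))%:E)%E.
  by apply: integral_ge0 => t _; rewrite lee_fin normsq_ge0.
split=> [[m1 m2 fin] i|H].
  have mg j : cmeas (fun t => g t j 0) by split; [exact: m1|exact: m2].
  split=> //; rewrite ltNge leye_eq; apply/negP => /eqP infi.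
  move: fin; rewrite dirint_sqnormE// (bigD1 i)//= infi addye.
    by rewrite gt0_muley ?lte_fin.
  by rewrite gt_eqF// (@lt_le_trans _ _ 0%E) ?ltNy0// sume_ge0.
split; [by move=> i; exact: (H i).1.1|by move=> i; exact: (H i).1.2|].
rewrite dirint_sqnormE; last by move=> i; exact: (H i).1.
rewrite lte_mul_pinfty ?lee_fin ?(ltW c0)//.
by apply: lte_sum_pinfty => i _; exact: (H i).2.
Qed.

Lemma dirint_nrm2 g : dirint g -> dirint_sqnorm g = (nrm2 g)%:E.
Proof.
move=> /dirintP H; rewrite dirint_sqnormE /nrm2 /ip; last by move=> i; exact: (H i).1.
rewrite ge0_sume_distrr; last first.
  by move=> i _; apply: integral_ge0 => t _; rewrite lee_fin normsq_ge0.
rewrite raddf_sum /= -sumEFin; apply: eq_bigr => i _.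
exact: (sqint_mean (H i)).
Qed.

Lemma dirint_linear (c : R[i]) g h : dirint g -> dirint h -> dirint (fun t => c *: g t + h t).
Proof.
move=> /dirintP Hg /dirintP Hh; apply/dirintP => i.
by under eq_fun do rewrite !mxE; apply: sqintD => //; exact: sqintZ.
Qed.

Lemma dirint0 : dirint (fun=> 0 : 'cV[R[i]]_p).
Proof.
apply/dirintP => i; under eq_fun do rewrite mxE.
by have := sqintZ 0 (@sqint1 R); under eq_fun do rewrite mul0r.
Qed.

Lemma ip_integrable g h : dirint g -> dirint h ->
  forall i, cintegrable (fun t => g t i 0 * (h t i 0)^*%C).
Proof. by move=> /dirintP Hg /dirintP Hh i; apply: sqintM => //; exact: sqintJ. Qed.

Lemma ip_linear (c : R[i]) g h k : dirint g -> dirint h -> dirint k ->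
  ip (fun t => c *: g t + h t) k = c * ip g k + ip h k.
Proof.
move=> Dg Dh Dk; rewrite /ip mulr_sumr -big_split; apply: eq_bigr => i _ /=.
rewrite -cmeanZ; last exact: ip_integrable.
rewrite -cmeanD; [|apply: cintegrableZ; exact: ip_integrable|exact: ip_integrable].
by congr cmean; apply/funext => t; rewrite !mxE mulrDl mulrA.
Qed.

Lemma ipC g h : dirint g -> dirint h -> ip h g = (ip g h)^*%C.
Proof.
move=> Dg Dh; rewrite /ip rmorph_sum; apply: eq_bigr => i _ /=.
rewrite -[RHS]cmeanJ; last exact: ip_integrable.
congr cmean; apply/funext => t; rewrite conjcM conjcK mulrC //.
Qed.

Lemma ip0l k : ip (fun=> 0) k = 0.
Proof.
rewrite /ip big1// => i _; under eq_fun do rewrite mxE mul0r.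
exact: cmean0.
Qed.

Lemma nrm2_ge0 g : dirint g -> 0 <= nrm2 g.
Proof.
move=> Dg; rewrite -lee_fin -dirint_nrm2// /dirint_sqnorm mule_ge0//.
  by rewrite lee_fin invr_ge0 mulr_ge0// pi_ge0.
apply: integral_ge0 => t _; rewrite lee_fin sumr_ge0// => i _.
by rewrite sqr_ge0.
Qed.

Lemma ip_self g : dirint g -> ip g g = (nrm2 g)%:C.
Proof.
move=> Dg; have := ipC Dg Dg; rewrite /nrm2; case: (ip g g) => a b /= /eqP.
rewrite eq_complex /= => /andP[_ /eqP b0]; congr (_ +i* _)%C; lra.
Qed.

Lemma nrm2_expand (c : R[i]) g h : dirint g -> dirint h ->
  nrm2 (fun t => c *: g t + h t) = normsq c * nrm2 g + Re (c * ip g h) *+ 2 + nrm2 h.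
Proof.
move=> Dg Dh; have Dk := dirint_linear c Dg Dh.
rewrite {1}/nrm2 (ip_linear c Dg Dh Dk) (ipC Dk Dg) (ipC Dk Dh).
rewrite (ip_linear c Dg Dh Dg) (ip_linear c Dg Dh Dh) (ipC Dg Dh) !ip_self//.
move: (nrm2 g) (nrm2 h) => x y; case: c (ip g h) {Dk} => [c1 c2] [a b].
by rewrite /normsq /= mulr2n; ring.
Qed.

Variable theta : 'I_p -> R -> R[i].
Hypothesis mtheta : forall i, cmeas (theta i).
Hypothesis theta1 : forall i t, normsq (theta i t) = 1.

(** Characters twisted, in each column, by a function of modulus one.  The twist
    costs nothing in the theory of Fourier series and will be chosen to make
    the fibers real. *)
Definition basis (x : site N) : R -> 'cV[R[i]]_p :=
  fun t => \col_i (if i == x.2 then theta i t * chr x.1 t else 0).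

Definition coef g (x : site N) : R[i] := ip g (basis x).

Lemma dirint_basis x : dirint (basis x).
Proof.
apply/dirintP => i; under eq_fun do rewrite mxE.
case: (i == x.2); last by have := sqintZ 0 (@sqint1 R); under eq_fun do rewrite mul0r.
apply: (sqint_of_bounded (B := 1)); first by apply: cmeasM => //; exact: cmeas_chr.
by move=> t _; rewrite normsqM theta1 normsq_chr mulr1.
Qed.

Lemma coefE g x : coef g x = cmean (fun t => g t x.2 0 * (theta x.2 t * chr x.1 t)^*%C).
Proof.
rewrite /coef /ip (bigD1 x.2)//= big1 ?addr0.
  by congr cmean; apply/funext => t; rewrite mxE eqxx.
move=> i ix; rewrite -[RHS](@cmean0 R); congr cmean; apply/funext => t.
by rewrite mxE (negPf ix) conjc0 mulr0.
Qed.

Lemma coef_basis x y : coef (basis x) y = (x == y)%:R.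
Proof.
rewrite coefE; have [xy|xy] := eqVneq y.2 x.2; last first.
  rewrite (_ : (x == y) = false); last by apply/negbTE; apply: contra xy => /eqP ->.
  rewrite -[RHS](@cmean0 R); congr cmean; apply/funext => t.
  by rewrite mxE (negPf xy) mul0r.
have -> : (x == y) = (x.1 - y.1 == 0).
  rewrite subr_eq0; case: x y xy => [n i] [m j] /= ->.
  by rewrite xpair_eqE eqxx andbT.
rewrite -cmean_chr; congr cmean; apply/funext => t.
rewrite mxE xy eqxx conjcM chr_conj chrD mulrACA mul_conj theta1 mul1r //.
Qed.

(** Finite Fourier sums with coefficients f over the sites in s. *)
Definition synth (s : seq (site N)) (f : site N -> R[i]) : R -> 'cV[R[i]]_p :=
  fun t => \sum_(x <- s) f x *: basis x t.

Lemma synth_cons x s f : synth (x :: s) f = fun t => f x *: basis x t + synth s f t.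
Proof. by apply/funext => t; rewrite /synth big_cons. Qed.

Lemma synth_nil f : synth [::] f = fun=> 0.
Proof. by apply/funext => t; rewrite /synth big_nil. Qed.

Lemma dirint_synth s f : dirint (synth s f).
Proof.
elim: s => [|x s IH]; first by rewrite synth_nil; exact: dirint0.
by rewrite synth_cons; apply: dirint_linear => //; exact: dirint_basis.
Qed.

Lemma ip_synth s f k : dirint k -> ip (synth s f) k = \sum_(x <- s) f x * (coef k x)^*%C.
Proof.
move=> Dk; elim: s => [|x s IH]; first by rewrite synth_nil ip0l big_nil.
rewrite synth_cons ip_linear ?big_cons ?IH //; [|exact: dirint_basis|exact: dirint_synth].
by congr (_ * _ + _); rewrite /coef -ipC//; exact: dirint_basis.
Qed.

Lemma coef_linear c g h x : dirint g -> dirint h ->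
  coef (fun t => c *: g t + h t) x = c * coef g x + coef h x.
Proof. by move=> Dg Dh; apply: ip_linear => //; exact: dirint_basis. Qed.

Lemma coef_synth s f x : uniq s -> coef (synth s f) x = if x \in s then f x else 0.
Proof.
move=> us; rewrite /coef ip_synth; last exact: dirint_basis.
rewrite (eq_bigr (fun y => if y == x then f y else 0)); last first.
  move=> y _; rewrite coef_basis eq_sym; case: eqP => _; rewrite ?conjc1 ?mulr1// conjc0 mulr0//.
elim: s us => [|y s IH]; first by rewrite big_nil.
move=> /= /andP[ys us]; rewrite big_cons IH// inE [y == x]eq_sym.
case: eqP => [->|_] /=; last by rewrite add0r.
by rewrite (negPf ys) addr0.
Qed.

(** Pythagoras, for the orthonormal family [basis]. *)
Lemma nrm2_sub_synth g s f : dirint g -> uniq s ->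
  nrm2 (fun t => -1 *: synth s f t + g t) =
  nrm2 g - \sum_(x <- s) Re (f x * (coef g x)^*%C) *+ 2 + mass f s.
Proof.
move=> Dg us; have DS := dirint_synth s f.
rewrite nrm2_expand// ip_synth//.
have -> : nrm2 (synth s f) = mass f s.
  apply: (@complexI R); rewrite -ip_self// ip_synth// /mass rmorph_sum.
  by apply: eq_big_seq => x xs; rewrite coef_synth// xs mul_conj.
have -> : normsq (-1) = 1 :> R by rewrite /normsq /=; ring.
rewrite mulN1r raddfN /= sumrMnl -raddf_sum /= mulNrn mul1r; ring.
Qed.

Lemma bessel g s : dirint g -> uniq s -> mass (coef g) s <= nrm2 g.
Proof.
move=> Dg us; have := nrm2_ge0 (dirint_linear (-1) (dirint_synth s (coef g)) Dg).
rewrite nrm2_sub_synth//.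
have -> : \sum_(x <- s) Re (coef g x * (coef g x)^*%C) *+ 2 = mass (coef g) s *+ 2.
  by rewrite sumrMnl; congr (_ *+ 2); apply: eq_bigr => x _; rewrite mul_conj.
by rewrite mulr2n; lra.
Qed.

(** A rapidly Cauchy sequence converges: apply [riesz_fischer] to the real and
    the imaginary part of each coordinate. *)
Lemma dirint_complete (gs : nat -> R -> 'cV[R[i]]_p) (C : R) :
  (forall j, dirint (gs j)) ->
  (forall j, nrm2 (fun t => -1 *: gs j t + gs j.+1 t) <= C / 8 ^+ j) ->
  exists g, exists K : R, dirint g /\
    forall J, nrm2 (fun t => -1 *: gs J t + g t) <= K / 4 ^+ J.
Proof.
move=> Dgs Hgs; have pi0 : 0 < 2 * pi :> R by rewrite mulr_gt0// pi_gt0.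
have part (i : 'I_p) (re : R[i] -> R) : (forall z w, re (- 1 * z + w) = re w - re z) ->
    (forall z, re z ^+ 2 <= normsq z) ->
    (forall j, measurable_fun circle (fun t => re (gs j t i 0))) ->
    exists w : R -> R, measurable_fun circle w /\ forall J,
     (\int[mu]_(t in circle) ((w t - re (gs J t i 0)) ^+ 2)%:E <= (8 * (2 * pi * C) / 4 ^+ J)%:E)%E.
  move=> reB reN mre.
  have [||w [mw Hw]] := @riesz_fischer _ _ R mu circle (@measurable_circle R)
    (fun j t => re (gs j t i 0)) (2 * pi * C); [exact: mre| |by exists w].
  move=> j; have Dd := dirint_linear (-1) (Dgs j) (Dgs j.+1).
  have := Hgs j; rewrite -lee_fin -dirint_nrm2// => Hj.
  have c0 : (0 <= (2 * pi)^-1%:E :> \bar R)%E by rewrite lee_fin invr_ge0 ltW.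
  have -> : (2 * pi * C / 8 ^+ j)%:E = ((2 * pi)%:E * (C / 8 ^+ j)%:E)%E by rewrite -EFinM mulrA.
  rewrite -lee_pdivrMl// ; apply: le_trans Hj.
  rewrite /dirint_sqnorm; apply: lee_wpmul2l => //.
  have md : measurable_fun circle (fun t => (re (gs j.+1 t i 0) - re (gs j t i 0)) ^+ 2).
    by apply: measurable_funX; exact: measurable_funB.
  apply: ge0_le_integral => //.
  - exact: measurable_circle.
  - by move=> t _; rewrite lee_fin sqr_ge0.
  - by apply/measurable_EFinP; exact: md.
  - apply/measurable_EFinP; apply: measurable_sum => k.
    have [+ _] := (dirintP _).1 Dd k; move/cmeas_normsq.
    by under eq_fun do rewrite -normc_sqr.
  - move=> t _; rewrite lee_fin -reB (bigD1 i)//=.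
    apply: (@le_trans _ _ (normsq ((-1 *: gs j t + gs j.+1 t) i 0))).
      by rewrite !mxE; exact: reN.
    by rewrite normc_sqr lerDl sumr_ge0// => k _; rewrite sqr_ge0.
have cg j i : cmeas (fun t => gs j t i 0) := ((dirintP _).1 (Dgs j) i).1.
have /choice[wr Hr] (i : 'I_p) : exists w : R -> R, measurable_fun circle w /\ forall J,
     (\int[mu]_(t in circle) ((w t - Re (gs J t i 0)) ^+ 2)%:E <= (8 * (2 * pi * C) / 4 ^+ J)%:E)%E.
  apply: (part i (@complex.Re R)) => [[a b] [c e]|[a b]|j] /=; first by ring.
    by rewrite /normsq /= lerDl sqr_ge0.
  exact: (cg j i).1.
have /choice[wi Hi] (i : 'I_p) : exists w : R -> R, measurable_fun circle w /\ forall J,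
     (\int[mu]_(t in circle) ((w t - Im (gs J t i 0)) ^+ 2)%:E <= (8 * (2 * pi * C) / 4 ^+ J)%:E)%E.
  apply: (part i (@complex.Im R)) => [[a b] [c e]|[a b]|j] /=; first by ring.
    by rewrite /normsq /= lerDr sqr_ge0.
  exact: (cg j i).2.
pose g t : 'cV[R[i]]_p := \col_i (wr i t +i* wi i t)%C.
pose d J t : 'cV[R[i]]_p := -1 *: gs J t + g t.
have nd J i t : normsq (d J t i 0) =
    (wr i t - Re (gs J t i 0)) ^+ 2 + (wi i t - Im (gs J t i 0)) ^+ 2.
  rewrite /d !mxE; case: (gs J t i 0) => a b; rewrite /normsq /=; ring.
have gi i : cmeas (fun t => g t i 0).
  by under eq_fun do rewrite mxE; split => /=; [exact: (Hr i).1|exact: (Hi i).1].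
have int_d J i : (\int[mu]_(t in circle) (normsq (d J t i 0))%:E <=
    (16 * (2 * pi * C) / 4 ^+ J)%:E)%E.
  under eq_integral do rewrite nd EFinD.
  have m1 : measurable_fun circle (fun t => (wr i t - Re (gs J t i 0)) ^+ 2).
    by apply: measurable_funX; apply: measurable_funB; [exact: (Hr i).1|exact: (cg J i).1].
  have m2 : measurable_fun circle (fun t => (wi i t - Im (gs J t i 0)) ^+ 2).
    by apply: measurable_funX; apply: measurable_funB; [exact: (Hi i).1|exact: (cg J i).2].
  rewrite ge0_integralD//; last 5 first.
  - exact: measurable_circle.
  - by move=> t _; rewrite lee_fin sqr_ge0.
  - exact/measurable_EFinP.
  - by move=> t _; rewrite lee_fin sqr_ge0.
  - exact/measurable_EFinP.
  apply: le_trans (leeD ((Hr i).2 J) ((Hi i).2 J)) _.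
  by rewrite -EFinD lee_fin le_eqVlt; apply/orP; left; apply/eqP; ring.
have Dd J : dirint (d J).
  apply/dirintP => i; split; last exact: le_lt_trans (int_d J i) (ltry _).
  rewrite /d; under eq_fun do rewrite mxE [X in X + _]mxE.
  by apply: cmeasD => //; apply: cmeasM => //; exact: cmeas_cst.
have Dg : dirint g.
  have := dirint_linear 1 (Dgs 0%N) (Dd 0%N); congr dirint; apply/funext => t.
  by rewrite /d scale1r scaleN1r addrA subrr add0r.
exists g, (p%:R * (16 * C)); split=> // J.
rewrite -[X in nrm2 X]/(d J) /nrm2 /ip raddf_sum /=.
apply: (@le_trans _ _ (\sum_(i < p) (16 * C / 4 ^+ J))); last first.
  by rewrite sumr_const card_ord -[leLHS]mulr_natl mulrA.
apply: ler_sum => i _; rewrite -lee_fin -(sqint_mean ((dirintP _).1 (Dd J) i)).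
rewrite lee_pdivrMl//; apply: le_trans (int_d J i) _.
by rewrite -EFinM lee_fin le_eqVlt; apply/orP; left; apply/eqP; ring.
Qed.

(** Choose finite sets s_j of sites outside of which f has mass at most 8^-j.
    The Fourier sums over s_j form a rapidly Cauchy sequence; coefficients and
    norm are continuous, so they pass to its limit. *)
Lemma synthesis f : l2 f -> exists g, [/\ dirint g, coef g = f & nrm2 g = l2norm2 f].
Proof.
move=> lf; set L := l2norm2 f.
have /choice[s Hs] (j : nat) : exists s : seq (site N), uniq s /\ L <= mass f s + 8 ^- j.
  by have [|s us ls] := mass_approx lf (_ : 0 < 8 ^- j :> R); [rewrite invr_gt0 exprn_gt0|exists s].
have us j := (Hs j).1; have Ls j := (Hs j).2.
pose gs j := synth (s j) f.
have Dgs j : dirint (gs j) by exact: dirint_synth.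
(* The mass of f outside of s j. *)
have out j t : uniq t -> mass f [seq x <- t | x \notin s j] <= 8 ^- j.
  move=> ut; have := mass_le lf (_ : uniq (s j ++ [seq x <- t | x \notin s j])).
  rewrite cat_uniq us filter_uniq// andbT /= => h.
  have : mass f (s j ++ [seq x <- t | x \notin s j]) <= L.
    apply: h; apply/hasPn => x; rewrite mem_filter => /andP[] //.
  by rewrite /mass big_cat /= -/(mass f (s j)); have := Ls j; lra.
have nrm_gs j : nrm2 (gs j) = mass f (s j).
  apply: (@complexI R); rewrite -ip_self// ip_synth// /mass rmorph_sum.
  by apply: eq_big_seq => x xs; rewrite coef_synth// xs mul_conj.
have step j : nrm2 (fun t => -1 *: gs j t + gs j.+1 t) <= 3 / 8 ^+ j.
  rewrite nrm2_sub_synth// nrm_gs.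
  have -> : \sum_(x <- s j) Re (f x * (coef (gs j.+1) x)^*%C) *+ 2 =
      mass f [seq x <- s j | x \in s j.+1] *+ 2.
    rewrite sumrMnl /mass big_filter [in RHS]big_mkcond; congr (_ *+ 2).
    apply: eq_bigr => x _; rewrite coef_synth//; case: ifP => _; first by rewrite mul_conj.
    by rewrite conjc0 mulr0.
  have E : mass f (s j) = mass f [seq x <- s j | x \in s j.+1] + mass f [seq x <- s j | x \notin s j.+1].
    by rewrite /mass !big_filter (bigID (fun x => x \in s j.+1)).
  have h1 := out j.+1 _ (us j); have h2 := mass_le lf (us j.+1); have h3 := Ls j.
  have h4 : 8 ^- j.+1 <= 8 ^- j :> R.
    by rewrite lef_pV2 ?posrE ?exprn_gt0// ler_eXn2l// ltr1n.
  rewrite mulr2n; move: h1 h2 h3 h4 E; rewrite -/L; lra.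
have [g [K [Dg Hg]]] := dirint_complete Dgs step.
have dD J : dirint (fun t => -1 *: gs J t + g t) by exact: dirint_linear.
have K0 : 0 <= K by have := le_trans (nrm2_ge0 (dD 0%N)) (Hg 0%N); rewrite expr0 divr1.
have cvg0 (a b : R) : (forall J : nat, a <= b / 4 ^+ J) -> a <= 0.
  move=> H; have C : b * 4^-1 ^+ J @[J --> \oo] --> (b * 0 : R).
    by apply: cvgM; [exact: cvg_cst|apply: cvg_expr; rewrite ger0_norm; lra].
  rewrite mulr0 in C; rewrite -(cvg_lim _ C)//.
  apply: limr_ge; first by apply/cvg_ex; exists 0.
  by apply: nearW => J; rewrite exprVn.
have e84 J : 8 ^- J <= 4 ^- J :> R.
  rewrite lef_pV2 ?posrE ?exprn_gt0// lerXn2r ?nnegrE//; lra.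
exists g.
have cg : coef g = f.
  apply/funext => x; apply/eqP; rewrite -subr_eq0 -normsq_eq0 eq_le normsq_ge0 andbT.
  apply: (cvg0 _ (2 * K + 2)) => J.
  have -> : coef g x - f x = (-1 * coef (gs J) x + coef g x) + (coef (gs J) x - f x) by ring.
  apply: le_trans (normsqD_le _ _) _.
  have -> : (2 * K + 2) / 4 ^+ J = 2 * (K / 4 ^+ J) + 2 * 4 ^- J by ring.
  apply: lerD; rewrite ler_pM2l//.
    rewrite -coef_linear//; apply: le_trans (Hg J).
    have := bessel (dD J) (_ : uniq [:: x]); rewrite /mass big_seq1; exact.
  rewrite coef_synth//; case: ifP => xs.
    by rewrite subrr /normsq /= expr0n addr0 invr_ge0 exprn_ge0.
  apply: le_trans (e84 J); apply: le_trans (out J [:: x] _) => //=.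
  rewrite xs /= /mass big_seq1 sub0r; case: (f x) => a b.
  by rewrite /normsq /= !sqrrN.
split=> //; apply/eqP; rewrite eq_le; apply/andP; split; rewrite -subr_le0; apply: (cvg0 _ (K + 1)) => J.
  have := Hg J; rewrite nrm2_sub_synth// cg.
  have -> : \sum_(x <- s J) Re (f x * (f x)^*%C) *+ 2 = mass f (s J) *+ 2.
    by rewrite sumrMnl; congr (_ *+ 2); apply: eq_bigr => x _; rewrite mul_conj.
  have h := mass_le lf (us J); have : 0 <= 4 ^- J :> R by rewrite invr_ge0 exprn_ge0.
  by rewrite mulrDl mul1r mulr2n; move: h; rewrite -/L; lra.
have := bessel Dg (us J); rewrite cg => h; have := Ls J; have := e84 J.
have : 0 <= K / 4 ^+ J by rewrite divr_ge0 ?exprn_ge0.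
by rewrite mulrDl mul1r; lra.
Qed.

(** In each column, g times the conjugate twist is orthogonal to all characters. *)
Lemma coef_eq0_ae g : dirint g -> (forall x, coef g x = 0) ->
  ae_eq_fiber g (fun=> 0).
Proof.
move=> Dg H.
have comp (i : 'I_p) : {ae mu, forall t, circle t -> g t i 0 = 0}.
  have st : sqint (fun t => (theta i t)^*%C * g t i 0).
    apply: (sqint_bounded (B := 1)); first exact: cmeasJ.
      by move=> t _; rewrite normsq_conj theta1.
    exact: (dirintP _).1 Dg i.
  have := chr_complete st => h.
  have aeF := ae_filter_ringOfSetsType mu.
  have : {ae mu, forall t, circle t -> (theta i t)^*%C * g t i 0 = 0}.
    apply: h => n; have := H (- n, i); rewrite coefE /= => <-.
    by congr cmean; apply/funext => t; rewrite conjcM chr_conj opprK; ring.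
  apply: filterS => t ht ct; have /eqP := ht ct; rewrite mulf_eq0 => /orP[|/eqP //].
  by rewrite -normsq_eq0 normsq_conj theta1 oner_eq0.
have aeF := ae_filter_ringOfSetsType mu.
have : {ae mu, forall t, forall i : 'I_p, circle t -> g t i 0 = 0}.
  by apply: (@filter_forall _ _ (fun (i : 'I_p) t => circle t -> g t i 0 = 0)).
rewrite /ae_eq_fiber /ae_eq; apply: filterS => t ht ct.
by apply/colP => i; rewrite mxE; exact: ht.
Qed.

Lemma coef_inj_ae g h : dirint g -> dirint h -> coef g = coef h -> ae_eq_fiber g h.
Proof.
move=> Dg Dh E.
have c0 x : coef (fun t => -1 *: h t + g t) x = 0.
  by rewrite coef_linear// E mulN1r addNr.
have := coef_eq0_ae (dirint_linear (-1) Dh Dg) c0.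
have aeF := ae_filter_ringOfSetsType mu.
rewrite /ae_eq_fiber /ae_eq; apply: filterS => t ht ct; have := ht ct.
by rewrite scaleN1r addrC => /eqP; rewrite subr_eq0 => /eqP.
Qed.

Lemma l2_coef g : dirint g -> l2 (coef g).
Proof. by move=> Dg; apply: (@l2_of_mass _ _ _ (nrm2 g)) => s us; exact: bessel. Qed.

Lemma l2_sqnorm_coef_le g : dirint g -> (l2_sqnorm (coef g) <= (nrm2 g)%:E)%E.
Proof. by move=> Dg; apply: l2_sqnorm_le => s us; exact: bessel. Qed.

(** The unitary map sends a sequence to a function having these Fourier
    coefficients.  It is obtained by choice, so it is linear only up to almost
    everywhere equality. *)
Lemma fourier_unitary : exists U : (site N -> R[i]) -> R -> 'cV[R[i]]_p,
  unitary U /\ forall f, l2 f -> coef (U f) = f.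
Proof.
have /choice[U HU] f : exists g, l2 f -> [/\ dirint g, coef g = f & nrm2 g = l2norm2 f].
  have [lf|nlf] := pselect (l2 f); last by exists (fun=> 0).
  by have [g Hg] := synthesis lf; exists g.
exists U; split; last by move=> f /HU[].
split.
- by move=> f /HU[].
- move=> c f g lf lg; have [Df cf _] := HU f lf; have [Dg cg _] := HU g lg.
  have [D3 c3 _] := HU _ (l2_linear c lf lg).
  apply: coef_inj_ae => //; first exact: dirint_linear.
  by rewrite c3; apply/funext => x; rewrite coef_linear// cf cg.
- by move=> f lf; have [Df _ nf] := HU f lf; rewrite dirint_nrm2// nf l2_fin.
- move=> g Dg; exists (coef g); first exact: l2_coef.
  have [D1 c1 _] := HU _ (l2_coef Dg).
  exact: coef_inj_ae.
Qed.

End Fibers.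

(** * Multiplication operators on the direct integral *)

Section Multiplication.
Variables (R : realType) (N : nat).
Local Notation p := (2 * N).+1.
Local Notation mu := (@lebesgue_measure R).
Local Notation circle := (@circle R).
Implicit Types (g h : R -> 'cV[R[i]]_p).

Lemma eq_cmean (h k : R -> R[i]) : (forall t, circle t -> h t = k t) -> cmean h = cmean k.
Proof.
move=> hk; apply/eqP; rewrite eq_complex /=; apply/andP; split; apply/eqP; congr (_ * _);
  by apply: eq_Rintegral => t; rewrite inE => /hk ->.
Qed.

Lemma measurable_normsq_sum g : dirint g ->
  measurable_fun circle (fun t => \sum_(i < p) ComplexField.Normc.normc (g t i 0) ^+ 2).
Proof.
move=> Dg; apply: measurable_sum => k.
have [+ _] := (dirintP _).1 Dg k; move/cmeas_normsq.
by under eq_fun do rewrite -normc_sqr.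
Qed.

Lemma nrm2_le g h (K : R) : dirint g -> dirint h -> 0 <= K ->
  (forall t, circle t -> \sum_(i < p) normsq (g t i 0) <= K * \sum_(i < p) normsq (h t i 0)) ->
  nrm2 g <= K * nrm2 h.
Proof.
move=> Dg Dh K0 H; rewrite -lee_fin EFinM -!dirint_nrm2// /dirint_sqnorm.
have c0 : (0 <= (2 * pi)^-1%:E :> \bar R)%E by rewrite lee_fin invr_ge0 mulr_ge0// pi_ge0.
have mg := measurable_normsq_sum Dg; have mh := measurable_normsq_sum Dh.
rewrite muleCA lee_wpmul2l// -ge0_integralZl//; last 3 first.
- exact: measurable_circle.
- exact/measurable_EFinP.
- by move=> t _; rewrite lee_fin sumr_ge0// => i _; rewrite sqr_ge0.
apply: ge0_le_integral => //.
- exact: measurable_circle.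
- by move=> t _; rewrite lee_fin sumr_ge0// => i _; rewrite sqr_ge0.
- exact/measurable_EFinP.
- by apply/measurable_EFinP; apply: measurable_funM => //; exact: measurable_cst.
- move=> t ct; rewrite -EFinM lee_fin.
  have E (k : R -> 'cV[R[i]]_p) : \sum_(i < p) ComplexField.Normc.normc (k t i 0) ^+ 2 =
    \sum_(i < p) normsq (k t i 0) by apply: eq_bigr => i _; rewrite normc_sqr.
  by rewrite !E; exact: H.
Qed.

Lemma nrm2_ae g h : dirint g -> dirint h -> ae_eq_fiber g h -> nrm2 g = nrm2 h.
Proof.
move=> Dg Dh gh; apply/EFin_inj; rewrite -!dirint_nrm2// /dirint_sqnorm; congr (_ * _)%E.
apply: ae_eq_integral.
- exact: measurable_circle.
- by apply/measurable_EFinP; exact: measurable_normsq_sum.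
- by apply/measurable_EFinP; exact: measurable_normsq_sum.
have aeF := ae_filter_ringOfSetsType mu.
by move: gh; rewrite /ae_eq_fiber /ae_eq; apply: filterS => t ht ct; rewrite ht.
Qed.

(** A crude constant in place of Cauchy-Schwarz; only its existence matters. *)
Lemma normsq_sum_le (I : Type) (s : seq I) (z : I -> R[i]) :
  normsq (\sum_(i <- s) z i) <= 2 ^+ size s * \sum_(i <- s) normsq (z i).
Proof.
elim: s => [|i s IH]; first by rewrite !big_nil mulr0 /normsq /= expr0n addr0.
rewrite !big_cons /= exprS; apply: le_trans (normsqD_le _ _) _.
have := normsq_ge0 (z i); have : 1 <= 2 ^+ size s :> R by rewrite exprn_ege1// ler1n.
set n := normsq (z i); move: IH; set S := \sum_(j <- s) normsq _; set X := 2 ^+ _; set Y := normsq (\sum_(j <- s) _).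
by move=> h1 h2 h3; nra.
Qed.

Definition bounded_multiplier (A : R -> 'M[R[i]]_p) : Prop :=
  (forall i j, cmeas (fun t => A t i j)) /\
  exists B : R, forall t i j, circle t -> normsq (A t i j) <= B.

Lemma dirint_mulmx A g : bounded_multiplier A -> dirint g -> dirint (dirint_op A g).
Proof.
move=> [mA [B HB]] /dirintP Dg; apply/dirintP => i.
rewrite /dirint_op; under eq_fun do rewrite mxE.
by apply: sqint_sum => j; exact: (sqint_bounded (mA i j) (fun t ct => HB t i j ct) (Dg j)).
Qed.

Lemma nrm2_mulmx A : bounded_multiplier A ->
  exists2 K : R, 0 <= K & forall g, dirint g -> nrm2 (dirint_op A g) <= K * nrm2 g.
Proof.
move=> bA; have [mA [B HB]] := bA; pose K := p%:R * (2 ^+ p * `|B|).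
have K0 : 0 <= K by rewrite !mulr_ge0 ?exprn_ge0.
exists K => // g Dg; apply: nrm2_le => // [|t ct]; first exact: dirint_mulmx.
have -> : K * \sum_(i < p) normsq (g t i 0) =
    \sum_(k < p) (2 ^+ p * (`|B| * \sum_(i < p) normsq (g t i 0))).
  by rewrite sumr_const card_ord -[RHS]mulr_natl /K !mulrA.
apply: ler_sum => k _; rewrite /dirint_op mxE; apply: le_trans (normsq_sum_le _ _) _.
rewrite -[index_enum _]enumT size_enum_ord ler_wpM2l ?exprn_ge0// mulr_sumr.
apply: ler_sum => i _; rewrite normsqM ler_wpM2r ?normsq_ge0//.
by apply: le_trans (HB _ _ _ ct) _; exact: ler_norm.
Qed.

Variable theta : 'I_p -> R -> R[i].
Hypothesis mtheta : forall i, cmeas (theta i).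
Hypothesis theta1 : forall i t, normsq (theta i t) = 1.
Local Notation coef := (coef theta).

Lemma coef_ae g h : dirint g -> dirint h -> ae_eq_fiber g h -> coef g = coef h.
Proof.
move=> Dg Dh gh; apply/funext => x; apply/eqP; rewrite -subr_eq0 -normsq_eq0 eq_le normsq_ge0 andbT.
have Dd := dirint_linear (-1) Dh Dg.
have -> : coef g x - coef h x = coef (fun t => -1 *: h t + g t) x.
  by rewrite coef_linear// mulN1r addrC.
have := bessel mtheta theta1 Dd (_ : uniq [:: x]); rewrite /mass big_seq1.
move=> /(_ isT)/le_trans; apply.
rewrite (@nrm2_ae _ (fun=> 0) Dd (@dirint0 _ _)); first by rewrite /nrm2 ip0l.
have aeF := ae_filter_ringOfSetsType mu.
move: gh; rewrite /ae_eq_fiber /ae_eq; apply: filterS => t ht ct.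
by rewrite ht// scaleN1r addNr.
Qed.

Lemma parseval g : dirint g -> l2norm2 (coef g) = nrm2 g.
Proof.
move=> Dg; have [h [Dh ch <-]] := synthesis mtheta theta1 (l2_coef mtheta theta1 Dg).
apply: nrm2_ae => //; exact: (coef_inj_ae mtheta theta1).
Qed.

Variables (A : R -> 'M[R[i]]_p) (T : (site N -> R[i]) -> site N -> R[i]).
Hypothesis bA : bounded_multiplier A.
Hypothesis TA : forall g, dirint g -> coef (dirint_op A g) = T (coef g).

Lemma shifted_multiplier z : bounded_multiplier (fun t => A t - z%:M).
Proof.
have [mA [B HB]] := bA; split=> [i j|].
  under eq_fun do rewrite mxE; by apply: cmeasD => //; exact: cmeas_cst.
exists (2 * B + 2 * normsq z) => t i j ct; rewrite !mxE.
apply: le_trans (normsqD_le _ _) _; rewrite lerD// ler_pM2l// ?HB//.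
case: (i == j); last by rewrite mulr0n oppr0 {1}/normsq /= expr0n addr0 normsq_ge0.
by rewrite mulr1n; case: (z) => a b; rewrite /normsq /= !sqrrN.
Qed.

Lemma coef_shifted z g : dirint g ->
  coef (dirint_op (fun t => A t - z%:M) g) = fun x => T (coef g) x - z * coef g x.
Proof.
move=> Dg; apply/funext => x; rewrite -TA//.
have -> : dirint_op (fun t => A t - z%:M) g = fun t => (- z) *: g t + dirint_op A g t.
  by apply/funext => t; rewrite /dirint_op mulmxBl mul_scalar_mx scaleNr addrC.
rewrite coef_linear//; last exact: dirint_mulmx.
by rewrite mulNr addrC.
Qed.

Lemma unitarily_equivalent_multiplication : unitarily_equivalent T (dirint_op A).
Proof.
have [U [uU cU]] := fourier_unitary mtheta theta1; exists U; split=> // f lf.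
have [UD _ _ _] := uU.
have DA := dirint_mulmx bA (UD _ lf).
have Tf : T f = coef (dirint_op A (U f)) by rewrite TA ?cU//; exact: UD.
have lT : l2 (T f) by rewrite Tf; exact: (l2_coef mtheta theta1).
split=> //; apply: (coef_inj_ae mtheta theta1) => //; first exact: UD.
by rewrite cU.
Qed.

(** Multiplication by M, transported to sequences, is the inverse. *)
Lemma resolvent_of_inverse z (M : R -> 'M[R[i]]_p) : bounded_multiplier M ->
  (forall t, circle t -> (A t - z%:M) *m M t = 1%:M /\ M t *m (A t - z%:M) = 1%:M) ->
  resolvent_set T z.
Proof.
move=> bM HM; have [U [uU cU]] := fourier_unitary mtheta theta1.
have [UD UL UN _] := uU.
have DM g : dirint g -> dirint (dirint_op M g) by exact: dirint_mulmx.
have eqM g h : ae_eq_fiber g h -> ae_eq_fiber (dirint_op M g) (dirint_op M h).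
  have aeF := ae_filter_ringOfSetsType mu.
  by rewrite /ae_eq_fiber /ae_eq; apply: filterS => t ht ct; rewrite /dirint_op ht.
exists (fun f => coef (dirint_op M (U f))); split.
- split.
  + by move=> f lf; apply: (l2_coef mtheta theta1); apply: DM; exact: UD.
  + move=> c f g lf lg.
    rewrite (@coef_ae _ (dirint_op M (fun t => c *: U f t + U g t))); last 3 first.
    * by apply: DM; apply: UD; exact: l2_linear.
    * by apply: DM; apply: dirint_linear; exact: UD.
    * by apply: eqM; exact: UL.
    have -> : dirint_op M (fun t => c *: U f t + U g t) =
        fun t => c *: dirint_op M (U f) t + dirint_op M (U g) t.
      by apply/funext => t; rewrite /dirint_op mulmxDr -scalemxAr.
    by apply/funext => x; rewrite coef_linear//; apply: DM; exact: UD.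
  + have [K K0 HK] := nrm2_mulmx bM; exists (Num.sqrt K) => f lf.
    rewrite sqr_sqrtr// -(UN f lf) dirint_nrm2; last exact: UD.
    apply: le_trans (l2_sqnorm_coef_le mtheta theta1 _) _; first by apply: DM; exact: UD.
    by rewrite -EFinM lee_fin; apply: HK; exact: UD.
- move=> f lf; have Df := UD _ lf.
  have DAf := dirint_mulmx (shifted_multiplier z) Df.
  have E : coef (dirint_op (fun t => A t - z%:M) (U f)) = fun x => T f x - z * f x.
    by rewrite coef_shifted// cU.
  have lTf : l2 (fun x => T f x - z * f x) by rewrite -E; exact: (l2_coef mtheta theta1).
  transitivity (coef (U f)); last exact: cU.
  apply: coef_ae; [by apply: DM; exact: UD|exact: Df|].
  have : ae_eq_fiber (U (fun x => T f x - z * f x)) (dirint_op (fun t => A t - z%:M) (U f)).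
    by apply: (coef_inj_ae mtheta theta1) => //; [exact: UD|rewrite cU].
  move=> /eqM; have aeF := ae_filter_ringOfSetsType mu.
  rewrite /ae_eq_fiber /ae_eq; apply: filterS => t ht ct; rewrite ht//.
  by rewrite /dirint_op mulmxA (HM t ct).2 mul1mx.
- move=> f lf; have Df := UD _ lf; have Dg := DM _ Df.
  rewrite -(coef_shifted z Dg); transitivity (coef (U f)); last exact: cU.
  have DAg := dirint_mulmx (shifted_multiplier z) Dg.
  apply: coef_ae; [exact: DAg|exact: Df|]; apply: aeW => t ct.
  by rewrite /dirint_op mulmxA (HM t ct).1 mul1mx.
Qed.

(** A bounded inverse B would give |f|^2 <= C^2 |(T - z) f|^2 for all f, which an
    approximate eigenvector with e = 1 / (C^2 + 1) contradicts. *)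
Lemma spectrum_of_approximate_eigenvector z :
  (forall e : R, 0 < e -> exists g, [/\ dirint g, 0 < nrm2 g &
     nrm2 (dirint_op (fun t => A t - z%:M) g) <= e * nrm2 g]) ->
  spectrum T z.
Proof.
move=> H [B [[Bl2 _ [M HM]] BT _]].
have e0 : 0 < (M ^+ 2 + 1)^-1 by rewrite invr_gt0 ltr_wpDl// sqr_ge0.
have [g [Dg g0 Hg]] := H _ e0.
have Dh := dirint_mulmx (shifted_multiplier z) Dg.
have lf := l2_coef mtheta theta1 Dg.
have lh := l2_coef mtheta theta1 Dh.
have := HM _ lh; rewrite (coef_shifted z Dg) BT// -(coef_shifted z Dg).
rewrite !l2_fin// !parseval// -EFinM lee_fin => h.
have : nrm2 g <= M ^+ 2 * ((M ^+ 2 + 1)^-1 * nrm2 g).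
  by apply: le_trans h _; rewrite ler_wpM2l ?sqr_ge0.
rewrite mulrA ler_pMl// ler_pdivlMr ?ltr_wpDl ?sqr_ge0// mul1r gerDl ler10 //.
Qed.

End Multiplication.

(** * Fibers of the nanoribbon operator *)

Section Nanoribbon.
Variables (R : realType) (N : nat) (v : 'rV[R]_((2 * N).+1)).
Local Notation p := (2 * N).+1.
Local Notation mu := (@lebesgue_measure R).
Local Notation circle := (@circle R).
Local Notation J := (jacobi v).

Definition coupling (t : R) : R := 2 * `|cos (t / 2)|.
(** The sign of cos (t/2), positive up to t = pi and negative beyond, times
    e^(it/2). *)
Definition phase (t : R) : R[i] := (2 * \1_(`]-oo, pi]%classic) t - 1)%:C * expi (2^-1 * t).
(** The exponent is half of the column number i + 1, rounded down, since columns
    are numbered from 0 here. *)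
Definition gauge (i : 'I_p) (t : R) : R[i] := phase t ^+ uphalf i.

Lemma normsqX (z : R[i]) n : normsq (z ^+ n) = normsq z ^+ n.
Proof.
elim: n => [|n IH]; first by rewrite !expr0 /normsq /= expr1n expr0n addr0.
by rewrite !exprS normsqM IH.
Qed.

Lemma normsq_phase t : normsq (phase t) = 1.
Proof.
rewrite normsqM normsq_expi mulr1 indicE /normsq /= expr0n addr0.
by case: (_ \in _) => /=; ring.
Qed.

Lemma cmeas_phase : cmeas phase.
Proof.
apply: cmeasM; last exact: cmeas_expi.
apply: cmeas_real; apply: measurable_funB; last exact: measurable_cst.
apply: measurable_funM; first exact: measurable_cst.
by apply: measurable_indic; exact: measurable_itv.
Qed.

Lemma cmeasX (h : R -> R[i]) n : cmeas h -> cmeas (fun t => h t ^+ n).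
Proof.
move=> mh; elim: n => [|n IH].
  by under eq_fun do rewrite expr0; exact: cmeas_cst.
by under eq_fun do rewrite exprS; exact: cmeasM.
Qed.

Lemma cmeas_gauge i : cmeas (gauge i).
Proof. exact: cmeasX cmeas_phase. Qed.

Lemma normsq_gauge i t : normsq (gauge i t) = 1.
Proof. by rewrite normsqX normsq_phase expr1n. Qed.

(** 1 + e^(it) = 2 cos (t/2) e^(it/2), and the phase carries the sign of the
    cosine. *)
Lemma phase_coupling t : circle t -> phase t * (coupling t)%:C = 1 + expi t.
Proof.
rewrite /Defs.circle /= in_itv /= => /andP[t0 t2].
have E : (2 * \1_(`]-oo, pi]%classic) t - 1) * `|cos (t / 2)| = cos (t / 2) :> R.
  rewrite indicE; have [tpi|tpi] := leP t pi.
    rewrite mem_set /=; last by rewrite in_itv.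
    by rewrite ger0_norm; [ring|apply: cos_ge0_pihalf; lra].
  rewrite memNset /=; last by rewrite in_itv /= leNgt tpi.
  have c0 : cos (t / 2) <= 0.
    rewrite -oppr_ge0 -cosDpi; have -> : t / 2 + pi = (t / 2 - pi) + pi *+ 2 by rewrite mulr2n; ring.
    by rewrite cosD2pi; apply: cos_ge0_pihalf; lra.
  by rewrite ler0_norm//; ring.
rewrite /phase /coupling [2^-1 * t]mulrC; move: E; set s := (2 * _ - 1) => E.
have -> : s%:C * expi (t / 2) * (2 * `|cos (t / 2)|)%:C = (2 * cos (t / 2))%:C * expi (t / 2).
  by rewrite mulrAC -rmorphM /= mulrCA E.
have -> : expi t = expi (t / 2 + t / 2) by congr expi; field.
rewrite /expi cosD sinD; apply/eqP; rewrite eq_complex /=; apply/andP; split; apply/eqP.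
  by have := cos2Dsin2 (t / 2); lra.
by ring.
Qed.

Lemma normsq_eq1 (z : R[i]) : normsq z = 1 -> z^*%C * z = 1.
Proof. by move=> h; rewrite mulrC mul_conj h. Qed.

(** With the argument numbered from 1, as in the definition of the operator, and
    0 outside of the ribbon. *)
Definition column_ext (F : 'I_p -> R[i]) (k : nat) : R[i] :=
  if k is k'.+1 then oapp F 0 (insub k') else 0.

Lemma column_ext_ord F (i : 'I_p) : column_ext F i.+1 = F i.
Proof. by rewrite /column_ext valK. Qed.

Lemma column_ext_sum F k : \sum_(j < p) (if j.+1 == k then F j else 0) = column_ext F k.
Proof.
case: k => [|k] /=; first by rewrite big1.
case: insubP => [i _ ik|kp] /=.
  by rewrite (bigD1 i)//= ik eqxx big1 ?addr0// => j ji; rewrite eqSS -ik ifF//; apply/negP => /eqP/val_inj/eqP; exact/negP.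
by rewrite big1// => j _; rewrite eqSS; case: eqP => // e; move: kp; rewrite -e ltn_ord.
Qed.

Lemma jacobi_row a (F : 'I_p -> R[i]) i : \sum_j (J a i j)%:C * F j =
  (jacobi_coef a i)%:C * column_ext F i + (v 0 i)%:C * F i +
  (jacobi_coef a i.+1)%:C * column_ext F i.+2.
Proof.
rewrite -!column_ext_sum !mulr_sumr.
have -> : (v 0 i)%:C * F i = \sum_(j < p) (if i == j then (v 0 i)%:C * F i else 0).
  by rewrite (bigD1 i)//= eqxx big1 ?addr0// => j; rewrite eq_sym => /negPf ->.
rewrite -!big_split; apply: eq_bigr => j _ /=.
rewrite mxE [_.+1 == i :> nat]eq_sym eqSS.
have [ij|ij] := eqVneq (i : nat) j.+1.
  rewrite ifF ?ifF ?mulr0 ?addr0//; first by rewrite ij; apply/eqP; lia.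
  by apply/eqP => e; move: ij; rewrite e; lia.
rewrite mulr0 add0r; have [ji|ji] := eqVneq (j : nat) i.+1.
  rewrite ifF ?add0r//; by apply/eqP => e; move: ji; rewrite e; lia.
by rewrite mulr0 addr0; case: eqP => [->|]; rewrite ?mul0r.
Qed.

Local Notation coef := (coef gauge).

Lemma coupling_le t : `|coupling t| <= 2.
Proof.
rewrite ger0_norm ?mulr_ge0// /coupling -[leRHS]mulr1 ler_pM2l//.
exact: cos_max.
Qed.

Lemma continuous_coupling : continuous coupling.
Proof.
move=> t; apply: cvgM; first exact: cvg_cst.
apply: cvg_norm; apply: continuous_comp; last exact: continuous_cos.
by apply: cvgM; [exact: cvg_id|exact: cvg_cst].
Qed.

Lemma measurable_coupling : measurable_fun circle coupling.
Proof.
by apply: measurable_funTS; apply: continuous_measurable_fun; exact: continuous_coupling.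
Qed.

Definition fiber (t : R) : 'M[R[i]]_p := map_mx (real_complex R) (J (coupling t)).

Lemma fiber_bounded : bounded_multiplier fiber.
Proof.
have mj n : measurable_fun circle (fun t => jacobi_coef (coupling t) n).
  by rewrite /jacobi_coef; case: odd; [exact: measurable_coupling|exact: measurable_cst].
split=> [i j|].
  rewrite /fiber; under eq_fun do rewrite !mxE; apply: cmeas_real.
  by case: eqP => _ //; case: eqP => _ //; case: eqP => _; exact: measurable_cst.
exists (4 + \sum_i (v 0 i) ^+ 2) => t i j _; rewrite !mxE.
have vi k : (v 0 k) ^+ 2 <= \sum_i (v 0 i) ^+ 2.
  by rewrite (bigD1 k)//= lerDl sumr_ge0// => l _; rewrite sqr_ge0.
have v0 := le_trans (sqr_ge0 _) (vi i).
have jc n : jacobi_coef (coupling t) n ^+ 2 <= 4.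
  rewrite /jacobi_coef; case: odd; last by rewrite expr1n; lra.
  have := coupling_le t; rewrite -(ler_pXn2r (ltn0Sn 1)) ?nnegrE// real_normK ?num_real//.
  by move/le_trans; apply; lra.
rewrite /normsq /= expr0n addr0.
case: eqP => _; first by rewrite (le_trans (jc _))// lerDl.
case: eqP => _; first by rewrite (le_trans (jc _))// lerDl.
case: eqP => _; first by rewrite (le_trans (vi i))// lerDr.
by rewrite expr0n addr_ge0.
Qed.

(** W m k stands for the integrand of the Fourier coefficient at the site (m, k).
    In each row of the fiber the coupling occurs once, next to a column whose
    gauge differs from that of the row by one power of the phase; by
    [phase_coupling] the product becomes 1 + e^(it) or its conjugate, whose
    second term shifts the index m of the character by one. *)
Lemma coef_fiber g : dirint g -> coef (dirint_op fiber g) = schroedinger v (coef g).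
Proof.
move=> Dg; apply/funext => -[n i].
have sg (j : 'I_p) : sqint (fun t => g t j 0) := (dirintP _).1 Dg j.
pose W n k t := column_ext (fun j => g t j 0) k * (phase t ^+ k./2 * chr n t)^*%C.
have s1 m k : sqint (fun t => (phase t ^+ k * chr m t)^*%C).
  apply: sqintJ; apply: (sqint_of_bounded (B := 1)) => [|t _].
    by apply: cmeasM; [exact: cmeasX cmeas_phase|exact: cmeas_chr].
  by rewrite normsqM normsqX normsq_phase normsq_chr expr1n mulr1.
have sext k : sqint (fun t => column_ext (fun j => g t j 0) k).
  have s0 : sqint (fun=> 0 : R[i]).
    by have := sqintZ 0 (@sqint1 R); under eq_fun do rewrite mul0r.
  by case: k => [|k] //=; case: insub => [j|] //=.
have IW m k : cintegrable (W m k) by apply: sqintM; [exact: sext|exact: s1].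
have EW m k : cmean (W m k) = dirichlet (coef g) m k.
  rewrite /W /dirichlet; case: k => [|k] /=.
    by rewrite -[RHS](@cmean0 R); congr cmean; apply/funext => t; rewrite mul0r.
  case: insubP => [j _ jk|kp] /=.
    by rewrite coefE /= /gauge -jk.
  by rewrite -[RHS](@cmean0 R); congr cmean; apply/funext => t; rewrite mul0r.
have pc t : (phase t)^*%C * phase t = 1 by apply: normsq_eq1; exact: normsq_phase.
have ac t : circle t -> phase t * (coupling t)%:C = 1 + expi t by exact: phase_coupling.
have ac' t : circle t -> (phase t)^*%C * (coupling t)%:C = 1 + expi (- t).
  move=> ct; have := congr1 (fun z => z^*%C) (ac t ct).
  rewrite conjcM conjc_real => ->; rewrite -expi_conj.
  by apply/eqP; rewrite eq_complex /= opprD oppr0 !eqxx.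
have chrS m t : (chr m t)^*%C * expi t = (chr (m - 1) t)^*%C.
  rewrite -{1}[t in expi t]mul1r -[1 * t]/((1%:Z)%:~R * t) -/(chr 1 t) !chr_conj -chrD.
  by congr chr; ring.
have chrP m t : (chr m t)^*%C * expi (- t) = (chr (m + 1) t)^*%C.
  have -> : expi (- t) = chr (- 1%:Z) t by rewrite /chr mulrNz mulr1z mulN1r.
  by rewrite !chr_conj -chrD opprD.
rewrite coefE /= /dirint_op /fiber /schroedinger /Delta /potential /=.
have row t : (map_mx (real_complex R) (J (coupling t)) *m g t) i 0 =
    (jacobi_coef (coupling t) i)%:C * column_ext (fun j => g t j 0) i + (v 0 i)%:C * g t i 0 +
  (jacobi_coef (coupling t) i.+1)%:C * column_ext (fun j => g t j 0) i.+2.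
  by rewrite -jacobi_row mxE; apply: eq_bigr => j _; rewrite mxE.
have mid t : (v 0 i)%:C * g t i 0 * (gauge i t * chr n t)^*%C = (v 0 i)%:C * W n i.+1 t.
  by rewrite /W column_ext_ord /gauge mulrA.
have ED : dirichlet (coef g) n i.+1 = coef g (n, i) by rewrite /dirichlet valK.
have [m [im|im]] : exists m, i = m.*2 :> nat \/ i = m.*2.+1 :> nat.
- by exists i./2; have := odd_double_half i; case: (odd i); [right|left]; lia.
- have up1 : uphalf i = m by rewrite im uphalf_half odd_double doubleK.
  have h0 : i./2 = m by rewrite im doubleK.
  have h2 : i.+2./2 = m.+1 by rewrite /= h0.
  have oi : odd i = false by rewrite im odd_double.
  have jc0 a : jacobi_coef a i = 1 :> R by rewrite /jacobi_coef oi.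
  have jc1 a : jacobi_coef a i.+1 = a :> R by rewrite /jacobi_coef /= oi.
  rewrite oi /=.
  rewrite (@eq_cmean _ _ (fun t => W n i t + W (n - 1) i.+2 t + W n i.+2 t + (v 0 i)%:C * W n i.+1 t)).
    rewrite !cmeanD ?cmeanZ ?EW ?ED //; by repeat apply: cintegrableD; try exact: cintegrableZ.
  move=> t ct; rewrite row !mulrDl mid jc0 jc1 mul1r.
  move: (W n i.+1 t) => w; rewrite /W /gauge up1 h0 h2 [_ ^+ m.+1]exprS.
  rewrite (conjcM _ (chr n t)) (conjcM _ (chr (n - 1) t)) ?(conjcM _ (chr n t)) (conjcM (phase t)) -chrS.
  have -> : (coupling t)%:C = (phase t)^*%C * (1 + expi t) by rewrite -ac// mulrA pc mul1r.
  move: (column_ext _ i.+2) (column_ext _ i) => a b.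
  move: (phase t)^*%C (phase t ^+ m)^*%C (chr n t)^*%C => x y z; ring.
- have up1 : uphalf i = m.+1 by rewrite im uphalf_half /= odd_double /= uphalf_double.
  have h0 : i./2 = m by rewrite im /= uphalf_double.
  have h2 : i.+2./2 = m.+1 by rewrite /= h0.
  have oi : odd i by rewrite im /= odd_double.
  have jc0 a : jacobi_coef a i = a :> R by rewrite /jacobi_coef oi.
  have jc1 a : jacobi_coef a i.+1 = 1 :> R by rewrite /jacobi_coef /= oi.
  rewrite oi /=.
  rewrite (@eq_cmean _ _ (fun t => W n i t + W (n + 1) i t + W n i.+2 t + (v 0 i)%:C * W n i.+1 t)).
    rewrite !cmeanD ?cmeanZ ?EW ?ED //; by repeat apply: cintegrableD; try exact: cintegrableZ.
  move=> t ct; rewrite row !mulrDl mid jc0 jc1 mul1r.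
  move: (W n i.+1 t) => w; rewrite /W /gauge up1 h0 h2 [_ ^+ m.+1]exprS.
  rewrite (conjcM _ (chr n t)) (conjcM _ (chr (n + 1) t)) ?(conjcM _ (chr n t)) (conjcM (phase t)) -chrP.
  have := ac' t ct; move: (column_ext _ i.+2) (column_ext _ i) => a b.
  move: (phase t)^*%C (phase t ^+ m)^*%C (chr n t)^*%C => x y z E.
  transitivity ((x * (coupling t)%:C) * (b * y * z) + (v 0 i)%:C * w + a * (x * y * z)); first ring.
  by rewrite E; ring.
Qed.

End Nanoribbon.

(** * Spectrum *)

Section Spectrum.
Variables (R : realType) (N : nat) (v : 'rV[R]_((2 * N).+1)).
Local Notation p := (2 * N).+1.
Local Notation mu := (@lebesgue_measure R).
Local Notation circle := (@circle R).
Local Notation J := (jacobi v).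
Local Notation H := (schroedinger v).
Local Notation fiber := (fiber v).

(** Bounded measurable functions.  They form a ring closed under inverses of
    functions bounded away from 0, so that inverse matrices computed by
    determinants stay bounded. *)
Definition tame (h : R -> R[i]) : Prop :=
  cmeas h /\ exists B : R, forall t, circle t -> normsq (h t) <= B.

Lemma tame_cst c : tame (fun=> c).
Proof. by split; [exact: cmeas_cst|exists (normsq c)]. Qed.

Lemma tameD h k : tame h -> tame k -> tame (fun t => h t + k t).
Proof.
move=> [mh [B HB]] [mk [C HC]]; split; first exact: cmeasD.
exists (2 * B + 2 * C) => t ct; apply: le_trans (normsqD_le _ _) _.
by rewrite lerD// ler_pM2l// ?HB// HC.
Qed.

Lemma tameM h k : tame h -> tame k -> tame (fun t => h t * k t).
Proof.
move=> [mh [B HB]] [mk [C HC]]; split; first exact: cmeasM.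
exists (B * C) => t ct; rewrite normsqM.
by apply: ler_pM; rewrite ?normsq_ge0 ?HB ?HC.
Qed.

Lemma tameJ h : tame h -> tame (fun t => (h t)^*%C).
Proof.
move=> [mh [B HB]]; split; first exact: cmeasJ.
by exists B => t ct; rewrite normsq_conj; exact: HB.
Qed.

Lemma tame_sum (I : Type) (s : seq I) (F : I -> R -> R[i]) :
  (forall i, tame (F i)) -> tame (fun t => \sum_(i <- s) F i t).
Proof.
move=> tF; elim: s => [|i s IH].
  by under eq_fun do rewrite big_nil; exact: tame_cst.
by under eq_fun do rewrite big_cons; exact: tameD.
Qed.

Lemma tame_prod (I : Type) (s : seq I) (F : I -> R -> R[i]) :
  (forall i, tame (F i)) -> tame (fun t => \prod_(i <- s) F i t).
Proof.
move=> tF; elim: s => [|i s IH].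
  by under eq_fun do rewrite big_nil; exact: tame_cst.
by under eq_fun do rewrite big_cons; exact: tameM.
Qed.

Lemma tame_det n (F : R -> 'M[R[i]]_n) : (forall i j, tame (fun t => F t i j)) ->
  tame (fun t => \det (F t)).
Proof.
move=> tF; apply: tame_sum => s.
by apply: tameM; [exact: tame_cst|apply: tame_prod].
Qed.

Lemma tame_adj n (F : R -> 'M[R[i]]_n) : (forall i j, tame (fun t => F t i j)) ->
  forall i j, tame (fun t => (\adj (F t)) i j).
Proof.
move=> tF i j; under eq_fun do rewrite mxE /cofactor.
apply: tameM; first exact: tame_cst.
by apply: tame_det => k l; under eq_fun do rewrite !mxE; exact: tF.
Qed.

(** The denominator is replaced by its maximum with c, which changes nothing on
    the circle and makes the inversion a continuous function. *)
Lemma tame_inv (h : R -> R[i]) (c : R) : tame h -> 0 < c ->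
  (forall t, circle t -> c <= normsq (h t)) -> tame (fun t => (h t)^-1).
Proof.
move=> th c0 hc.
have E (z : R[i]) : z^-1 = z^*%C * ((normsq z)^-1)%:C.
  have [->|z0] := eqVneq z 0; first by rewrite invr0 /normsq /= expr0n addr0 invr0 mulr0.
  apply: (mulfI z0); rewrite mulfV// mulrA mul_conj -rmorphM /= mulfV// normsq_eq0 //.
pose k t : R := (Num.max (normsq (h t)) c)^-1.
have mk : measurable_fun circle k.
  apply: (@measurableT_comp _ _ _ _ _ _ (fun x : R => (Num.max x c)^-1)).
    apply: continuous_measurable_fun => x.
    apply: (@cvgV _ _ _ _ (fun x : R => Num.max x c)); first by rewrite gt_eqF// lt_max c0 orbT.
    by apply: (@continuous_max _ _ (fun x : R => x) (fun=> c)); [exact: cvg_id|exact: cvg_cst].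
  exact: (cmeas_normsq th.1).
have tk : tame (fun t => (k t)%:C).
  split; first exact: cmeas_real.
  exists (c^-1 ^+ 2) => t ct; rewrite /normsq /= expr0n addr0 /k.
  have m0 : 0 < Num.max (normsq (h t)) c by rewrite lt_max c0 orbT.
  apply: lerXn2r; rewrite ?nnegrE ?invr_ge0 ?(ltW m0) ?(ltW c0)//.
  by rewrite lef_pV2 ?posrE// le_max lexx orbT.
have [[m1 m2] [B HB]] := tameM (tameJ th) tk.
have EE t : circle t -> (h t)^-1 = (h t)^*%C * (k t)%:C.
  by move=> ct; rewrite E /k max_l// hc.
split; last by exists B => t ct; rewrite EE ?HB.
split.
  by apply: eq_measurable_fun m1 => t; rewrite inE => /EE ->.
by apply: eq_measurable_fun m2 => t; rewrite inE => /EE ->.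
Qed.

Lemma tame_multiplier (A : R -> 'M[R[i]]_p) : bounded_multiplier A <->
  forall i j, tame (fun t => A t i j).
Proof.
split=> [[mA [B HB]] i j|tA]; first by split=> //; exists B => t ct; exact: HB.
split=> [i j|]; first by have [] := tA i j.
have /choice[B HB] (ij : 'I_p * 'I_p) : exists B : R, forall t, circle t ->
    normsq (A t ij.1 ij.2) <= B by have [] := tA ij.1 ij.2.
exists (\sum_ij `|B ij|) => t i j ct.
apply: le_trans (HB (i, j) t ct) _; apply: le_trans (ler_norm _) _.
by rewrite (bigD1 (i, j))//= lerDl sumr_ge0.
Qed.

Lemma coupling02 (t : R) : coupling t \in `[0, 2].
Proof.
rewrite in_itv /=; have := coupling_le t.
by rewrite ger0_norm ?mulr_ge0// => ->; rewrite mulr_ge0.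
Qed.

Variable lam : int -> R -> R.
Hypothesis Hlam : forall a : R, a \in `[0, 2] ->
  ordered_eigenvalues (J a) (fun k => lam k a).

Lemma det_fiber z t : \det (z%:M - fiber t) =
  \prod_(i < p) (z - (lam (i%:Z - N%:Z) (coupling t))%:C).
Proof.
have -> : \det (z%:M - fiber t) = (char_poly (fiber t)).[z].
  rewrite -horner_evalE -det_map_mx; congr (\det _).
  apply/matrixP => i j; rewrite !mxE /= /horner_eval hornerD hornerN hornerC.
  by case: (i == j); rewrite ?mulr1n ?mulr0n ?hornerX ?horner0.
rewrite /fiber -map_char_poly (Hlam (coupling02 t)).1 rmorph_prod horner_prod.
by apply: eq_bigr => i _; rewrite rmorphB /= map_polyX map_polyC /= hornerXsubC.
Qed.

Lemma index_bounds (i : 'I_p) : - N%:Z <= i%:Z - N%:Z <= N%:Z.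
Proof. by have := ltn_ord i; lia. Qed.

(** A continuous positive function on [0, 2] has a positive minimum. *)
Lemma band_distance z k : - N%:Z <= k <= N%:Z ->
  ~ (real_complex R @` (lam k @` `[0, 2]%classic)) z ->
  exists2 c : R, 0 < c & forall a, a \in `[0, 2] -> c <= normsq (z - (lam k a)%:C).
Proof.
move=> kN nz.
have cf : {within `[0, 2], continuous (fun a => (complex.Re z - lam k a) ^+ 2 + (complex.Im z) ^+ 2)}.
  have /subspace_continuousP ca := band_continuous Hlam kN.
  apply/subspace_continuousP => a /ca {}ca.
  apply: cvgD; last exact: cvg_cst.
  by apply: cvgM; apply: cvgB => //; exact: cvg_cst.
have E a : normsq (z - (lam k a)%:C) = (complex.Re z - lam k a) ^+ 2 + (complex.Im z) ^+ 2.
  by case: (z) => x y; rewrite /normsq /= oppr0 addr0.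
have [a a02 Ha] := EVT_min (@ler0n R 2) cf.
exists (normsq (z - (lam k a)%:C)).
  rewrite lt_neqAle normsq_ge0 andbT eq_sym normsq_eq0 subr_eq0.
  by apply/eqP => e; apply: nz; exists (lam k a) => //; exists a.
by move=> b b02; rewrite !E; exact: Ha.
Qed.

(** The inverse is given by the adjugate, divided by a determinant which is
    bounded away from 0. *)
Lemma resolvent_off_bands z :
  (forall k : int, - N%:Z <= k <= N%:Z -> ~ (real_complex R @` (lam k @` `[0, 2]%classic)) z) ->
  resolvent_set H z.
Proof.
move=> nz.
have /choice[c Hc] (i : 'I_p) : exists c : R, 0 < c /\
    forall a, a \in `[0, 2] -> c <= normsq (z - (lam (i%:Z - N%:Z) a)%:C).
  by have [c c0 H] := band_distance (index_bounds i) (nz _ (index_bounds i)); exists c.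
have Dlow t : \prod_i c i <= normsq (\det (z%:M - fiber t)).
  rewrite det_fiber (big_morph (@normsq R) (@normsqM R) (_ : normsq 1 = 1)); last first.
    by rewrite /normsq /= expr1n expr0n addr0.
  by apply: ler_prod => i _; rewrite ltW ?(Hc i).1//= (Hc i).2// coupling02.
have c0 : 0 < \prod_i c i by apply: prodr_gt0 => i _; exact: (Hc i).1.
have tE : forall i j, tame (fun t => (z%:M - fiber t) i j).
  have [_ t1] := tame_multiplier fiber; have t2 := (tame_multiplier fiber).1 (fiber_bounded v).
  move=> i j; under eq_fun do rewrite mxE.
  apply: tameD; first exact: tame_cst.
  under eq_fun do rewrite mxE -mulN1r.
  by apply: tameM; [exact: tame_cst|exact: t2].
pose M t : 'M[R[i]]_p := - (\det (z%:M - fiber t))^-1 *: \adj (z%:M - fiber t).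
apply: (resolvent_of_inverse (@cmeas_gauge R N) (@normsq_gauge R N) (fiber_bounded v) (@coef_fiber _ _ v) (M := M)).
  apply/tame_multiplier => i j; rewrite /M; under eq_fun do rewrite mxE.
  apply: tameM; last exact: tame_adj.
  under eq_fun do rewrite -mulN1r.
  by apply: tameM; [exact: tame_cst|apply: (tame_inv (tame_det tE) c0) => t _].
move=> t ct; have D0 : \det (z%:M - fiber t) != 0.
  by rewrite -normsq_eq0 gt_eqF// (lt_le_trans c0).
rewrite /M -[fiber t - _]opprB -!scalemxAr -!scalemxAl mulNmx mulmxN mul_mx_adj mul_adj_mx.
by rewrite scalerN scaleNr opprK scale_scalar_mx mulVf.
Qed.

(** The parameter is sought in [0, pi], which leaves room for an arc to its
    right inside the circle. *)
Lemma coupling_surjective (a : R) : a \in `[0, 2] ->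
  exists2 t : R, 0 <= t <= pi & coupling t = a.
Proof.
rewrite in_itv /= => /andP[a0 a2].
have [|/andP[t0 tpi] ct] := @acos_def R (a / 2); first by apply/andP; split; lra.
have tpi2 : acos (a / 2) <= pi / 2.
  rewrite leNgt; apply/negP => lt; have : 0 <= cos (acos (a / 2)) by rewrite ct; lra.
  have := lt; rewrite -ltr_cos ?in_itv /= ?t0 ?tpi ?divr_ge0 ?pi_ge0//=; last by have := pi_ge0 R; lra.
  by rewrite cos_pihalf => h1 h2; lra.
exists (2 * acos (a / 2)); first by apply/andP; split; lra.
by rewrite /coupling mulrAC mulfV// mul1r ct ger0_norm; lra.
Qed.

Lemma jacobi_lipschitz (a b : R) i j : (J a i j - J b i j) ^+ 2 <= (a - b) ^+ 2.
Proof.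
have jc n : (jacobi_coef a n - jacobi_coef b n) ^+ 2 <= (a - b) ^+ 2.
  by rewrite /jacobi_coef; case: odd => //; rewrite subrr expr0n sqr_ge0.
rewrite !mxE; case: eqP => _; first exact: jc.
case: eqP => _; first exact: jc.
by case: eqP => _; rewrite subrr expr0n sqr_ge0.
Qed.

Lemma jacobi_eigenvector a k : a \in `[0, 2] -> - N%:Z <= k <= N%:Z ->
  exists2 y : 'cV[R]_p, y != 0 & J a *m y = lam k a *: y.
Proof.
move=> a02 kN; have [n np kE] := int_index kN.
have : eigenvalue (J a) (lam k a).
  rewrite eigenvalue_root_char (ordered_spec_seq (Hlam a02)).1 root_prod_XsubC.
  by rewrite kE -(@nth_spec_seq _ _ (lam^~ a))// mem_nth// size_spec_seq.
case/eigenvalueP => y yE y0; exists y^T; first by rewrite trmx_eq0.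
by rewrite -(jacobi_sym v a) -trmx_mul yE linearZ.
Qed.

(** The eigenvector y of J_a cut off to an arc [s, s + r) on which the coupling
    stays close to a = a(s).  On the arc, (J_(a(t)) - lam) y = (J_(a(t)) - J_a) y
    is small compared with y. *)
Lemma bands_in_spectrum k a : - N%:Z <= k <= N%:Z -> a \in `[0, 2] ->
  spectrum H (lam k a)%:C.
Proof.
move=> kN a02; have [y y0 Hy] := jacobi_eigenvector a02 kN.
have [s /andP[s0 spi] sa] := coupling_surjective a02.
apply: (spectrum_of_approximate_eigenvector (@cmeas_gauge R N) (@normsq_gauge R N) (fiber_bounded v) (@coef_fiber _ _ v)).
move=> e e0.
pose Y : R := \sum_i (y i 0) ^+ 2.
have Y0 : 0 < Y.
  rewrite lt_neqAle sumr_ge0 ?andbT; last by move=> i _; rewrite sqr_ge0.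
  apply: contraNneq y0 => Y0; apply/eqP/colP => i; rewrite mxE; apply/eqP.
  rewrite -sqrf_eq0 eq_le sqr_ge0 andbT; rewrite [leRHS]Y0 /Y (bigD1 i)//= lerDl.
  by rewrite sumr_ge0// => l _; rewrite sqr_ge0.
(* The constant lost when summing the p rows by normsq_sum_le. *)
pose K : R := p%:R * 2 ^+ p.
have K0 : 0 < K by rewrite mulr_gt0 ?exprn_gt0.
have eK : 0 < Num.sqrt (e / K) by rewrite sqrtr_gt0 divr_gt0.
have /cvgrPdist_le/(_ _ eK)/nbhs_ballP[d /= d0 Hd] := continuous_coupling (x := s).
(* r <= pi keeps the arc inside the circle. *)
pose r := Num.min d pi.
have r0 : 0 < r by rewrite lt_min d0 pi_gt0.
pose S : set R := `[s, s + r[%classic.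
have mS : measurable S by exact: measurable_itv.
have rpi : r <= pi by rewrite ge_min lexx orbT.
have S_circle : S `<=` circle.
  move=> t /=; rewrite /S /Defs.circle /= !in_itv /= => /andP[t1 t2].
  by rewrite (le_trans s0)//=; have := pi_ge0 R; lra.
have S_close t : S t -> (coupling t - a) ^+ 2 <= e / K.
  rewrite /S /= in_itv /= => /andP[t1 t2].
  have : `|coupling s - coupling t| <= Num.sqrt (e / K).
    apply: Hd; rewrite /ball /= distrC ger0_norm; last by lra.
    by apply: lt_le_trans (_ : r <= d); [lra|rewrite ge_min lexx].
  rewrite sa distrC => h; rewrite -[e / K]sqr_sqrtr; last by rewrite divr_ge0 ?ltW.
  by rewrite -real_normK ?num_real// lerXn2r ?nnegrE ?sqrtr_ge0.
pose g (t : R) : 'cV[R[i]]_p := \col_i (\1_S t * y i 0)%:C.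
have gE t i : g t i 0 = (\1_S t * y i 0)%:C by rewrite mxE.
have ng t : \sum_(i < p) normsq (g t i 0) = Y * \1_S t.
  rewrite /Y mulr_suml; apply: eq_bigr => i _; rewrite gE /normsq /= expr0n addr0.
  by rewrite indicE; case: (_ \in _); rewrite /= ?mul1r ?mulr1 ?mul0r ?mulr0 ?expr0n.
have Dg : dirint g.
  apply/dirintP => i; under eq_fun do rewrite gE.
  apply: (sqint_of_bounded (B := (y i 0) ^+ 2)).
    apply: cmeas_real; apply: measurable_funM; last exact: measurable_cst.
    exact: measurable_indic.
  move=> t _; rewrite /normsq /= expr0n addr0 indicE.
  by case: (_ \in _); rewrite /= ?mul1r ?mul0r ?expr0n ?sqr_ge0.
exists g; split=> //.
  rewrite -lte_fin -dirint_nrm2// /dirint_sqnorm.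
  have -> : (\int[mu]_(t in circle) (\sum_(i < p) ComplexField.Normc.normc (g t i 0%R) ^+ 2)%:E =
      Y%:E * \int[mu]_(t in circle) (\1_S t)%:E)%E.
    rewrite -(ge0_integralZl _ (@measurable_circle R)) ?lee_fin ?(ltW Y0)//; last first.
      by apply/measurable_EFinP; exact: measurable_indic.
    apply: eq_integral => t _; rewrite -EFinM -ng; congr EFin.
    by apply: eq_bigr => i _; rewrite normc_sqr.
  rewrite integral_indic//; last exact: measurable_circle.
  have muS : mu S = r%:E.
    have := @lebesgue_measure_itv R `[s, s + r[.
    by rewrite /= lte_fin ltrDl r0 -EFinB [X in X - s]addrC addrK.
  by rewrite setIidl// [X in (_ * (_ * X))%E]muS -!EFinM lte_fin !mulr_gt0 ?invr_gt0 ?mulr_gt0 ?pi_gt0.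
apply: nrm2_le => //; first by exact: (dirint_mulmx (shifted_multiplier (fiber_bounded v) _) Dg).
  exact: ltW.
move=> t ct; have [St|nSt] := pselect (S t); last first.
  rewrite ng indicE memNset// mulr0 mulr0 big1// => i _.
  rewrite /dirint_op mxE big1 ?/normsq /= ?expr0n ?addr0// => j _.
  by rewrite gE indicE memNset// mul0r mulr0.
have gy : g t = map_mx (real_complex R) y.
  by apply/colP => i; rewrite gE mxE indicE mem_set// mul1r.
have -> : dirint_op (fun t => fiber t - (lam k a)%:C%:M) g t =
    map_mx (real_complex R) ((J (coupling t) - J a) *m y).
  rewrite /dirint_op gy mulmxBl mul_scalar_mx mulmxBl Hy.
  by rewrite [RHS]map_mxB map_mxM map_mxZ.
have -> : e * \sum_(i < p) normsq (g t i 0) = \sum_(i < p) (2 ^+ p * (e / K * Y)).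
  rewrite ng indicE mem_set// mulr1 sumr_const card_ord -[RHS]mulr_natl.
  by rewrite [RHS]mulrA -/K [RHS]mulrA [K * _]mulrC divfK// gt_eqF.
apply: ler_sum => i _; rewrite mxE mxE rmorph_sum.
apply: le_trans (normsq_sum_le _ _) _.
rewrite -[index_enum _]enumT size_enum_ord ler_wpM2l ?exprn_ge0// /Y mulr_sumr.
rewrite -[index_enum _]enumT; apply: ler_sum => j _; rewrite /normsq /= expr0n addr0 exprMn ler_wpM2r ?sqr_ge0//.
by rewrite mxE [X in _ + X]mxE; apply: le_trans (jacobi_lipschitz _ _ _ _) (S_close _ St).
Qed.

Lemma spectrum_bands : spectrum H = \bigcup_(k in [set k : int | - N%:Z <= k <= N%:Z])
  (real_complex R @` (lam k @` `[0, 2]%classic)).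
Proof.
apply/seteqP; split=> [z sz|z [k kN [_ [a a02 <-] <-]]]; last exact: bands_in_spectrum.
apply: contrapT => nz; apply: sz; apply: resolvent_off_bands => k kN kz.
by apply: nz; exists k.
Qed.

End Spectrum.

Theorem theorem1p1 (R : realType) (N : nat) (hN : (1 <= N)%N)
    (v : 'rV[R]_((2 * N).+1)) :
  unitarily_equivalent (schroedinger v)
    (dirint_op (fun t : R =>
       map_mx (real_complex R) (jacobi v (2 * `|cos (t / 2)|))))
  /\
  (exists lam : int -> R -> R, forall a : R, a \in `[0, 2] ->
     ordered_eigenvalues (jacobi v a) (fun k => lam k a))
  /\
  (forall lam : int -> R -> R,
     (forall a : R, a \in `[0, 2] ->
        ordered_eigenvalues (jacobi v a) (fun k => lam k a)) ->
     [/\ spectrum (schroedinger v) =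
           \bigcup_(k in [set k : int | - N%:Z <= k <= N%:Z])
             (real_complex R @` (lam k @` `[0, 2]%classic)),
         exists lam_minus lam_plus : int -> R,
           forall k : int, - N%:Z <= k <= N%:Z ->
             lam k @` `[0, 2]%classic =
               if 0 <= k then `[lam_minus k, lam_plus k]%classic
               else `[lam_plus k, lam_minus k]%classic,
         forall k : int, - N%:Z <= k <= N%:Z ->
           real_analytic_on `[0, 2] (lam k)
       & forall a : R, a \in `[0, 2] -> a != 0 ->
           forall j k : int, - N%:Z <= j -> j < k -> k <= N%:Z ->
             lam j a < lam k a]).
Proof.
split.
  exact: (unitarily_equivalent_multiplication (@cmeas_gauge R N) (@normsq_gauge R N)
    (fiber_bounded v) (@coef_fiber _ _ v)).
split; first by have [lam Hlam] := jacobi_ordered_eigenvalues v; exists lam => a _.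
move=> lam Hlam; split.
- exact: spectrum_bands.
- have /choice[I HI] k : exists I : R * R, - N%:Z <= k <= N%:Z ->
      lam k @` `[0, 2]%classic = `[I.1, I.2]%classic.
    have [kN|kN] := boolP (- N%:Z <= k <= N%:Z); last by exists (0, 0).
    by have [l [u E]] := band_image Hlam kN; exists (l, u).
  exists (fun k => if 0 <= k then (I k).1 else (I k).2).
  exists (fun k => if 0 <= k then (I k).2 else (I k).1).
  by move=> k /HI ->; case: (0 <= k).
- by move=> k kN; exact: (band_analytic Hlam kN).
- by move=> a a02 a0 j k jN jk kN; exact: (band_strict Hlam).
Qed.
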